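(* Suppose $0\le Z_t\le 1$ with probability 1 for all $t\in\{1,\ldots,T\}$, and that the simulation and reward-evaluation oracles with unit costs $C$ and $G$ described in the context are available. Then for any $\epsilon,\delta\in(0,1)$, Algorithm $\mathcal A(\epsilon,\delta)$ of the context, in total computational time at most $$(C+G+1)\times(1+\log(\delta^{-1}))\times\exp(100\,\epsilon^{-2})\times T^{8\epsilon^{-1}},$$ returns a random number $X$ satisfying $P\big(|X-\mathrm{OPT}|\le\epsilon\big)\ge 1-\delta$.
   Context: Problem. Let $T,D\ge 1$ be integers. $\mathbf Y=(Y_1,\ldots,Y_T)$ is an arbitrary (possibly non-Markovian) discrete-time stochastic process, each $Y_t$ being a random vector in $\mathbb R^D$; $Y_{[t]}=(Y_1,\ldots,Y_t)$. For a $D\times T$ matrix $M$, $M_{[t]}$ denotes its first $t$ columns. $\mathcal F$ is the natural filtration of $\mathbf Y$. For each $t$, $g_t:\mathbb R^{D\times t}\to\mathbb R$ is measurable and $Z_t=g_t(Y_{[t]})$ is the (integrable, non-negative) reward for stopping at $t$. $\mathcal T$ is the set of stopping times adapted to $\mathcal F$ with values in $\{1,\ldots,T\}$, and $\mathrm{OPT}=\sup_{\tau\in\mathcal T}E[Z_\tau]$, assumed strictly positive. Oracles. For every $t\in\{0,\ldots,T\}$ and $\gamma\in\mathbb R^{D\times t}$, a call $\mathcal B(t,\gamma)$ returns a fresh independent sample of a $D\times T$ matrix distributed as $\mathbf Y$ conditioned on $\{Y_{[t]}=\gamma\}$ (unconditioned if $t=0$, $\gamma=\emptyset$), at cost $C$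 units of time; evaluating any $g_t$ on any given partial trajectory costs $G$ units of time. ($C$ and $G$ are assumed to scale at most polynomially in $T$ and $D$.) Computational model. Computation is over real numbers. Each addition, subtraction, multiplication, division, maximum or minimum of two numbers, or raising of a number to a power, costs one unit; the median of $n$ numbers costs $n$ units; reading, writing, storing and passing numbers is free; sampling a standard Bernoulli, uniform on $[0,1]$ or standard normal variable costs one unit. The median of $x_1\le\cdots\le x_n$ is $\frac12(x_{\lfloor (n+1)/2\rfloor}+x_{\lfloor n/2\rfloor+1})$. Let $N(\epsilon,\eta)=\lceil\frac1{2\epsilon^2}\log(\frac2\eta)\rceil$. Algorithms $\mathcal B^k(t,\gamma,\epsilon,\delta)$, $k\ge1$ (recursively defined; all calls use independent randomness). $\mathcal B^1(t,\gamma,\epsilon,\delta)$ returns $g_t(\gamma)$. $\mathcal B^{k+1}(t,\gamma,\epsilon,\delta)$: let $N=N(\frac\epsilon4,\frac1{16})$. For each $s=1,\ldots,\lceil 8\log(2\delta^{-1})\rceil$: let $A^3$ be the output of $\mathcal B^k(t,\gamma,\frac\epsilon2,\frac18)$; for $i=1,\ldots,N$, draw $\mathbf A^1$ by a call $\mathcal B(t,\gamma)$, let $A^2_j$ be the output of $\mathcal B^k(j,\mathbf A^1_{[j]},\frac\epsilon4,\frac1{16NT})$ for $j=1,\ldots,T$, and set $A^0_i=\max_jA^2_j$; set $A^m_s=A^3-N^{-1}\sum_{i=1}^NA^0_i$. Return the median of $(A^m_s)_s$. Algorithm $\mathcal A(\epsilon,\delta)$: let $k=\lceil\frac2\epsilon\rceil$,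 $\alpha=\frac\epsilon2\lceil\frac2\epsilon\rceil^{-1}$, $\beta=\delta\lceil\frac2\epsilon\rceil^{-1}$, $N'=N(\frac\alpha2,\frac18)$. For each $l=1,\ldots,k$: for each $s=1,\ldots,\lceil8\log(2\beta^{-1})\rceil$, do: for $i=1,\ldots,N'$, draw $\mathbf A^1$ by a call $\mathcal B(0,\emptyset)$, let $A^2_j$ be the output of $\mathcal B^l(j,\mathbf A^1_{[j]},\frac\alpha2,\frac1{8N'T})$ for $j=1,\ldots,T$, and set $A^0_i=\max_jA^2_j$; set $A^l_s=(N')^{-1}\sum_{i=1}^{N'}A^0_i$. Let $\hat L_l$ be the median of $(A^l_s)_s$. Return $\sum_{l=1}^k\hat L_l$. *)

(* Defs.v *)
From HB Require Import structures.
From mathcomp Require Import all_boot all_order all_algebra.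
From mathcomp Require Import all_classical all_reals all_analysis.

Set Implicit Arguments.
Unset Strict Implicit.
Unset Printing Implicit Defensive.

Import Order.TTheory GRing.Theory Num.Theory.
Import numFieldNormedType.Exports.

Local Open Scope classical_set_scope.
Local Open Scope ring_scope.

(* The sigma-algebra on matrices generated by the entries, i.e. the Borel
   sigma-algebra of R^(m x n); for n = 0 it is the trivial one on a point. *)
Section measurable_matrix.
Context (R : realType) (m n : nat).

Definition mx_entry_preimages : set (set 'M[R]_(m, n)) :=
  \bigcup_(ij in [set: 'I_m * 'I_n])
    preimage_set_system setT (fun M : 'M[R]_(m, n) => M ij.1 ij.2) measurable.

Let mx_measurable0 : <<s mx_entry_preimages >> set0.
Proof. exact: sigma_algebra0. Qed.

Let mx_measurableC A :
  <<s mx_entry_preimages >> A -> <<s mx_entry_preimages >> (~` A).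
Proof. exact: sigma_algebraC. Qed.

Let mx_measurable_bigcup (F : (set 'M[R]_(m, n))^nat) :
  (forall i, <<s mx_entry_preimages >> (F i)) ->
  <<s mx_entry_preimages >> (\bigcup_i (F i)).
Proof. exact: sigma_algebra_bigcup. Qed.

HB.instance Definition _ := @isMeasurable.Build (sigma_display mx_entry_preimages)
  'M[R]_(m, n) <<s mx_entry_preimages >>
  mx_measurable0 mx_measurableC mx_measurable_bigcup.

End measurable_matrix.

(* Times are elements of 'I_T.+1 = {0, ..., T}; the stopping dates {1, ..., T}
   are its positive elements. [prefix t M] is M_[t]. *)
Definition prefix (R : realType) (T D : nat) (t : 'I_T.+1) (M : 'M[R]_(D, T)) :
    'M[R]_(D, t) :=
  colsub (widen_ord (leq_ord t)) M.

(* [date j], for j in {0, ..., T-1}, is the date j+1. *)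
Definition date (T : nat) (j : 'I_T) : 'I_T.+1 := lift ord0 j.

Section optimal_stopping.
Context d (Omega : measurableType d) (R : realType) (P : probability Omega R).
Context (T D : nat) (Y : Omega -> 'M[R]_(D, T)).
Context (g : forall t : 'I_T.+1, 'M[R]_(D, t) -> R).

Definition stop_reward (t : 'I_T.+1) (w : Omega) : R := g (prefix t (Y w)).

Definition natural_filtration (t : 'I_T.+1) : set (set Omega) :=
  g_sigma_algebra_preimage (fun w => prefix t (Y w)).

Definition stopping_time (tau : Omega -> 'I_T.+1) : Prop :=
  (forall w, (0 < tau w)%N) /\
  (forall t : 'I_T.+1, natural_filtration t [set w | (tau w <= t)%N]).

Definition OPT : \bar R :=
  ereal_sup [set 'E_P[fun w => stop_reward (tau w) w]%E | tau in stopping_time].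

(* [kappa] is a regular version of the conditional law of Y given Y_[t]. For
   t = 0 the only prefix is the empty one, and this says that kappa is the law
   of Y. *)
Definition conditional_law (t : 'I_T.+1)
    (kappa : R.-pker 'M[R]_(D, t) ~> 'M[R]_(D, T)) : Prop :=
  forall (A : set 'M[R]_(D, t)) (B : set 'M[R]_(D, T)),
    measurable A -> measurable B ->
    P ([set w | A (prefix t (Y w))] `&` [set w | B (Y w)]) =
    (\int[P]_(w in [set w | A (prefix t (Y w))]) kappa (prefix t (Y w)) B)%E.

End optimal_stopping.

(* x_1 <= ... <= x_n being the sorted list, with 1-based indices, this is
   (x_{floor((n+1)/2)} + x_{floor(n/2)+1}) / 2. *)
Definition median (R : realType) (s : seq R) : R :=
  let x := nth 0 (sort <=%R s) in
  (x ((size s).+1./2.-1) + x ((size s)./2)) / 2.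

(* Randomized real-number programs, as trees of primitive instructions; the
   continuation receives the answer of the instruction. *)
Section programs.
Context (R : realType) (T D : nat).

Variant operation :=
  | Add of R & R | Sub of R & R | Mul of R & R | Div of R & R
  | Max of R & R | Min of R & R | Pow of R & R | Log of R.

Definition operation_value (o : operation) : R :=
  match o with
  | Add x y => x + y
  | Sub x y => x - y
  | Mul x y => x * y
  | Div x y => x / y
  | Max x y => Num.max x y
  | Min x y => Num.min x y
  | Pow x y => x `^ y
  | Log x => ln x
  end.

Inductive prog (A : Type) : Type :=
  | Ret of A
  | Operation of operation & (R -> prog A)
  | Ceiling of R & (nat -> prog A)
  | Median of seq R & (R -> prog A)
  | EvalReward (t : 'I_T.+1) of 'M[R]_(D, t) & (R -> prog A)
  | CallOracle (t : 'I_T.+1) of 'M[R]_(D, t) & ('M[R]_(D, T) -> prog A).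

Fixpoint bind A B (p : prog A) (f : A -> prog B) : prog B :=
  match p with
  | Ret a => f a
  | Operation o k => Operation o (fun x => bind (k x) f)
  | Ceiling x k => Ceiling x (fun n => bind (k n) f)
  | Median s k => Median s (fun x => bind (k x) f)
  | EvalReward t gamma k => EvalReward gamma (fun x => bind (k x) f)
  | CallOracle t gamma k => CallOracle gamma (fun M => bind (k M) f)
  end.

(* The values of ceilings in programs are nonnegative. *)
Definition nat_ceil (x : R) : nat := `|Num.ceil x|%N.

(* [runs_within C G g p b]: whatever the oracle answers, running p takes time at
   most b. The model lists no price for logarithms and ceilings; they are
   charged one unit, like the other operations. *)
Fixpoint runs_within (C G : R) (g : forall t : 'I_T.+1, 'M[R]_(D, t) -> R)
    A (p : prog A) (b : R) : Prop :=
  match p with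
  | Ret _ => 0 <= b
  | Operation o k => runs_within C G g (k (operation_value o)) (b - 1)
  | Ceiling x k => runs_within C G g (k (nat_ceil x)) (b - 1)
  | Median s k => runs_within C G g (k (median s)) (b - (size s)%:R)
  | EvalReward t gamma k => runs_within C G g (k (g t gamma)) (b - G)
  | CallOracle t gamma k => forall M, runs_within C G g (k M) (b - C)
  end.

(* [output_prob g kappa p E] is the probability that p returns a value in E.
   Integrating out every answer separately, against kappa_t(gamma), makes each
   oracle call a fresh sample, independent of all the previous ones. *)
Fixpoint output_prob (g : forall t : 'I_T.+1, 'M[R]_(D, t) -> R)
    (kappa : forall t : 'I_T.+1, R.-pker 'M[R]_(D, t) ~> 'M[R]_(D, T))
    A (p : prog A) (E : set A) : \bar R :=
  match p with
  | Ret a => (\1_E a)%:E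
  | Operation o k => output_prob g kappa (k (operation_value o)) E
  | Ceiling x k => output_prob g kappa (k (nat_ceil x)) E
  | Median s k => output_prob g kappa (k (median s)) E
  | EvalReward t gamma k => output_prob g kappa (k (g t gamma)) E
  | CallOracle t gamma k =>
      (\int[kappa t gamma]_M output_prob g kappa (k M) E)%E
  end.

Definition output_law (g : forall t : 'I_T.+1, 'M[R]_(D, t) -> R)
    (kappa : forall t : 'I_T.+1, R.-pker 'M[R]_(D, t) ~> 'M[R]_(D, T))
    (p : prog R) (mu : probability R R) : Prop :=
  forall E : set R, measurable E -> mu E = output_prob g kappa p E.

End programs.

Declare Scope prog_scope.
Delimit Scope prog_scope with prog.
Notation "x <- p ;; q" := (bind p (fun x => q))
  (at level 100, p at next level, right associativity) : prog_scope.

Section algorithms.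
Context (R : realType) (T D : nat).
Local Notation prog := (prog R T D).
Local Open Scope prog_scope.

Definition ret A (a : A) : prog A := Ret R T D a.
Definition op (o : operation R) : prog R := Operation o (@ret R).
Definition ceiling (x : R) : prog nat := Ceiling x (@ret nat).
Definition med (s : seq R) : prog R := Median s (@ret R).
Definition eval_reward (t : 'I_T.+1) (gamma : 'M[R]_(D, t)) : prog R :=
  EvalReward gamma (@ret R).
Definition call_oracle (t : 'I_T.+1) (gamma : 'M[R]_(D, t)) :
    prog 'M[R]_(D, T) :=
  CallOracle gamma (@ret _).

Fixpoint for_each I A (s : seq I) (body : I -> prog A) : prog (seq A) :=
  if s is i :: s' then
    a <- body i ;; r <- for_each s' body ;; ret (a :: r)
  else ret [::].

(* n - 1 operations on a list of n > 0 numbers *)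
Fixpoint fold_from (o : R -> R -> operation R) (x : R) (s : seq R) :
    prog R :=
  if s is y :: s' then z <- op (o x y) ;; fold_from o z s' else ret x.
Definition fold_op (o : R -> R -> operation R) (s : seq R) : prog R :=
  if s is x :: s' then fold_from o x s' else ret 0.
Definition maximum := fold_op (@Max R).
Definition total := fold_op (@Add R).

(* n^-1 * (sum of s) *)
Definition average (n : nat) (s : seq R) : prog R :=
  v <- op (Div 1 n%:R) ;; S <- total s ;; op (Mul v S).

(* N(eps, eta) = ceil (1 / (2 eps^2) * log (2 / eta)) *)
Definition sample_size (eps eta : R) : prog nat :=
  e2 <- op (Pow eps 2) ;; e2' <- op (Mul 2 e2) ;; v <- op (Div 1 e2') ;;
  q <- op (Div 2 eta) ;; l <- op (Log q) ;;
  x <- op (Mul v l) ;; ceiling x.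

(* ceil (8 log (2 delta^-1)) *)
Definition repetitions (delta : R) : prog nat :=
  v <- op (Div 1 delta) ;; q <- op (Mul 2 v) ;; l <- op (Log q) ;;
  x <- op (Mul 8 l) ;; ceiling x.

(* 1 / (c N T) *)
Definition failure_prob (c : R) (N : nat) : prog R :=
  x <- op (Mul c N%:R) ;; y <- op (Mul x T%:R) ;; op (Div 1 y).

(* [algB k] is B^(k+1): the recursion starts at k = 0 with B^1. *)
Fixpoint algB (k : nat) (t : 'I_T.+1) (gamma : 'M[R]_(D, t)) (eps delta : R) :
    prog R :=
  if k is k'.+1 then
    e <- op (Div eps 4) ;;
    N <- sample_size e (1 / 16) ;;
    n <- repetitions delta ;;
    Am <- for_each (iota 1 n) (fun s =>
      e2 <- op (Div eps 2) ;;
      A3 <- algB k' gamma e2 (1 / 8) ;;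
      A0 <- for_each (iota 1 N) (fun i =>
        A1 <- call_oracle gamma ;;
        A2 <- for_each (enum 'I_T) (fun j =>
          e4 <- op (Div eps 4) ;;
          eta <- failure_prob 16 N ;;
          algB k' (prefix (date j) A1) e4 eta) ;;
        maximum A2) ;;
      m <- average N A0 ;;
      op (Sub A3 m)) ;;
    med Am
  else eval_reward gamma.

(* The l-th iteration, l = 1, ..., k, calls B^l = [algB l.-1]. *)
Definition algA (eps delta : R) : prog R :=
  q <- op (Div 2 eps) ;;
  k <- ceiling q ;;
  v <- op (Div 1 k%:R) ;;
  h <- op (Div eps 2) ;;
  alpha <- op (Mul h v) ;;
  beta <- op (Mul delta v) ;;
  a <- op (Div alpha 2) ;;
  N <- sample_size a (1 / 8) ;;
  L <- for_each (iota 1 k) (fun l =>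
    n <- repetitions beta ;;
    Al <- for_each (iota 1 n) (fun s =>
      A0 <- for_each (iota 1 N) (fun i =>
        A1 <- call_oracle (0 : 'M[R]_(D, @ord0 T)) ;;
        A2 <- for_each (enum 'I_T) (fun j =>
          a2 <- op (Div alpha 2) ;;
          eta <- failure_prob 8 N ;;
          algB l.-1 (prefix (date j) A1) a2 eta) ;;
        maximum A2) ;;
      average N A0) ;;
    med Al) ;;
  total L.

End algorithms.

(* Main.v *)
Require Import Defs.
From HB Require Import structures.
From mathcomp Require Import all_boot all_order all_algebra.
From mathcomp Require Import all_classical all_reals all_analysis.
From mathcomp Require Import measurable_realfun.
From mathcomp Require Import zify ring lra.

Set Implicit Arguments.
Unset Strict Implicit.
Unset Printing Implicit Defensive.

Import Order.TTheory GRing.Theory Num.Theory.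
Import numFieldNormedType.Exports.

Local Open Scope classical_set_scope.
Local Open Scope ring_scope.

(** Write [value 0] for the rewards truncated to the interval from 0 to 1; along
almost every path this is the reward itself. From the reward process
[value k], subtract the martingale of the conditional expectations of its
pathwise maximum [max_value k]: this is [value k.+1]. By optional stopping
the optimal value drops by exactly E[max_value k] in each step, so that for
every k it is the sum of E[max_value l] over l <= k plus the supremum over
stopping times of the mean of [value k.+1]. The remainder is small for a
pathwise reason. Almost surely, for k >= 1 the rewards [value k] are nonpositive
and nondecreasing in k, hence so is their maximum. At the last date conditioning
has no effect, so the values there telescope to value 0 - sum_(l < k) max_value l.
Comparing the two facts, the k.+1 nonpositive and nondecreasing maxima
[max_value 1], ..., [max_value k.+1] have a sum of at least -1, and the last of
them is at least -1/(k+1). Stopping at the first date where [value k.+1] reaches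
this level loses at most 1/(k+1) ([OPT_expansion]).

The algorithms estimate the terms of this sum: [algB k] approximates [value k],
and [algA] adds up estimates of E[max_value l] for l < k = ceil(2/eps), each
within eps/(2k). A mean of simulated maxima is accurate by Hoeffding's
inequality and a union bound over the inexact recursive calls
([pr_mean_deviation]); this makes a run fail with probability at most 1/4, and
the median over repetitions makes the failure probability exponentially small
([pr_median_deviation]). Hoeffding's inequality needs the maxima to lie in an
interval of length 1, which holds only almost surely, so [algB k] is shown
accurate along almost every path; a property of almost every path also holds
almost surely under the conditional law given almost every past ([ae_kernel]),
so the induction on k goes through ([ae_accurate]).

Probabilities of events of a run are expectations [expect], defined by recursion
on the program. Integrals of nonnegative functions are monotone also without
measurability, and the error bounds are proved by peeling off one iteration of a loop
at a time. Linearity and the existence of an output law come from the fact that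
the algorithms are compositions of Markov kernels ([sampled_algB],
[sampled_algA]).

For the running time, let x = 1/eps and L(delta) = 1 + ln(1/delta). The number of
repetitions is at most 8 L(delta), sample sizes are polynomial in x, and the
inner failure probabilities have L of order T x. One level of the recursion
thus multiplies the cost by a constant times T^2 x^3 and divides eps by at most
4, which gives (C + G + 1) L(delta) (2^12 T^2 x^3)^k 8^(k^2) for [algB k]
([costB_le]). With k at most 2x + 1 levels this is below the stated bound, with
room to spare in every constant ([runs_to_algA_bound], [costA_bound_le]). *)

Local Notation prefix := Defs.prefix.
Local Notation total := Defs.total.

(** * Measurable functions of finite lists *)

Section measurable_seq.
Context d (A : measurableType d).

(** Asking for an i-th entry also says that the list has one, so these sets
determine the length of a list as well as its entries. *)
Definition seq_cylinder (i : nat) (B : set A) : set (seq A) :=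
  [set s | if onth s i is Some a then B a else False].

Definition seq_cylinders : set (set (seq A)) :=
  [set S | exists i B, measurable B /\ S = seq_cylinder i B].

HB.instance Definition _ := isPointed.Build (seq A) [::].

Let seq_measurable0 : <<s seq_cylinders >> set0.
Proof. exact: sigma_algebra0. Qed.

Let seq_measurableC S : <<s seq_cylinders >> S -> <<s seq_cylinders >> (~` S).
Proof. exact: sigma_algebraC. Qed.

Let seq_measurable_bigcup (F : (set (seq A))^nat) :
  (forall i, <<s seq_cylinders >> (F i)) ->
  <<s seq_cylinders >> (\bigcup_i (F i)).
Proof. exact: sigma_algebra_bigcup. Qed.

HB.instance Definition _ := @isMeasurable.Build (sigma_display seq_cylinders)
  (seq A) <<s seq_cylinders >>
  seq_measurable0 seq_measurableC seq_measurable_bigcup.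

Lemma measurable_seq_cylinder i B : measurable B -> measurable (seq_cylinder i B).
Proof. by move=> mB; apply: sub_sigma_algebra; exists i, B. Qed.

Lemma measurable_fun_into_seq d' (X : measurableType d') (f : X -> seq A) :
  (forall i B, measurable B -> measurable (f @^-1` seq_cylinder i B)) ->
  measurable_fun setT f.
Proof.
move=> H; apply: (@measurability _ _ _ _ _ _ seq_cylinders) => //.
move=> _ [_ [i [B [mB ->]]] <-]; rewrite setTI; exact: H.
Qed.

Lemma measurable_fun_cons d' (X : measurableType d') (f : X -> A) (h : X -> seq A) :
  measurable_fun setT f -> measurable_fun setT h ->
  measurable_fun setT (fun x => f x :: h x).
Proof.
move=> mf mh; apply: measurable_fun_into_seq => -[|i] B mB.
- by have := mf measurableT _ mB; rewrite setTI.
- by have := mh measurableT _ (measurable_seq_cylinder i mB); rewrite setTI.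
Qed.

Lemma measurable_fun_behead : measurable_fun setT (@behead A).
Proof.
apply: measurable_fun_into_seq => i B mB.
rewrite (_ : _ @^-1` _ = seq_cylinder i.+1 B); first exact: measurable_seq_cylinder.
by apply/seteqP; split => -[|a s] //=; case: i.
Qed.

Lemma measurable_size_gt n : measurable [set s : seq A | (n < size s)%N].
Proof.
rewrite (_ : [set _ | _] = seq_cylinder n setT); first exact: measurable_seq_cylinder.
apply/seteqP; split => s /=; rewrite /seq_cylinder /=.
  by elim: s n => [[]//|a s IH [|n]] //=; rewrite ltnS => /IH.
by elim: s n => [[]//|a s IH [|n]] //= /IH.
Qed.

Lemma measurable_size_eq n : measurable [set s : seq A | size s = n].
Proof.
case: n => [|n].
  rewrite (_ : [set _ | _] = ~` [set s : seq A | (0 < size s)%N]).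
    by apply: measurableC; exact: measurable_size_gt.
  by apply/seteqP; split => s /=; rewrite ?lt0n; [move=> -> | move=> /negP; rewrite negbK => /eqP].
rewrite (_ : [set _ | _] = [set s : seq A | (n < size s)%N] `\` [set s : seq A | (n.+1 < size s)%N]).
  apply: measurableD; exact: measurable_size_gt.
apply/seteqP; split => s /=; first by move=> ->; rewrite ltnn ltnSn.
by move=> [h1 /negP]; rewrite -leqNgt => h2; apply/eqP; rewrite eqn_leq h1 h2.
Qed.

Lemma measurable_fun_head (a0 : A) : measurable_fun setT (head a0).
Proof.
move=> _ B mB; rewrite setTI.
rewrite (_ : _ @^-1` _ = seq_cylinder 0 B `|` ([set s | size s = 0] `&` [set s | B a0])).
  apply: measurableU; first exact: measurable_seq_cylinder.
  apply: measurableI; first exact: measurable_size_eq.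
  by have [b|b] := pselect (B a0); [rewrite (_ : [set _ | _] = setT) // | rewrite (_ : [set _ | _] = set0) //]; apply/seteqP; split.
apply/seteqP; split => -[|a s] //=; rewrite /seq_cylinder /=; by [right|left|move=> [|[]]].
Qed.

(** Lists have countably many lengths, so that measurability may be checked on the
lists of each length separately. *)
Lemma measurable_fun_from_seq d' d'' (X : measurableType d') (Y : measurableType d'')
    (F : X * seq A -> Y) :
  (forall n, measurable_fun [set z | size z.2 = n] F) -> measurable_fun setT F.
Proof.
move=> H.
rewrite (_ : setT = \bigcup_n [set z : X * seq A | size z.2 = n]); last first.
  by apply/seteqP; split => // z _; exists (size z.2).
apply/measurable_fun_bigcup => // n.
have := measurable_size_eq n => /(@measurable_snd _ _ X (seq A) measurableT).
by rewrite setTI.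
Qed.

(** Maxima, sums and counts are all left folds, so their measurability comes from
this one. *)
Lemma measurable_fun_foldl d' (X : measurableType d') (step : X * A -> X) :
  measurable_fun setT step ->
  measurable_fun setT (fun z : X * seq A => foldl (fun x a => step (x, a)) z.1 z.2).
Proof.
move=> mstep; apply: measurable_fun_from_seq => n.
have mn m : measurable [set z : X * seq A | size z.2 = m].
  have := measurable_size_eq m => /(@measurable_snd _ _ X (seq A) measurableT).
  by rewrite setTI.
elim: n => [|n IH].
  apply: (@eq_measurable_fun _ _ _ _ _ fst); last exact: (measurable_funS measurableT).
  by move=> [x [|a s]] //; rewrite inE.
apply: (@eq_measurable_fun _ _ _ _ _ ((fun z : X * seq A => foldl (fun x a => step (x, a)) z.1 z.2)
   \o (fun z => (step (z.1, head point z.2), behead z.2)))).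
  by move=> [x [|a s]] //=; rewrite inE.
apply: (measurable_comp (mn n)) IH _.
  by move=> _ [[x [|a s]] /= sz <-] //=; case: sz.
apply: (measurable_funS measurableT) => //.
apply/measurable_fun_pairP; split; last first.
  exact: (measurableT_comp measurable_fun_behead).
apply: (measurableT_comp mstep); apply/measurable_fun_pairP; split.
  exact: measurable_fst.
exact: (measurableT_comp (measurable_fun_head point) measurable_snd).
Qed.

End measurable_seq.

(** * Expectations and output laws of programs *)

Section expectation.
Context (R : realType) (T D : nat).
Context (g : forall t : 'I_T.+1, 'M[R]_(D, t) -> R).
Context (kappa : forall t : 'I_T.+1, R.-pker 'M[R]_(D, t) ~> 'M[R]_(D, T)).
Local Notation prog := (prog R T D).
Local Open Scope ereal_scope.

(** The weakest-precondition reading of a program. It makes sense for every f: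
the integral of a nonnegative function is a supremum over the simple functions
below it, and stays monotone when the function is not measurable. *)
Fixpoint expect A (p : prog A) (f : A -> \bar R) : \bar R :=
  match p with
  | Ret a => f a
  | Operation o k => expect (k (operation_value o)) f
  | Ceiling x k => expect (k (nat_ceil x)) f
  | Median s k => expect (k (median s)) f
  | EvalReward t gamma k => expect (k (g gamma)) f
  | CallOracle t gamma k => \int[kappa t gamma]_M expect (k M) f
  end.

Lemma output_prob_expect A (p : prog A) (E : set A) :
  output_prob g kappa p E = expect p (EFin \o \1_E).
Proof.
by elim: p => //= t gamma k IH; congr integral; apply/funext => M; exact: IH.
Qed.

Lemma expect_bind A B (p : prog A) (q : A -> prog B) f :
  expect (bind p q) f = expect p (fun a => expect (q a) f).
Proof.
by elim: p => //= t gamma k IH; congr integral; apply/funext => M; exact: IH.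
Qed.

Lemma expect_ge0 A (p : prog A) f : (forall a, 0 <= f a) -> 0 <= expect p f.
Proof.
by move=> f0; elim: p => //= t gamma k IH; apply: integral_ge0 => M _; exact: IH.
Qed.

(** The output of a parametrized program is a Markov kernel: expectations of
measurable functions are integrals, and depend measurably on the parameter. *)
Definition sampled d d' (X : measurableType d) (A : measurableType d')
    (p : X -> prog A) : Prop :=
  exists k : R.-pker X ~> A, forall x (f : A -> \bar R), (forall a, 0 <= f a) ->
    measurable_fun setT f -> expect (p x) f = \int[k x]_a f a.

End expectation.

Section kernel_precomposition.
Context d d' d'' (X : measurableType d) (Y : measurableType d')
  (Z : measurableType d'') (R : realType).
Variables (k : R.-pker Y ~> Z) (h : X -> Y).

Definition kprecomp (mh : measurable_fun setT h) (x : X) :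
  {measure set Z -> \bar R} := k (h x).

Hypothesis mh : measurable_fun setT h.

Let measurable_kprecomp U : measurable U ->
  measurable_fun setT (kprecomp mh ^~ U).
Proof. by move=> mU; exact: (measurableT_comp (measurable_kernel k U mU) mh). Qed.

HB.instance Definition _ := isKernel.Build _ _ _ _ _ (kprecomp mh)
  measurable_kprecomp.

Let kprecomp_prob x : kprecomp mh x [set: Z] = 1%E.
Proof. exact: prob_kernel. Qed.

HB.instance Definition _ := Kernel_isProbability.Build _ _ _ _ _
  (kprecomp mh) kprecomp_prob.

End kernel_precomposition.

Section kernel_composition.
Context d d' d'' (X : measurableType d) (Y : measurableType d')
  (Z : measurableType d'') (R : realType).
Variables (l : R.-pker X ~> Y) (k : R.-pker (X * Y) ~> Z).

(** The composition [mkcomp] for probability kernels, so that compositions can be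
iterated. *)
Definition pkcomp : X -> {measure set Z -> \bar R} := mkcomp l k.

Let measurable_pkcomp U : measurable U -> measurable_fun setT (pkcomp ^~ U).
Proof.
move=> mU; apply: (measurable_fun_integral_finite_kernel (k ^~ U)) => //=.
exact/measurable_kernel.
Qed.

HB.instance Definition _ := isKernel.Build _ _ _ _ _ pkcomp measurable_pkcomp.

Let pkcomp_prob x : pkcomp x [set: Z] = 1%E.
Proof.
rewrite /pkcomp /mkcomp /= /kcomp.
under eq_integral do rewrite prob_kernel.
by rewrite integral_cst // prob_kernel mule1.
Qed.

HB.instance Definition _ := Kernel_isProbability.Build _ _ _ _ _
  pkcomp pkcomp_prob.

End kernel_composition.

Section sampled_programs.
Context (R : realType) (T D : nat).
Context (g : forall t : 'I_T.+1, 'M[R]_(D, t) -> R).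
Context (kappa : forall t : 'I_T.+1, R.-pker 'M[R]_(D, t) ~> 'M[R]_(D, T)).
Local Notation prog := (prog R T D).
Local Notation sampled := (sampled g kappa).
Local Notation expect := (expect g kappa).
Context d (X : measurableType d).

Lemma eq_sampled d' (A : measurableType d') (p q : X -> prog A) :
  (forall x f, expect (p x) f = expect (q x) f) -> sampled q -> sampled p.
Proof. by move=> pq [k kq]; exists k => x f f0 mf; rewrite pq kq. Qed.

Lemma sampled_comp d0 d' (X0 : measurableType d0) (A : measurableType d')
    (p : X -> prog A) (h : X0 -> X) :
  measurable_fun setT h -> sampled p -> sampled (fun x => p (h x)).
Proof. by move=> mh [k kp]; exists (kprecomp k mh) => x f f0 mf; rewrite kp. Qed.

Lemma sampled_ret d' (A : measurableType d') (h : X -> A) :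
  measurable_fun setT h -> sampled (fun x => Ret R T D (h x)).
Proof.
move=> mh; exists (kdirac mh) => x f f0 mf.
by rewrite /kdirac integral_dirac//= diracT mul1e.
Qed.

Lemma sampled_bind d1 d2 (A : measurableType d1) (B : measurableType d2)
    (p : X -> prog A) (q : X * A -> prog B) :
  sampled p -> sampled q -> sampled (fun x => bind (p x) (fun a => q (x, a))).
Proof.
move=> [kp hp] [kq hq]; exists (pkcomp kp kq) => x f f0 mf.
rewrite expect_bind /pkcomp /mkcomp /= integral_kcomp//.
rewrite (_ : (fun a => _) = (fun a => \int[kq (x, a)]_b f b)%E); last first.
  by apply/funext => a; rewrite hq.
rewrite hp//; first by move=> a; exact: integral_ge0.
have mk : measurable_fun setT (fun z => \int[kq z]_b f b)%E.
  by apply: measurable_fun_integral_kernel => // U mU; exact: measurable_kernel.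
exact: (measurableT_comp mk (measurable_pair1 x)).
Qed.

Lemma sampled_oracle (t : 'I_T.+1) (h : X -> 'M[R]_(D, t)) :
  measurable_fun setT h -> sampled (fun x => call_oracle (h x)).
Proof. by move=> mh; exists (kprecomp (kappa t) mh) => x f f0 mf. Qed.

End sampled_programs.

Section sampled_loops.
Context (R : realType) (T D : nat).
Context (g : forall t : 'I_T.+1, 'M[R]_(D, t) -> R).
Context (kappa : forall t : 'I_T.+1, R.-pker 'M[R]_(D, t) ~> 'M[R]_(D, T)).
Local Notation prog := (prog R T D).
Local Notation sampled := (sampled g kappa).
Local Notation expect := (expect g kappa).
Context d (X : measurableType d).

Lemma sampled_for_each (I : Type) d' (A : measurableType d') (s : seq I)
    (p : I -> X -> prog A) :
  (forall i, sampled (p i)) ->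
  sampled (fun x => for_each s (fun i => p i x)).
Proof.
move=> mp; elim: s => [|i s IH] /=; first exact: sampled_ret.
apply: (@sampled_bind _ _ _ _ _ _ _ _ _ A (seq A) (p i)
  (fun z => bind (for_each s (fun j => p j z.1)) (fun r => Ret R T D (z.2 :: r)))) => //.
apply: (@sampled_bind _ _ _ _ _ _ _ _ _ (seq A) (seq A)
  (fun z => for_each s (fun j => p j z.1))
  (fun w => Ret R T D (w.1.2 :: w.2))).
  exact: (sampled_comp measurable_fst IH).
apply: sampled_ret; apply: measurable_fun_cons; last exact: measurable_snd.
exact: (measurableT_comp measurable_snd measurable_fst).
Qed.

End sampled_loops.

(** * Maxima, sums and medians of lists *)

Section list_functions.
Context (R : realType).

(** What [maximum] and [total] return: a fold started at the first entry. *)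
Definition fold1 (o : R -> R -> R) (s : seq R) : R := foldl o (head 0 s) (behead s).

Lemma measurable_fold1 (o : R * R -> R) : measurable_fun setT o ->
  measurable_fun setT (fold1 (fun x y => o (x, y))).
Proof.
move=> mo.
rewrite (_ : fold1 _ = (fun z => foldl (fun x a => o (x, a)) z.1 z.2) \o
  (fun s => (head 0 s, behead s)))//.
apply: (measurableT_comp (measurable_fun_foldl mo)).
apply/measurable_fun_pairP; split; first exact: measurable_fun_head.
exact: measurable_fun_behead.
Qed.

Lemma measurable_fold1_max : measurable_fun setT (fold1 Num.max).
Proof. by apply: (@measurable_fold1 (fun z => Num.max z.1 z.2)); exact: measurable_maxr. Qed.

Lemma fold1_sum (s : seq R) : fold1 +%R s = \sum_(x <- s) x.
Proof.
case: s => [|x s]; rewrite /fold1 /= ?big_nil//.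
rewrite big_cons; elim: s x => [|y s IH] x /=; first by rewrite big_nil addr0.
by rewrite IH big_cons addrA.
Qed.

Lemma measurable_sum_seq : measurable_fun setT (fun s : seq R => \sum_(x <- s) x).
Proof.
rewrite (_ : (fun s => _) = fold1 +%R); last by apply/funext => s; rewrite fold1_sum.
by apply: (@measurable_fold1 (fun z => z.1 + z.2)); exact: measurable_funD.
Qed.

Lemma measurable_count_le (c : R) : measurable_fun setT (count (<= c)).
Proof.
pose step (z : nat * R) : nat := (z.1 + (z.2 <= c)%R)%N.
rewrite (_ : count _ = (fun z => foldl (fun x a => step (x, a)) z.1 z.2) \o (fun s => (0%N, s))); last first.
  apply/funext => s /=; rewrite -[LHS]add0n.
  by elim: s 0%N => [|a s IH] m /=; rewrite ?addn0// -IH addnA.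
apply: (measurableT_comp (measurable_fun_foldl _)) => //.
  apply: measurable_fun_addn; first exact: measurable_fst.
  apply: (measurableT_comp (f := nat_of_bool)) => //.
  by apply: measurable_fun_ler => //; exact: measurable_snd.
exact: measurable_pair1.
Qed.

(** Order statistics are determined by counts; measurability of the median and
its location in an interval both reduce to counting. *)
Lemma nth_sort_le (s : seq R) i c : (i < size s)%N ->
  (nth 0 (sort <=%R s) i <= c) = (i < count (<= c) s)%N.
Proof.
move=> si.
have so : sorted <=%R (sort <=%R s) by exact: sort_le_sorted.
have -> : count (<= c) s = count (<= c) (sort <=%R s).
  by apply/permP; rewrite perm_sym; exact/permEl/perm_sort.
apply/idP/idP; last exact: nth_count_le.
apply: contraTT; rewrite -leqNgt -ltNge => h.
by apply: nth_count_gt => //; rewrite h size_sort si.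
Qed.

(** The length is fixed because the formula for the median depends on it. *)
Lemma measurable_nth_sort n i :
  measurable_fun [set s : seq R | size s = n] (fun s => nth 0 (sort <=%R s) i).
Proof.
have [ni|ni] := leqP n i.
  apply: (eq_measurable_fun (fun=> 0 : R)); last exact: measurable_cst.
  move=> s /[!inE]/= sn.
  by rewrite nth_default// size_sort sn.
move=> mn; apply: (measurability _ (RGenOInfty.measurableE R)) => //.
move=> _ [_ [c ->] <-].
rewrite (_ : _ `&` _ =
    [set s | size s = n] `&` ~` (count (<= c) @^-1` [set m | (i < m)%N])).
  apply: measurableI => //; apply: measurableC; rewrite -[X in measurable X]setTI.
  exact: measurable_count_le.
apply/seteqP; split => s /= [sn]; rewrite in_itv/= andbT => h; split => //.
  by apply/negP; rewrite -nth_sort_le ?sn// -ltNge.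
by rewrite ltNge nth_sort_le ?sn//; exact/negP.
Qed.

Lemma measurable_median : measurable_fun setT (@median R).
Proof.
rewrite (_ : setT = \bigcup_n [set s : seq R | size s = n]); last first.
  by apply/seteqP; split => // s _; exists (size s).
apply/measurable_fun_bigcup; first by move=> n; exact: measurable_size_eq.
move=> n; apply: (eq_measurable_fun (fun s : seq R =>
  (nth 0 (sort <=%R s) (n.+1./2.-1) + nth 0 (sort <=%R s) (n./2)) / 2)).
  by move=> s /[!inE]/= <-.
apply: measurable_funM; last exact: measurable_cst.
by apply: measurable_funD; exact: measurable_nth_sort.
Qed.

End list_functions.

(** * The algorithms with their deterministic instructions evaluated *)

Section measurable_matrix_functions.
Context (R : realType).

Lemma measurable_fun_mx_entry m n (i : 'I_m) (j : 'I_n) :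
  measurable_fun setT (fun M : 'M[R]_(m, n) => M i j).
Proof.
move=> _ B mB; apply: sub_sigma_algebra; exists (i, j) => //=.
by exists B.
Qed.

Lemma measurable_fun_into_mx d (X : measurableType d) m n (f : X -> 'M[R]_(m, n)) :
  (forall i j, measurable_fun setT (fun x => f x i j)) -> measurable_fun setT f.
Proof.
move=> mf; apply: (@measurability _ _ _ _ _ _ (@mx_entry_preimages R m n)) => //.
move=> _ [_ [[i j] _ [B mB <-]] <-]; rewrite !setTI.
by have := mf i j measurableT B mB; rewrite setTI.
Qed.

Lemma measurable_prefix T D (t : 'I_T.+1) :
  measurable_fun setT (@prefix R T D t).
Proof.
apply: measurable_fun_into_mx => i j.
rewrite (_ : (fun _ => _) = fun M : 'M[R]_(D, T) => M i (widen_ord (leq_ord t) j)).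
  exact: measurable_fun_mx_entry.
by apply/funext => M; rewrite mxE.
Qed.

End measurable_matrix_functions.

Section normal_forms.
Context (R : realType) (T D : nat).
Context (g : forall t : 'I_T.+1, 'M[R]_(D, t) -> R).
Context (kappa : forall t : 'I_T.+1, R.-pker 'M[R]_(D, t) ~> 'M[R]_(D, T)).
Local Notation prog := (prog R T D).
Local Notation sampled := (sampled g kappa).
Local Notation expect := (expect g kappa).
Implicit Types (k N : nat) (t : 'I_T.+1) (eps e eta delta : R).

(** The programs compute these three numbers without calling the oracle. *)
Definition sample_size_value e eta : nat :=
  nat_ceil (1 / (2 * e `^ 2) * ln (2 / eta)).

Definition repetitions_value delta : nat := nat_ceil (8 * ln (2 * (1 / delta))).

Definition failure_prob_value (c : R) N : R := 1 / (c * N%:R * T%:R).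

Definition max_estimate k t (gamma : 'M[R]_(D, t)) e eta : prog R :=
  bind (call_oracle gamma) (fun A1 =>
  bind (for_each (enum 'I_T) (fun j => algB k (prefix (date j) A1) e eta))
  (fun A2 => Ret R T D (fold1 Num.max A2))).

Definition mean_estimate k t (gamma : 'M[R]_(D, t)) e eta N : prog R :=
  bind (for_each (iota 1 N) (fun=> max_estimate k gamma e eta))
  (fun A0 => Ret R T D (1 / N%:R * \sum_(x <- A0) x)).

Definition difference_estimate k t (gamma : 'M[R]_(D, t)) eps : prog R :=
  let N := sample_size_value (eps / 4) (1 / 16) in
  bind (algB k gamma (eps / 2) (1 / 8)) (fun A3 =>
  bind (mean_estimate k gamma (eps / 4) (failure_prob_value 16 N) N)
  (fun m => Ret R T D (A3 - m))).

Definition median_of n (p : prog R) : prog R :=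
  bind (for_each (iota 1 n) (fun=> p)) (fun s => Ret R T D (median s)).

Lemma expect_for_each_ext I A (s : seq I) (p q : I -> prog A) f h :
  (forall i f, expect (p i) f = expect (q i) f) -> f =1 h ->
  expect (for_each s p) f = expect (for_each s q) h.
Proof.
move=> pq /funext <-; elim: s f => //= i s IH f; rewrite !expect_bind pq.
by congr expect; apply/funext => a; rewrite !expect_bind IH.
Qed.

Lemma expect_fold_op o (s : seq R) f :
  expect (fold_op T D o s) f = f (fold1 (fun x y => operation_value (o x y)) s).
Proof. by case: s => // x s; rewrite /fold1/=; elim: s x => //= y s IH x; exact: IH. Qed.

Lemma expect_maximum (s : seq R) f : expect (maximum T D s) f = f (fold1 Num.max s).
Proof. exact: expect_fold_op. Qed.

Lemma expect_total (s : seq R) f : expect (total T D s) f = f (\sum_(x <- s) x).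
Proof. by rewrite expect_fold_op -fold1_sum. Qed.

(** Deterministic instructions leave expectations unchanged; only the draws and the
list functions applied to them remain. *)
Lemma expect_algBS k t (gamma : 'M[R]_(D, t)) eps delta f :
  expect (algB k.+1 gamma eps delta) f =
  expect (median_of (repetitions_value delta) (difference_estimate k gamma eps)) f.
Proof.
rewrite /median_of expect_bind /= expect_bind.
apply: expect_for_each_ext => // _ {}f.
rewrite /= !expect_bind; congr expect; apply/funext => A3.
rewrite !expect_bind; apply: expect_for_each_ext => [_ {}f|A0]; last first.
  by rewrite /= !expect_bind expect_total.
rewrite /max_estimate /=; congr integral; apply/funext => A1.
rewrite !expect_bind; apply: expect_for_each_ext => // A2.
by rewrite expect_maximum.
Qed.

Lemma expect_algA eps delta f :
  let k := nat_ceil (2 / eps) in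
  let alpha := eps / 2 * (1 / k%:R) in
  let beta := delta * (1 / k%:R) in
  let N := sample_size_value (alpha / 2) (1 / 8) in
  expect (algA T D eps delta) f =
  expect (for_each (iota 1 k) (fun l => median_of (repetitions_value beta)
    (mean_estimate l.-1 (0 : 'M[R]_(D, @ord0 T)) (alpha / 2)
       (failure_prob_value 8 N) N)))
  (fun L => f (\sum_(x <- L) x)).
Proof.
move=> k alpha beta N; rewrite /algA /= expect_bind.
apply: expect_for_each_ext => [l {}f|L]; last by rewrite expect_total.
rewrite /median_of /= !expect_bind.
apply: expect_for_each_ext => // _ {}f.
rewrite expect_bind [in RHS]expect_bind.
apply: expect_for_each_ext => [_ {}f|A0]; last first.
  by rewrite /= expect_bind expect_total.
rewrite /max_estimate /=; congr integral; apply/funext => A1.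
rewrite !expect_bind; apply: expect_for_each_ext => // A2.
by rewrite expect_maximum.
Qed.

End normal_forms.

Section algorithms_sampled.
Context (R : realType) (T D : nat).
Context (g : forall t : 'I_T.+1, 'M[R]_(D, t) -> R).
Hypothesis mg : forall t : 'I_T.+1, (1 <= t)%N -> measurable_fun setT (@g t).
Context (kappa : forall t : 'I_T.+1, R.-pker 'M[R]_(D, t) ~> 'M[R]_(D, T)).
Local Notation prog := (prog R T D).
Local Notation sampled := (sampled g kappa).
Implicit Types (k N : nat) (t : 'I_T.+1).

Let good k := forall (t : 'I_T.+1) e delta, (1 <= t)%N ->
  sampled (fun gamma : 'M[R]_(D, t) => algB k gamma e delta).

Lemma sampled_max_estimate k t e eta : good k ->
  sampled (fun gamma : 'M[R]_(D, t) => max_estimate k gamma e eta).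
Proof.
move=> gk.
apply: (sampled_bind (p := fun gamma : 'M[R]_(D, t) => call_oracle gamma)
  (q := fun z => bind (for_each (enum 'I_T) (fun j => algB k (prefix (date j) z.2) e eta))
  (fun A2 => Ret R T D (fold1 Num.max A2)))).
  exact: sampled_oracle.
apply: (sampled_bind (A := seq R)
  (p := fun z => for_each (enum 'I_T) (fun j => algB k (prefix (date j) z.2) e eta))
  (q := fun w => Ret R T D (fold1 Num.max w.2))).
  apply: (@sampled_for_each _ _ _ _ _ _ _ _ _ _ _ (fun j z => algB k (prefix (date j) z.2) e eta)) => j.
  have sj := gk (date j) e eta isT.
  have mh : measurable_fun setT
      (fun z : 'M[R]_(D, t) * 'M[R]_(D, T) => prefix (date j) z.2).
    exact: (measurableT_comp (@measurable_prefix R T D (date j)) measurable_snd).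
  exact: (sampled_comp mh sj).
apply: sampled_ret.
exact: (measurableT_comp (@measurable_fold1_max R) measurable_snd).
Qed.

Lemma sampled_mean_estimate k t e eta N : good k ->
  sampled (fun gamma : 'M[R]_(D, t) => mean_estimate k gamma e eta N).
Proof.
move=> gk.
apply: (sampled_bind (A := seq R)
  (p := fun gamma : 'M[R]_(D, t) => for_each (iota 1 N) (fun=> max_estimate k gamma e eta))
  (q := fun w => Ret R T D (1 / N%:R * \sum_(x <- w.2) x))).
  by apply: (@sampled_for_each _ _ _ _ _ _ _ _ _ _ _ (fun _ gamma => max_estimate k gamma e eta)) => _;
    exact: sampled_max_estimate.
apply: sampled_ret; apply: measurable_funM => //.
exact: (measurableT_comp (@measurable_sum_seq R) measurable_snd).
Qed.

Lemma sampled_median_of d (X : measurableType d) n (p : X -> prog R) :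
  sampled p -> sampled (fun x => median_of n (p x)).
Proof.
move=> sp.
apply: (sampled_bind (A := seq R)
  (p := fun x => for_each (iota 1 n) (fun=> p x))
  (q := fun w => Ret R T D (median w.2))).
  exact: (@sampled_for_each _ _ _ _ _ _ _ _ _ _ _ (fun _ => p)).
apply: sampled_ret.
exact: (measurableT_comp (@measurable_median R) measurable_snd).
Qed.

Lemma sampled_difference_estimate k t eps : good k -> (1 <= t)%N ->
  sampled (fun gamma : 'M[R]_(D, t) => difference_estimate k gamma eps).
Proof.
move=> gk t1; rewrite /difference_estimate; set N := sample_size_value _ _.
apply: (sampled_bind (A := R)
  (p := fun gamma : 'M[R]_(D, t) => algB k gamma (eps / 2) (1 / 8))
  (q := fun z => bind (mean_estimate k z.1 (eps / 4) (failure_prob_value T 16 N) N)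
     (fun m => Ret R T D (z.2 - m)))); first exact: gk.
apply: (sampled_bind (A := R) (B := R)
  (p := fun z : 'M[R]_(D, t) * R => mean_estimate k z.1 (eps / 4) (failure_prob_value T 16 N) N)
  (q := fun w : 'M[R]_(D, t) * R * R => Ret R T D (w.1.2 - w.2))).
  exact: (sampled_comp measurable_fst (sampled_mean_estimate _ _ _ _ gk)).
apply: sampled_ret; apply: measurable_funB => //.
exact: (measurableT_comp measurable_snd measurable_fst).
Qed.

Lemma sampled_algB k t e delta : (1 <= t)%N ->
  sampled (fun gamma : 'M[R]_(D, t) => algB k gamma e delta).
Proof.
elim: k t e delta => [|k IH] t e delta t1.
  exact: (sampled_ret _ _ (mg t1)).
apply: (eq_sampled (fun gamma f => expect_algBS _ _ _ gamma _ _ f)).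
by apply: sampled_median_of; exact: sampled_difference_estimate.
Qed.

End algorithms_sampled.

(** * Error bounds for programs and loops *)

Section lower_integral.
Context d (X : measurableType d) (R : realType).
Variable mu : {measure set X -> \bar R}.
Local Open Scope ereal_scope.

Lemma le_lower_integral (f h : X -> \bar R) :
  (forall x, 0 <= f x) -> (forall x, f x <= h x) ->
  \int[mu]_x f x <= \int[mu]_x h x.
Proof.
move=> f0 fh; have h0 x : 0 <= h x by exact: le_trans (fh x).
rewrite !ge0_integralTE//; apply: le_ereal_sup => _ [s sf <-].
by exists s => // x; exact: le_trans (fh x).
Qed.

(** The null set where the bound fails is absorbed by setting h to +oo there. *)
Lemma ae_le_lower_integral (f h : X -> \bar R) :
  (forall x, 0 <= f x) -> (forall x, 0 <= h x) -> measurable_fun setT h ->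
  {ae mu, forall x, f x <= h x} ->
  \int[mu]_x f x <= \int[mu]_x h x.
Proof.
move=> f0 h0 mh [N [mN N0 subN]].
pose h' x := if x \in N then +oo else h x.
have h'0 x : 0 <= h' x by rewrite /h'; case: ifP.
apply: (@le_trans _ _ (\int[mu]_x h' x)).
  apply: le_lower_integral => // x; rewrite /h'; case: ifPn => [_|]; first exact: leey.
  by rewrite notin_setE => nN; apply: contrapT => fh; apply: nN; exact: subN.
rewrite le_eqVlt; apply/orP; left; apply/eqP.
apply: ge0_ae_eq_integral => //.
  apply: measurable_fun_ifT => //; apply: (measurable_fun_bool true).
  rewrite setTI (_ : _ @^-1` _ = N)//.
  by apply/seteqP; split => x /=; [move/set_mem|move/mem_set].
exists N; split => // x /=; apply: contra_notP => nN _.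
by rewrite /h' ifF//; apply/negbTE; rewrite notin_setE.
Qed.

End lower_integral.

Section expectation_bounds.
Context (R : realType) (T D : nat).
Context (g : forall t : 'I_T.+1, 'M[R]_(D, t) -> R).
Context (kappa : forall t : 'I_T.+1, R.-pker 'M[R]_(D, t) ~> 'M[R]_(D, T)).
Local Notation prog := (prog R T D).
Local Notation sampled := (sampled g kappa).
Local Notation expect := (expect g kappa).
Local Open Scope ereal_scope.

Lemma le_expect A (p : prog A) (f h : A -> \bar R) :
  (forall a, 0 <= f a) -> (forall a, f a <= h a) -> expect p f <= expect p h.
Proof.
move=> f0 fh; elim: p => //= t gamma k IH.
by apply: le_lower_integral => M; [exact: expect_ge0|exact: IH].
Qed.

Lemma expect_cst A (p : prog A) (r : \bar R) : expect p (fun=> r) = r.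
Proof.
elim: p => //= t gamma k IH; under eq_integral do rewrite IH.
by rewrite integral_cst// prob_kernel mule1.
Qed.

Lemma expect_le_cst A (p : prog A) (f : A -> \bar R) r :
  (forall a, 0 <= f a) -> (forall a, f a <= r) -> expect p f <= r.
Proof. by move=> f0 fr; rewrite -(expect_cst p r); exact: le_expect. Qed.

(** On measurable functions the expectation is an integral, hence linear. *)
Definition has_law d (A : measurableType d) (p : prog A) : Prop :=
  exists2 mu : {measure set A -> \bar R}, mu setT = 1 &
    forall f : A -> \bar R, (forall a, 0 <= f a) -> measurable_fun setT f ->
      expect p f = \int[mu]_a f a.

Lemma sampled_has_law d d' (X : measurableType d) (A : measurableType d')
  (p : X -> prog A) x : sampled p -> has_law (p x).
Proof. by move=> [k kp]; exists (k x); [exact: prob_kernel|exact: kp]. Qed.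

Definition pr A (p : prog A) (B : set A) : \bar R := expect p (fun a => (\1_B a)%:E).

Lemma expect_affine d (A : measurableType d) (p : prog A) (B : set A) (a b : R) :
  has_law p -> measurable B -> (0 <= a)%R -> (0 <= b)%R ->
  expect p (fun x => (a + b * \1_B x)%:E) = a%:E + b%:E * pr p B.
Proof.
move=> [mu mu1 pmu] mB a0 b0; rewrite pmu; last 2 first.
- by move=> x; rewrite lee_fin addr_ge0// mulr_ge0.
- apply/measurable_EFinP; apply: measurable_funD => //.
  by apply: measurable_funM => //; exact: measurable_indic.
rewrite /pr pmu//; last by apply/measurable_EFinP; exact: measurable_indic.
under eq_integral do rewrite EFinD EFinM.
rewrite ge0_integralD//; first last.
- by apply: emeasurable_funM => //; apply/measurable_EFinP; exact: measurable_indic.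
- by move=> x _; rewrite mule_ge0// lee_fin.
rewrite integral_cst// mu1 mule1 ge0_integralZl//.
by apply/measurable_EFinP; exact: measurable_indic.
Qed.

(** The elementary step of the error estimates: the target is bounded by a outside
of a bad event of probability q, and by a + b on it. *)
Lemma expect_affine_le d (A : measurableType d) (p : prog A) (B : set A) (a b q : R)
    (f : A -> \bar R) :
  has_law p -> measurable B -> (0 <= a)%R -> (0 <= b)%R -> pr p B <= q%:E ->
  (forall x, 0 <= f x) -> (forall x, f x <= (a + b * \1_B x)%:E) ->
  expect p f <= (a + b * q)%:E.
Proof.
move=> lp mB a0 b0 pB f0 fab; apply: (le_trans (le_expect _ f0 fab)).
by rewrite expect_affine// EFinD EFinM leeD2l// lee_wpmul2l.
Qed.

(** The union bound, one iteration at a time: either the first output is bad, or the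
bound for the remaining iterations applies to f with that output prepended.
The only law needed is that of a single iteration. *)
Lemma expect_for_each_union d (A : measurableType d) (I : eqType) (s : seq I)
    (p : I -> prog A) (B : I -> set A) (b : R) (f : seq A -> \bar R) :
  (0 <= b)%R ->
  (forall i, i \in s -> has_law (p i)) -> (forall i, i \in s -> measurable (B i)) ->
  (forall i, i \in s -> pr (p i) (B i) <= b%:E) ->
  (forall l, 0 <= f l) -> (forall l, f l <= 1) ->
  (forall l, all2 (fun i a => a \notin B i) s l -> f l = 0) ->
  expect (for_each s p) f <= ((size s)%:R * b)%:E.
Proof.
move=> b0; elim: s f => [|i s IH] f lp mB pB f0 f1 fB.
  by rewrite /= mul0r fB.
rewrite /= expect_bind -natr1 mulrDl mul1r -[X in (_ + X)%R]mul1r.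
have is0 : i \in i :: s by rewrite inE eqxx.
apply: (@expect_affine_le _ _ _ (B i)) => //.
- exact: lp.
- exact: mB.
- by rewrite mulr_ge0.
- exact: pB.
- by move=> a; exact: expect_ge0.
move=> a; rewrite expect_bind /=.
have [aB|aB] := boolP (a \in B i).
  rewrite indicE aB mulr1; apply: (@le_trans _ _ 1); first exact: expect_le_cst.
  by rewrite lee_fin lerDr mulr_ge0.
rewrite indicE (negbTE aB) mulr0 addr0; apply: IH => //.
- by move=> j js; apply: lp; rewrite inE js orbT.
- by move=> j js; apply: mB; rewrite inE js orbT.
- by move=> j js; apply: pB; rewrite inE js orbT.
- by move=> l ll; apply: fB; rewrite /= aB.
Qed.

(** Chernoff's bound: every iteration multiplies the mean of exp(lam * count) by
at most 1 + (exp lam - 1) q. *)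
Lemma expect_count_ge (I : Type) (s : seq I) (p : prog R) (B : set R) (q lam : R) (c : R) :
  has_law p -> measurable B -> (0 <= q)%R -> pr p B <= q%:E -> (0 <= lam)%R ->
  expect (for_each s (fun=> p))
     (fun l => (\1_[set l | (c <= (count (fun x => x \in B) l)%:R)%R] l)%:E)
  <= (expR (- lam * c) * (1 + (expR lam - 1) * q) ^+ size s)%:E.
Proof.
move=> lp mB q0 pB lam0.
have el0 : (0 <= expR lam - 1)%R by rewrite subr_ge0 -expR0 ler_expR.
set Q := (1 + _ * q)%R; have Q0 : (0 <= Q)%R by rewrite addr_ge0// mulr_ge0.
elim: s c => [|i s IH] c /=.
  rewrite expr0 mulr1 lee_fin indicE.
  case: (boolP (_ \in _)) => [|_]; last exact: expR_ge0.
  rewrite inE /= => c0; rewrite -[leLHS]expR0 ler_expR mulNr oppr_ge0.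
  exact: mulr_ge0_le0.
rewrite expect_bind.
set K := (expR (- lam * c) * Q ^+ size s)%R.
have K0 : (0 <= K)%R by rewrite mulr_ge0 ?expR_ge0// exprn_ge0.
rewrite (_ : expR _ * Q ^+ _.+1 = K + (K * (expR lam - 1)) * q)%R; last first.
  by rewrite /K exprSr [LHS]mulrA -/K /Q mulrDr mulr1 mulrA.
apply: (@expect_affine_le _ _ _ B) => //.
- by rewrite mulr_ge0.
- by move=> a; apply: expect_ge0 => l; rewrite lee_fin.
move=> a; rewrite expect_bind /=.
have [aB|aB] := boolP (a \in B).
  have := IH (c - 1)%R.
  rewrite (_ : expR _ * _ = K + K * (expR lam - 1) * \1_B a)%R; last first.
    rewrite indicE aB mulr1 (_ : - lam * (c - 1) = - lam * c + lam)%R; last by ring.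
    by rewrite expRD /K; ring.
  apply: le_trans; apply: le_expect => l; rewrite lee_fin// !indicE.
  rewrite (_ : (_ \in [set l | _]) = (l \in [set l | (c - 1 <= (count (fun x => x \in B) l)%:R)%R])) //.
  by apply/idP/idP; rewrite !inE /= aB natrD lerBlDl.
have := IH c; rewrite indicE (negbTE aB) mulr0 addr0.
apply: le_trans; apply: le_expect => l; rewrite lee_fin// !indicE.
rewrite (_ : (_ \in [set l | _]) = (l \in [set l | (c <= (count (fun x => x \in B) l)%:R)%R])) //.
by apply/idP/idP; rewrite !inE /= (negbTE aB) add0n.
Qed.

End expectation_bounds.

(** * Hoeffding's lemma *)

Section hoeffding.
Context (R : realType).

Lemma ge0_second_derivative (f df ddf : R -> R) (h : R) :
  (forall x : R, is_derive x 1 f (df x)) -> (forall x : R, is_derive x 1 df (ddf x)) ->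
  f 0 = 0 -> df 0 = 0 -> (forall x, 0 <= ddf x) -> 0 <= h -> 0 <= f h.
Proof.
move=> fd dfd f0 df0 ddf0.
have cont (F dF : R -> R) (Fd : forall x : R, is_derive x 1 F (dF x)) (a b : R) :
    {within `[a, b], continuous F}.
  apply: derivable_within_continuous => x _; exact: ex_derive.
rewrite le_eqVlt => /predU1P[<-|h0]; first by rewrite f0.
have [c /andP[c0 ch]] := MVT h0 (fun x _ => fd x) (cont _ _ fd 0 h).
rewrite /= in c0 ch *; rewrite f0 !subr0 => ->.
have {}c0 : 0 < c by move: c0; rewrite bnd_simp.
have [c' _] := MVT c0 (fun x _ => dfd x) (cont _ _ dfd 0 c).
by rewrite df0 !subr0 => ->; rewrite !mulr_ge0// ltW.
Qed.

(** With u the tilted success probability, the logarithm of the left-hand side has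
second derivative u (1 - u) <= 1/4 in h, and it agrees with p * h to first order
at h = 0. *)
Lemma bernoulli_mgf_ge0 (p h : R) : 0 <= p <= 1 -> 0 <= h ->
  1 - p + p * expR h <= expR (p * h + h ^+ 2 / 8).
Proof.
move=> /andP[p0 p1] h0.
pose Dn (x : R) : R := 1 - p + p * expR x.
have DnE x : Dn x = 1 - p + p * expR x by [].
have Dn0 x : 0 < Dn x.
  have := expR_gt0 x; rewrite /Dn => e0.
  have [->|pn0] := eqVneq p 0; first by rewrite mul0r subr0 addr0 ltr01.
  have : 0 < p * expR x by rewrite mulr_gt0// lt_def pn0.
  lra.
have dDn (x : R) : is_derive x 1 Dn (p * expR x).
  by apply: is_derive_eq; rewrite /GRing.scale/=; ring.
clearbody Dn.
pose f (x : R) := p * x + x ^+ 2 / 8 - ln (Dn x).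
pose df (x : R) := p + x / 4 - p * expR x / Dn x.
pose ddf (x : R) := 1 / 4 - (p * expR x / Dn x) * (1 - p * expR x / Dn x).
have fd (x : R) : is_derive x 1 f (df x).
  have dln := is_derive1_ln (Dn0 x).
  have dc := @is_derive1_comp _ (@ln R) Dn x _ _ dln (dDn x).
  apply: is_derive_eq; rewrite /GRing.scale/= /df; field.
  exact: lt0r_neq0.
have dfd (x : R) : is_derive x 1 df (ddf x).
  have dV := is_deriveV (lt0r_neq0 (Dn0 x)) (dDn x).
  apply: is_derive_eq; rewrite /GRing.scale/= /ddf; field.
  exact: lt0r_neq0.
have f0 : f 0 = 0 by rewrite /f DnE mulr0 expr0n mul0r !add0r expR0 mulr1 subrK ln1 oppr0.
have df0 : df 0 = 0.
  by rewrite /df DnE expR0 mulr1 subrK divr1 mul0r addr0 subrr.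
have : 0 <= f h.
  apply: (ge0_second_derivative fd dfd) => // x; rewrite /ddf; set u := p * _ / _.
  by have := sqr_ge0 (u - 1/2); rewrite expr2; lra.
by rewrite /f subr_ge0 -ler_expR lnK ?posrE ?DnE// -DnE.
Qed.

(** A negative h is made positive by exchanging the two outcomes. *)
Lemma bernoulli_mgf (p h : R) : 0 <= p <= 1 ->
  1 - p + p * expR h <= expR (p * h + h ^+ 2 / 8).
Proof.
move=> p01; have [h0|h0] := leP 0 h; first exact: bernoulli_mgf_ge0.
have p01' : 0 <= 1 - p <= 1 by lra.
have h0' : 0 <= - h by lra.
have := bernoulli_mgf_ge0 p01' h0'.
rewrite -(ler_pM2l (expR_gt0 h)) -expRD.
rewrite (_ : h + _ = p * h + h ^+ 2 / 8); last by field.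
apply: le_trans; rewrite le_eqVlt; apply/orP; left; apply/eqP.
rewrite expRN; field; exact: lt0r_neq0 (expR_gt0 _).
Qed.

(** Convexity: the tangent line at lam * v lies below the exponential at 0 and at
lam; average these two inequalities with the weights 1 - v and v. *)
Lemma expR_chord (lam v : R) : 0 <= v <= 1 ->
  expR (lam * v) <= 1 - v + v * expR lam.
Proof.
move=> v01.
have h1 : expR (lam * v) * (1 - lam * v) <= 1.
  rewrite -[leRHS](expR0 R) -(subrr (lam * v)) expRD ler_pM2l ?expR_gt0//.
  exact: expR_ge1Dx.
have h2 : expR (lam * v) * (1 + lam * (1 - v)) <= expR lam.
  rewrite [in leRHS](_ : lam = lam * v + lam * (1 - v)); last by ring.
  by rewrite expRD ler_pM2l ?expR_gt0//; exact: expR_ge1Dx.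
have : (1 - v) * (expR (lam * v) * (1 - lam * v)) <= 1 - v.
  by rewrite ler_piMr//; lra.
have : v * (expR (lam * v) * (1 + lam * (1 - v))) <= v * expR lam.
  by rewrite ler_wpM2l//; lra.
lra.
Qed.

End hoeffding.

Section bounded_measurable.
Context d (X : measurableType d) (R : realType).

(** All integrals met in the analysis of the values are of such functions against
probabilities, so that they are finite and [Exp] below loses nothing by
being real-valued. *)
Definition bounded_measurable (f : X -> R) : Prop :=
  measurable_fun setT f /\ exists K : R, forall x, `|f x| <= K.

Lemma bounded_measurable_cst r : bounded_measurable (fun=> r).
Proof. by split; [exact: measurable_cst|exists `|r|]. Qed.

Lemma bounded_measurableD f h : bounded_measurable f -> bounded_measurable h ->
  bounded_measurable (fun x => f x + h x).
Proof.
move=> [mf [K fK]] [mh [L hL]]; split; first exact: measurable_funD.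
by exists (K + L) => x; apply: (le_trans (ler_normD _ _)); exact: lerD.
Qed.

Lemma bounded_measurableM f h : bounded_measurable f -> bounded_measurable h ->
  bounded_measurable (fun x => f x * h x).
Proof.
move=> [mf [K fK]] [mh [L hL]]; split; first exact: measurable_funM.
by exists (K * L) => x; rewrite normrM ler_pM.
Qed.

Lemma bounded_measurableN f : bounded_measurable f -> bounded_measurable (fun x => - f x).
Proof.
move=> [mf [K fK]]; split; first exact: measurable_funN.
by exists K => x; rewrite normrN.
Qed.

Lemma bounded_measurableB f h : bounded_measurable f -> bounded_measurable h ->
  bounded_measurable (fun x => f x - h x).
Proof. by move=> bf bh; apply: bounded_measurableD => //; exact: bounded_measurableN. Qed.

Lemma bounded_measurable_max f h : bounded_measurable f -> bounded_measurable h ->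
  bounded_measurable (fun x => Num.max (f x) (h x)).
Proof.
move=> [mf [K fK]] [mh [L hL]]; split; first exact: measurable_maxr.
by exists (Num.max K L) => x; rewrite le_max; case: (leP (f x) (h x)) => _;
  rewrite ?fK ?hL ?orbT.
Qed.

Lemma bounded_measurable_indic A : measurable A -> bounded_measurable (\1_A : X -> R).
Proof.
move=> mA; split; first exact: measurable_indic.
by exists 1 => x; rewrite indicE; case: (_ \in _); rewrite ?normr1 ?normr0.
Qed.

Lemma bounded_measurable_expR f : bounded_measurable f ->
  bounded_measurable (fun x => expR (f x)).
Proof.
move=> [mf [K fK]]; split; first exact: (measurableT_comp (@measurable_expR R)).
exists (expR K) => x; rewrite ger0_norm ?expR_ge0// ler_expR.
exact: le_trans (ler_norm _) (fK x).
Qed.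

Variable mu : {measure set X -> \bar R}.
Hypothesis mu1 : mu setT = 1%E.

Lemma bounded_integrable f : bounded_measurable f -> mu.-integrable setT (EFin \o f).
Proof.
move=> [mf [K fK]]; apply: measurable_bounded_integrable => //.
  by rewrite mu1 ltry.
exists K; split; first exact: num_real.
by move=> L KL x _; exact: le_trans (fK x) (ltW KL).
Qed.

Definition Exp (f : X -> R) : R := fine (\int[mu]_x (f x)%:E).

Lemma EFin_Exp f : bounded_measurable f -> (\int[mu]_x (f x)%:E = (Exp f)%:E)%E.
Proof.
by move=> bf; rewrite fineK//; exact: (integrable_fin_num _ (bounded_integrable bf)).
Qed.

Lemma Exp_cst r : Exp (fun=> r) = r.
Proof. by rewrite /Exp integral_cst// mu1 mule1. Qed.

Lemma ExpD f h : bounded_measurable f -> bounded_measurable h ->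
  Exp (fun x => f x + h x) = Exp f + Exp h.
Proof.
move=> bf bh; apply: EFin_inj; rewrite -EFin_Exp; last exact: bounded_measurableD.
rewrite EFinD -!EFin_Exp//; under eq_integral do rewrite EFinD.
by rewrite integralD//; exact: bounded_integrable.
Qed.

Lemma ExpZ r f : bounded_measurable f -> Exp (fun x => r * f x) = r * Exp f.
Proof.
move=> bf; apply: EFin_inj; rewrite -EFin_Exp; last first.
  by apply: bounded_measurableM => //; exact: bounded_measurable_cst.
rewrite EFinM -EFin_Exp//; under eq_integral do rewrite EFinM.
by rewrite integralZl//; exact: bounded_integrable.
Qed.

Lemma ExpB f h : bounded_measurable f -> bounded_measurable h ->
  Exp (fun x => f x - h x) = Exp f - Exp h.
Proof.
move=> bf bh; rewrite ExpD//; last exact: bounded_measurableN.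
congr (_ + _); rewrite -mulN1r -ExpZ//; congr Exp.
by apply/funext => x; rewrite mulN1r.
Qed.

Lemma le_ae_Exp f h : bounded_measurable f -> bounded_measurable h ->
  {ae mu, forall x, f x <= h x} -> Exp f <= Exp h.
Proof.
move=> bf bh fh; have bhf := bounded_measurableB bh bf.
rewrite -subr_ge0 -ExpB// -lee_fin -EFin_Exp//.
rewrite (@ae_eq_integral _ _ _ _ _ (fun x => (Num.max 0 (h x - f x))%:E))//.
- by apply: integral_ge0 => x _; rewrite lee_fin le_max lexx.
- by apply/measurable_EFinP; case: bhf.
- apply/measurable_EFinP; apply: measurable_maxr => //; by case: bhf.
- by apply: filterS fh => x fhx _; rewrite max_r// subr_ge0.
Qed.

Lemma le_Exp f h : bounded_measurable f -> bounded_measurable h ->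
  (forall x, f x <= h x) -> Exp f <= Exp h.
Proof. by move=> bf bh fh; apply: le_ae_Exp => //; exact: aeW. Qed.

(** By convexity the exponential is below the chord over the interval, whose mean is
the exponential moment of a Bernoulli variable with the same mean. *)
Lemma hoeffding_mgf (y : X -> R) (A lam : R) : bounded_measurable y ->
  {ae mu, forall x, A <= y x <= A + 1} ->
  Exp (fun x => expR (lam * (y x - Exp y))) <= expR (lam ^+ 2 / 8).
Proof.
move=> by_ yA; set m := Exp y.
have mA : A <= m <= A + 1.
  have bc r := bounded_measurable_cst r.
  rewrite /m; apply/andP; split.
    by rewrite -[leLHS]Exp_cst; apply: le_ae_Exp => //; apply: filterS yA => x /andP[].
  by rewrite -[leRHS]Exp_cst; apply: le_ae_Exp => //; apply: filterS yA => x /andP[].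
pose a := expR (lam * (A - m)).
have bl : bounded_measurable (fun x => a * (expR lam - 1) * y x).
  by apply: bounded_measurableM => //; exact: bounded_measurable_cst.
have bc := bounded_measurable_cst (a * (1 - A * (expR lam - 1))).
apply: (@le_trans _ _ (Exp (fun x => a * (1 - A * (expR lam - 1)) +
    a * (expR lam - 1) * y x))).
  apply: le_ae_Exp; last first.
  - apply: filterS yA => x yx.
    rewrite (_ : lam * (y x - m) = lam * (A - m) + lam * (y x - A)); last by ring.
    rewrite expRD (_ : _ + _ = a * (1 - (y x - A) + (y x - A) * expR lam)); last by ring.
    by rewrite ler_pM2l ?expR_gt0// expR_chord//; lra.
  - exact: bounded_measurableD.
  - apply: bounded_measurable_expR; apply: bounded_measurableM.
      exact: bounded_measurable_cst.
    by apply: bounded_measurableB => //; exact: bounded_measurable_cst.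
rewrite ExpD// Exp_cst ExpZ// -/m.
have pA : 0 <= m - A <= 1 by lra.
have := bernoulli_mgf lam pA.
rewrite (_ : a * _ + _ = a * (1 - (m - A) + (m - A) * expR lam)); last by ring.
rewrite -(ler_pM2l (expR_gt0 (lam * (A - m)))) -expRD -/a.
by rewrite (_ : lam * _ + _ = lam ^+ 2 / 8)//; ring.
Qed.

End bounded_measurable.

Section median.
Context (R : realType).

(** Fewer than half of the entries lie outside of the interval, so the two middle
entries of the sorted list are neither among those below it nor among those
above it. *)
Lemma median_in_interval (s : seq R) (lo hi : R) :
  (2 * count (fun x : R => ~~ (lo <= x <= hi)%R) s < size s)%N ->
  lo <= median s <= hi.
Proof.
set F := count _ s => hF.
have chi : (count (fun x : R => ~~ (x <= hi)%R) s <= F)%N.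
  by apply: sub_count => x; apply: contra => /andP[].
have clo : (count (< lo) s <= F)%N.
  by apply: sub_count => x /= xlo; rewrite negb_and -ltNge xlo.
have csz := count_predC (fun x => x <= hi) s.
have bnd i : (F <= i)%N -> (i < size s - F)%N ->
    lo <= nth 0 (sort <=%R s) i <= hi.
  move=> Fi iF.
  have isz : (i < size s)%N by apply: leq_trans iF (leq_subr _ _).
  rewrite nth_sort_le//; apply/andP; split.
    apply: nth_count_ge; first exact: sort_le_sorted.
    have -> : count (< lo) (sort <=%R s) = count (< lo) s.
      by apply/permP; exact/permEl/perm_sort.
    by rewrite size_sort isz andbT (leq_trans clo).
  apply: (leq_trans iF); rewrite leq_subLR -csz addnC; apply: leq_add => //.
have n2 := odd_double_half (size s).
have h1 : lo <= nth 0 (sort <=%R s) ((size s).+1./2.-1) <= hi.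
  by apply: bnd; lia.
have h2 : lo <= nth 0 (sort <=%R s) ((size s)./2) <= hi.
  by apply: bnd; lia.
rewrite /median; lra.
Qed.

End median.

(** * Concentration of means and medians *)

Lemma measurable_dist_gt (R : realType) (e c : R) :
  measurable [set x : R | e < `|x - c|].
Proof.
rewrite (_ : [set _ | _] = (fun x => e < `|x - c|) @^-1` [set true])//.
rewrite -[_ @^-1` _]setTI; apply: measurable_fun_ltr => //.
apply: (measurableT_comp (@normr_measurable R setT)).
exact: measurable_funB.
Qed.

Section concentration.
Context (R : realType) (T D : nat).
Context (g : forall t : 'I_T.+1, 'M[R]_(D, t) -> R).
Context (kappa : forall t : 'I_T.+1, R.-pker 'M[R]_(D, t) ~> 'M[R]_(D, T)).
Local Notation prog := (prog R T D).
Local Notation expect := (expect g kappa).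
Local Notation has_law := (has_law g kappa).
Local Notation pr := (pr g kappa).

Lemma le_expect_for_each I A (s : seq I) (p : I -> prog A) (f h : seq A -> \bar R) :
  (forall l, 0 <= f l)%E -> (forall l, size l = size s -> f l <= h l)%E ->
  (expect (for_each s p) f <= expect (for_each s p) h)%E.
Proof.
elim: s f h => [|i s IH] f h f0 fh /=; first exact: fh.
rewrite !expect_bind; apply: le_expect => a.
  by apply: expect_ge0.
rewrite !expect_bind /=; apply: IH => // l ll.
by apply: fh; rewrite /= ll.
Qed.

Lemma expect_for_each_cons I A i (s : seq I) (p : I -> prog A) f :
  expect (for_each (i :: s) p) f =
  expect (p i) (fun a => expect (for_each s p) (fun l => f (a :: l))).
Proof. by rewrite expect_bind; congr expect; apply/funext => a; rewrite expect_bind. Qed.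

Lemma expect_call_oracle (t : 'I_T.+1) (gamma : 'M[R]_(D, t)) f :
  (expect (call_oracle gamma) f = \int[kappa t gamma]_M f M)%E.
Proof. by []. Qed.

(** Exponential Markov inequality for a sum whose terms are computed in two stages:
draw a path M, then approximate y M by a program that is off by more than e with
probability at most b. The failures of the second stage contribute the union
bound, the errors e shift the threshold c, and psi bounds the exponential moments
of y around m. The center u is arbitrary, so that the induction can subtract the
first output from it. *)
Lemma expect_sum_deviation I (s : seq I) (t : 'I_T.+1) (gamma : 'M[R]_(D, t))
    (q : 'M[R]_(D, T) -> prog R) (y : 'M[R]_(D, T) -> R) (b e lam m psi c u : R) :
  bounded_measurable y -> (forall M, has_law (q M)) ->
  0 <= b -> 0 <= e -> 0 <= lam -> 0 <= psi ->
  {ae kappa t gamma, forall M,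
    (pr (q M) [set x | (e < `|x - y M|)%R] <= b%:E)%E} ->
  Exp (kappa t gamma) (fun M => expR (lam * (y M - m))) <= psi ->
  Exp (kappa t gamma) (fun M => expR (- lam * (y M - m))) <= psi ->
  (expect (for_each s (fun=> bind (call_oracle gamma) q))
     (fun l => (\1_[set l | (c < `|\sum_(x <- l) x - u|)%R] l)%:E) <=
   ((size s)%:R * b + psi ^+ size s * expR (- lam * (c - (size s)%:R * e)) *
     (expR (lam * ((size s)%:R * m - u)) + expR (- lam * ((size s)%:R * m - u))))%:E)%E.
Proof.
move=> by_ lq b0 e0 lam0 psi0 qy mgf1 mgf2.
elim: s u => [|i s IH] u.
  rewrite /= !mul0r subr0 add0r expr0 mul1r !sub0r lee_fin indicE; case: (boolP (_ \in _)) => [|_]; last first.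
    by rewrite mulr_ge0 ?expR_ge0// addr_ge0 ?expR_ge0.
  rewrite inE /= big_nil sub0r normrN => cu; rewrite mulrDr -!expRD.
  have [u0|u0] := leP 0 u.
    apply: ler_wpDl; first exact: expR_ge0.
    rewrite -[leLHS](expR0 R) ler_expR (_ : _ + _ = lam * (u - c)); last by ring.
    by apply: mulr_ge0 => //; rewrite subr_ge0; move: cu; rewrite ger0_norm// => /ltW.
  apply: ler_wpDr; first exact: expR_ge0.
  rewrite -[leLHS](expR0 R) ler_expR (_ : _ + _ = lam * (- u - c)); last by ring.
  by apply: mulr_ge0 => //; rewrite subr_ge0; move: cu; rewrite ltr0_norm// => /ltW.
set n := size s in IH *.
have -> : size (i :: s) = n.+1 by [].
pose W z := expR (lam * z) + expR (- lam * z).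
pose Kn := psi ^+ n * expR (- lam * (c - n%:R * e)).
have Kn0 : 0 <= Kn by rewrite mulr_ge0 ?expR_ge0// exprn_ge0.
pose H M := n%:R * b + Kn * expR (lam * e) * W (n%:R * m - u + y M).
have W0 z : 0 <= W z by rewrite addr_ge0 ?expR_ge0.
have H0 M : 0 <= H M 
  by apply: addr_ge0; rewrite mulr_ge0// mulr_ge0// expR_ge0.
have bW : bounded_measurable (fun M => W (n%:R * m - u + y M)).
  have bz : bounded_measurable (fun M => n%:R * m - u + y M).
    by apply: bounded_measurableD => //; exact: bounded_measurable_cst.
  by apply: bounded_measurableD; apply: bounded_measurable_expR;
    apply: bounded_measurableM => //; exact: bounded_measurable_cst.
have bH : bounded_measurable (fun M => H M + b).
  apply: bounded_measurableD; last exact: bounded_measurable_cst.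
  apply: bounded_measurableD; first exact: bounded_measurable_cst.
  by apply: bounded_measurableM => //; exact: bounded_measurable_cst.
have k1 : kappa t gamma setT = 1%E by exact: prob_kernel.
rewrite expect_for_each_cons expect_bind expect_call_oracle.
apply: (@le_trans _ _ (\int[kappa t gamma]_M (H M + b)%:E)%E).
  apply: ae_le_lower_integral.
  - by move=> M; do 2 apply: expect_ge0 => ?; rewrite lee_fin.
  - by move=> M; rewrite lee_fin addr_ge0.
  - by apply/measurable_EFinP; case: bH.
  apply: filterS qy => M qM.
  rewrite -[b]mul1r.
  apply: (@expect_affine_le _ _ _ _ _ _ _ _ [set x | e < `|x - y M|]) => //.
  - exact: measurable_dist_gt.
  - by move=> a; apply: expect_ge0 => l; rewrite lee_fin.
  move=> a.
  have [ay|ay] := boolP (a \in [set x | e < `|x - y M|]).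
    rewrite indicE ay mulr1; apply: (@le_trans _ _ 1%E).
      by apply: expect_le_cst => l; rewrite lee_fin// indicE; case: (_ \in _).
    by rewrite lee_fin lerDr.
  rewrite indicE (negbTE ay) mulr0 addr0.
  have {}ay : `|a - y M| <= e by move: ay; rewrite notin_setE /= => /negP; rewrite -leNgt.
  move: (IH (u - a)) => {}IH.
  rewrite (_ : (fun r => _) =
    (fun l => (\1_[set l | (c < `|\sum_(x <- l) x - (u - a)|)%R] l)%:E)); last first.
    apply/funext => l; rewrite !indicE; congr ((nat_of_bool _)%:R%:E).
    by apply/idP/idP; rewrite !inE /= big_cons opprB addrA [_ + a]addrC.
  apply: (le_trans IH); rewrite lee_fin lerD2l -/Kn -mulrA ler_wpM2l//.
  move: ay; rewrite ler_norml => /andP[ay1 ay2].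
  have h1 : 0 <= lam * (e + y M - a) by rewrite mulr_ge0//; lra.
  have h2 : 0 <= lam * (e + a - y M) by rewrite mulr_ge0//; lra.
  by rewrite /W [leRHS]mulrDr -!expRD; apply: lerD; rewrite ler_expR; lra.
rewrite EFin_Exp// lee_fin.
pose c1 := Kn * expR (lam * e) * expR (lam * (n.+1%:R * m - u)).
pose c2 := Kn * expR (lam * e) * expR (- lam * (n.+1%:R * m - u)).
have be1 : bounded_measurable (fun M => expR (lam * (y M - m))).
  apply: bounded_measurable_expR; apply: bounded_measurableM.
    exact: bounded_measurable_cst.
  by apply: bounded_measurableB => //; exact: bounded_measurable_cst.
have be2 : bounded_measurable (fun M => expR (- lam * (y M - m))).
  apply: bounded_measurable_expR; apply: bounded_measurableM.
    exact: bounded_measurable_cst.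
  by apply: bounded_measurableB => //; exact: bounded_measurable_cst.
rewrite (_ : (fun M => H M + b) = (fun M => n.+1%:R * b +
   (c1 * expR (lam * (y M - m)) + c2 * expR (- lam * (y M - m))))); last first.
  apply/funext => M; rewrite /H /c1 /c2 /W -natr1.
  have -> : expR (lam * (n%:R * m - u + y M)) =
      expR (lam * ((n%:R + 1) * m - u)) * expR (lam * (y M - m)).
    by rewrite -expRD; congr expR; ring.
  have -> : expR (- lam * (n%:R * m - u + y M)) =
      expR (- lam * ((n%:R + 1) * m - u)) * expR (- lam * (y M - m)).
    by rewrite -expRD; congr expR; ring.
  ring.
have bc r := @bounded_measurable_cst _ 'M[R]_(D, T) R r.
rewrite ExpD//; last by apply: bounded_measurableD; apply: bounded_measurableM.
rewrite ExpD//; [|exact: bounded_measurableM|exact: bounded_measurableM].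
rewrite Exp_cst// !ExpZ// lerD2l.
apply: (@le_trans _ _ (c1 * psi + c2 * psi)).
  by apply: lerD; rewrite ler_wpM2l// mulr_ge0 ?expR_ge0// mulr_ge0 ?expR_ge0.
rewrite le_eqVlt; apply/orP; left; apply/eqP; rewrite /c1 /c2 /Kn exprS.
have -> : expR (- lam * (c - n.+1%:R * e)) =
    expR (- lam * (c - n%:R * e)) * expR (lam * e).
  by rewrite -expRD; congr expR; rewrite -natr1; ring.
ring.
Qed.

End concentration.

Section sample_sizes.
Context (R : realType).
Implicit Types x e eta delta : R.

Lemma nat_ceil_ge x : 0 <= x -> x <= (nat_ceil x)%:R.
Proof.
move=> x0; have cx : 0 <= Num.ceil x by rewrite ceil_ge0 (lt_le_trans _ x0)// ltrN10.
have -> : (nat_ceil x)%:R = (Num.ceil x)%:~R :> R.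
  by rewrite /nat_ceil pmulrn gez0_abs.
exact: ceil_ge.
Qed.

Lemma nat_ceil_lt x : 0 <= x -> (nat_ceil x)%:R < x + 1.
Proof.
move=> x0; have cx : 0 <= Num.ceil x by rewrite ceil_ge0 (lt_le_trans _ x0)// ltrN10.
have -> : (nat_ceil x)%:R = (Num.ceil x)%:~R :> R.
  by rewrite /nat_ceil pmulrn gez0_abs.
by have := ceilB1_lt x; rewrite intrB; lra.
Qed.

Lemma powR2 x : 0 <= x -> x `^ 2 = x ^+ 2.
Proof. by move=> x0; rewrite (powR_mulrn 2). Qed.

Lemma sample_size_value_ge e eta : 0 < e -> 0 < eta < 2 ->
  1 / (2 * e ^+ 2) * ln (2 / eta) <= (sample_size_value e eta)%:R.
Proof.
move=> e0 /andP[eta0 eta2]; rewrite /sample_size_value powR2; last exact: ltW.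
apply: nat_ceil_ge.
rewrite mulr_ge0//; first by rewrite divr_ge0// mulr_ge0// sqr_ge0.
by rewrite ln_ge0// ler_pdivlMr// mul1r ltW.
Qed.

Lemma sample_size_value_gt0 e eta : 0 < e -> 0 < eta < 2 ->
  (0 < sample_size_value e eta)%N.
Proof.
move=> e0 eta02; have := sample_size_value_ge e0 eta02.
have /andP[eta0 eta2] := eta02.
have : 0 < 1 / (2 * e ^+ 2) * ln (2 / eta).
  rewrite mulr_gt0//; first by rewrite divr_gt0// mulr_gt0// exprn_gt0.
  by rewrite ln_gt0// ltr_pdivlMr// mul1r.
by move=> /lt_le_trans h /h; rewrite ltr0n.
Qed.

Lemma sample_size_valueP e eta : 0 < e -> 0 < eta < 2 ->
  2 * expR (- (2 * (sample_size_value e eta)%:R * e ^+ 2)) <= eta.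
Proof.
move=> e0 eta02; have := sample_size_value_ge e0 eta02.
have /andP[eta0 eta2] := eta02; set N := (_)%:R.
rewrite mul1r ler_pdivrMl ?mulr_gt0 ?exprn_gt0// => h.
rewrite -ler_pdivlMl// expRN -[leRHS]invrK lef_pV2 ?posrE ?expR_gt0 ?invr_gt0//; last first.
  by rewrite mulr_gt0// invr_gt0.
rewrite -[leLHS]lnK ?posrE ?invr_gt0 ?mulr_gt0 ?invr_gt0// ler_expR.
by rewrite invfM invrK; lra.
Qed.

Lemma repetitions_valueP delta : 0 < delta < 2 ->
  expR (- ((repetitions_value delta)%:R / 8)) <= delta / 2.
Proof.
move=> /andP[d0 d2].
have : 8 * ln (2 * (1 / delta)) <= (repetitions_value delta)%:R.
  by apply: nat_ceil_ge; rewrite mulr_ge0// ln_ge0// mul1r ler_pdivlMr// mul1r ltW.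
rewrite mul1r => h.
rewrite -[leRHS](invrK) invfM invrK expRN lef_pV2 ?posrE ?expR_gt0//; last first.
  by rewrite mulr_gt0// invr_gt0.
rewrite -[leLHS]lnK ?posrE ?mulr_gt0 ?invr_gt0// ler_expR mulrC; lra.
Qed.

End sample_sizes.

Section amplification.
Context (R : realType) (T D : nat).
Context (g : forall t : 'I_T.+1, 'M[R]_(D, t) -> R).
Context (kappa : forall t : 'I_T.+1, R.-pker 'M[R]_(D, t) ~> 'M[R]_(D, T)).
Local Notation prog := (prog R T D).
Local Notation expect := (expect g kappa).
Local Notation has_law := (has_law g kappa).
Local Notation pr := (pr g kappa).

(** One half of the deviation is due to the errors of the second stage, the other half
is bounded by Hoeffding's inequality. *)
Lemma pr_mean_deviation (t : 'I_T.+1) (gamma : 'M[R]_(D, t))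
    (q : 'M[R]_(D, T) -> prog R) (y : 'M[R]_(D, T) -> R) (A b e : R) N :
  (0 < N)%N -> 0 < e -> 0 <= b ->
  bounded_measurable y -> (forall M, has_law (q M)) ->
  {ae kappa t gamma, forall M, A <= y M <= A + 1} ->
  {ae kappa t gamma, forall M,
    (pr (q M) [set x | (e < `|x - y M|)%R] <= b%:E)%E} ->
  (pr (bind (for_each (iota 1 N) (fun=> bind (call_oracle gamma) q))
        (fun A0 => Ret R T D (1 / N%:R * \sum_(x <- A0) x)%R))
     [set x | (2 * e < `|x - Exp (kappa t gamma) y|)%R]
   <= (N%:R * b + 2 * expR (- (2 * N%:R * e ^+ 2)))%:E)%E.
Proof.
move=> N0 e0 b0 by_ lq yA qy; set m := Exp _ _.
have k1 : kappa t gamma setT = 1%E by exact: prob_kernel.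
have Ngt0 : 0 < N%:R :> R by rewrite ltr0n.
rewrite /pr expect_bind.
(* Below, lam = 4 e minimizes lam^2/8 - lam e. *)
have mgf lam : Exp (kappa t gamma) (fun M => expR (lam * (y M - m))) <= expR (lam ^+ 2 / 8).
  exact: (hoeffding_mgf k1 _ by_ yA).
have mgfN : Exp (kappa t gamma) (fun M => expR (- (4 * e) * (y M - m))) <=
    expR ((4 * e) ^+ 2 / 8) by rewrite -sqrrN; exact: mgf.
have lam0 : 0 <= 4 * e by rewrite mulr_ge0// ltW.
have := @expect_sum_deviation _ _ _ g kappa nat (iota 1 N) t gamma q y b e (4 * e) m
  (expR ((4 * e) ^+ 2 / 8)) (N%:R * (2 * e)) (N%:R * m) by_ lq b0 (ltW e0) lam0
  (expR_ge0 _) qy (mgf _) mgfN.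
rewrite size_iota subrr !mulr0 expR0 => h.
apply: le_trans (le_trans h _); last first.
  rewrite lee_fin lerD2l -expRM_natl -expRD -[1 + 1]/(2%:R) mulrC ler_pM2l//.
  rewrite ler_expR le_eqVlt; apply/orP; left; apply/eqP; by field.
apply: le_expect => l; rewrite /= lee_fin// !indicE.
case: (boolP (_ \in [set x | 2 * e < _])) => //; rewrite inE /= => hl.
rewrite mem_set//= .
rewrite (_ : _ - _ = N%:R * (1 / N%:R * \sum_(x <- l) x - m)); last first.
  by field; rewrite gt_eqF.
by rewrite normrM ger0_norm ?ler0n// ltr_pM2l.
Qed.

(** If the median is off, then so is at least half of the outputs, each of them with
probability at most 1/4. *)
Lemma pr_median_deviation n (p : prog R) (e c : R) :
  has_law p -> (pr p [set x | (e < `|x - c|)%R] <= (1 / 4)%:E)%E ->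
  (pr (median_of n p) [set x | (e < `|x - c|)%R] <= (expR (- (n%:R / 8)))%:E)%E.
Proof.
move=> lp pB; set B := [set x | _] in pB *.
(* With this lam the bound is (3/4)^(n/2), and ln(3/4) <= -1/4. *)
pose lam : R := ln 3.
have lam0 : 0 <= lam by rewrite ln_ge0//; lra.
have q0 : (0 : R) <= 1 / 4 by lra.
have := expect_count_ge (iota 1 n) (n%:R / 2) lp (measurable_dist_gt e c) q0 pB lam0.
rewrite size_iota lnK ?posrE//.
move=> h; rewrite /pr /median_of expect_bind; apply: le_trans (le_trans h _).
  apply: le_expect_for_each => [l|l]; first by rewrite lee_fin.
  rewrite size_iota /= lee_fin !indicE => ln.
  case: (boolP (_ \in B)) => // mB; rewrite mem_set//=.
  rewrite ler_pdivrMr// -natrM ler_nat mulnC leqNgt; apply/negP => hc.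
  move: mB; rewrite inE /B /=; apply/negP; rewrite -leNgt ler_distl.
  apply: median_in_interval; rewrite ln; apply: leq_ltn_trans hc.
  rewrite leq_mul2l /=; apply: sub_count => x; rewrite -ler_distl -ltNge => xB.
  by rewrite inE.
rewrite lee_fin (_ : 1 + (3 - 1) * (1 / 4) = expR (ln (3 / 2))); last first.
  by rewrite lnK ?posrE//; lra.
rewrite -expRM_natl -expRD ler_expR.
have : ln (1 + (3 / 4 - 1) : R) <= 3 / 4 - 1 by apply: le_ln1Dx; lra.
rewrite [in ln _]addrC subrK.
have -> : ln (3 / 4 : R) = 2 * ln (3 / 2) - ln 3.
  apply: expR_inj; rewrite expRB expRM_natl !lnK ?posrE//; by [|lra|field].
rewrite -/lam => hl; have n0 : 0 <= n%:R :> R by [].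
rewrite (_ : _ + _ = n%:R * (ln (3 / 2) - lam / 2)); last by field.
have h8 : ln (3 / 2) - lam / 2 <= - (1 / 8) by lra.
by have := ler_wpM2l n0 h8; lra.
Qed.

End amplification.

(** * Expectations conditional on the past *)

Section constant_kernel.
Context d d' (X : measurableType d) (Y : measurableType d') (R : realType).
Variable (P : probability Y R).

Definition kconst (_ : X) : {measure set Y -> \bar R} := P.

Let measurable_kconst U : measurable U -> measurable_fun setT (kconst ^~ U).
Proof. by move=> _; exact: measurable_cst. Qed.

HB.instance Definition _ := isKernel.Build _ _ _ _ _ kconst measurable_kconst.

Let kconst_prob x : kconst x [set: Y] = 1%E.
Proof. exact: probability_setT. Qed.

HB.instance Definition _ := Kernel_isProbability.Build _ _ _ _ _
  kconst kconst_prob.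

End constant_kernel.

Section kernel_mixture.
Context d d' (X : measurableType d) (Y : measurableType d') (R : realType).
Variables (k k' : R.-pker X ~> Y) (A : set X).

(** Switches between two kernels according to an event; used to redraw a path only
where its past lies in A. *)
Definition kmix (mA : measurable A) (x : X) : {measure set Y -> \bar R} :=
  if x \in A then k x else k' x.

Hypothesis mA : measurable A.

Let measurable_kmix U : measurable U -> measurable_fun setT (kmix mA ^~ U).
Proof.
move=> mU; rewrite (_ : kmix mA ^~ U = fun x => if x \in A then k x U else k' x U).
  apply: measurable_fun_ifT; [|exact: measurable_kernel|exact: measurable_kernel].
  apply: (measurable_fun_bool true).
  rewrite setTI (_ : _ @^-1` _ = A)//.
  by apply/seteqP; split => x /=; [move/set_mem|move/mem_set].
by apply/funext => x; rewrite /kmix; case: ifP.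
Qed.

HB.instance Definition _ := isKernel.Build _ _ _ _ _ (kmix mA) measurable_kmix.

Let kmix_prob x : kmix mA x [set: Y] = 1%E.
Proof. by rewrite /kmix; case: ifP => _; exact: prob_kernel. Qed.

HB.instance Definition _ := Kernel_isProbability.Build _ _ _ _ _
  (kmix mA) kmix_prob.

End kernel_mixture.

Section kernel_expectation.
Context d d' (X : measurableType d) (Y : measurableType d') (R : realType).
Variable k : R.-pker X ~> Y.

(** Integrals of nonnegative functions against a kernel are measurable, hence the
shift by the bound K. *)
Lemma bounded_measurable_Exp_kernel (f : Y -> R) : bounded_measurable f ->
  bounded_measurable (fun x => Exp (k x) f).
Proof.
move=> bf; have [mf [K fK]] := bf.
have K0 : 0 <= K by exact: le_trans (fK point).
have bc (r : R) := bounded_measurable_cst Y r.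
have ExpK x : Exp (k x) f = Exp (k x) (fun y => f y + K) - K.
  have k1 : k x setT = 1%E by exact: prob_kernel.
  by rewrite ExpD // Exp_cst // addrK.
split; last first.
  exists K => x; rewrite ler_norml; have k1 : k x setT = 1%E by exact: prob_kernel.
  apply/andP; split.
    rewrite -[leLHS](Exp_cst k1); apply: le_Exp => // y.
    by have := fK y; rewrite ler_norml => /andP[].
  rewrite -[leRHS](Exp_cst k1); apply: le_Exp => // y.
  by have := fK y; rewrite ler_norml => /andP[].
rewrite (_ : (fun x => _) = fun x => Exp (k x) (fun y => f y + K) - K); last first.
  by apply/funext => x; exact: ExpK.
apply: measurable_funB; last exact: measurable_cst.
rewrite /Exp; apply: (measurableT_comp (@fine_measurable R setT measurableT)).
apply: measurable_fun_integral_kernel.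
- by move=> U mU; exact: measurable_kernel.
- by move=> y; rewrite lee_fin -lerBlDr sub0r; have := fK y; rewrite ler_norml => /andP[].
- by apply/measurable_EFinP; exact: measurable_funD.
Qed.

End kernel_expectation.

Lemma bounded_measurable_comp d d' (X : measurableType d) (Y : measurableType d')
    (R : realType) (f : Y -> R) (h : X -> Y) :
  measurable_fun setT h -> bounded_measurable f -> bounded_measurable (f \o h).
Proof. by move=> mh [mf [K fK]]; split; [exact: measurableT_comp|exists K => x /=]. Qed.

Section conditional_expectation.
Context d (Omega : measurableType d) (R : realType) (P : probability Omega R).
Context (T D : nat) (Y : Omega -> 'M[R]_(D, T)) (mY : measurable_fun setT Y).
Context (t : 'I_T.+1) (k : R.-pker 'M[R]_(D, t) ~> 'M[R]_(D, T)).
Hypothesis hk : conditional_law P Y k.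
Let P1 : P setT = 1%E := probability_setT P.
Let X w := prefix t (Y w).

Lemma measurable_prefix_process : measurable_fun setT X.
Proof. exact: (measurableT_comp (@measurable_prefix _ _ _ t) mY). Qed.
Let mX := measurable_prefix_process.

Lemma measurable_prefix_event A : measurable A -> measurable [set w | A (X w)].
Proof. by move=> mA; have := mX measurableT mA; rewrite setTI. Qed.

(** The defining identity of a conditional law extended from events to functions.
Redrawing the path from its conditional law where its past lies in A, or keeping
it, gives the same law of the path by that identity; so both ways of
drawing give the same integrals. *)
Lemma Exp_tower (A : set 'M[R]_(D, t)) (f : 'M[R]_(D, T) -> R) :
  measurable A -> bounded_measurable f ->
  Exp P (fun w => \1_A (X w) * Exp (k (X w)) f) =
  Exp P (fun w => \1_A (X w) * f (Y w)).
Proof.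
move=> mA.
pose A' : set Omega := [set w | A (X w)].
have mA' : measurable A' := measurable_prefix_event mA.
pose k1 := kmix (kprecomp k mX) (kdirac mY) mA'.
pose k2 : R.-pker Omega ~> 'M[R]_(D, T) := kdirac mY.
have ms : measurable_fun setT (@snd unit Omega) by exact: measurable_snd.
pose kP : R.-pker unit ~> Omega := @kconst _ _ unit Omega R P.
pose c1 := pkcomp kP (kprecomp k1 ms).
pose c2 := pkcomp kP (kprecomp k2 ms).
have c12 B : measurable B -> c1 tt B = c2 tt B.
  move=> mB; rewrite /c1 /c2 /pkcomp /mkcomp /= /kcomp /kP /kconst /=.
  rewrite /kprecomp /= /k1 /k2 /kmix.
  have mYB : measurable [set w | B (Y w)].
    by have := mY measurableT mB; rewrite setTI.
  rewrite (_ : (fun w => _) = (fun w => (\1_A' w)%:E * k (X w) B +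
     (\1_([set w | B (Y w)] `\` A') w)%:E))%E; last first.
    apply/funext => w; rewrite !indicE in_setD.
    case: ifPn => wA /=; first by rewrite andbF mul1e adde0.
    rewrite andbT mul0e add0e /kdirac /dirac/= indicE.
    by congr ((nat_of_bool _)%:R%:E).
  have mkX : measurable_fun setT (fun w => k (X w) B).
    exact: (measurableT_comp (measurable_kernel k B mB) mX).
  rewrite ge0_integralD//; last 2 first.
  - by apply: emeasurable_funM => //; apply/measurable_EFinP; exact: measurable_indic.
  - by apply/measurable_EFinP; apply: measurable_indic; exact: measurableD.
  rewrite integral_indic ?setIT//; last exact: measurableD.
  have -> : (\int[P]_w ((\1_A' w)%:E * k (X w) B) = P (A' `&` [set w | B (Y w)]))%E.
    rewrite (hk mA mB) [RHS]integral_mkcond; apply: eq_integral => w _.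
    by rewrite patchE indicE /X; case: (_ \in _); rewrite ?mul1e ?mul0e.
  have -> : (\int[P]_w \d_(Y w) B = P [set w | B (Y w)])%E.
    rewrite -[in RHS](setIT [set w | B (Y w)]) -(integral_indic P measurableT)//.
  rewrite -measureU//; [|exact: measurableI|exact: measurableD|].
    congr (P _); apply/seteqP; split => w /=; first by case=> [[]|[]].
    by have [|] := pselect (A' w); [left|right].
  by apply/seteqP; split => w //= [[? _] [_ /=]].
(* General f is reduced to nonnegative f by adding its bound K. *)
have main (f0 : 'M[R]_(D, T) -> R) : (forall M, 0 <= f0 M) -> bounded_measurable f0 ->
   Exp P (fun w => \1_A (X w) * Exp (k (X w)) f0) = Exp P (fun w => \1_A (X w) * f0 (Y w)).
  move=> f0_ge bf0; have [mf0 _] := bf0.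
  have mf0E : measurable_fun setT (EFin \o f0) by exact/measurable_EFinP.
  have bK : bounded_measurable (fun w => Exp (k (X w)) f0).
    exact: (bounded_measurable_comp mX (bounded_measurable_Exp_kernel k bf0)).
  have bfY : bounded_measurable (f0 \o Y) by exact: bounded_measurable_comp.
  have bA : bounded_measurable (fun w => \1_A (X w) : R).
    exact: (bounded_measurable_comp mX (bounded_measurable_indic _ mA)).
  have : (\int[c1 tt]_M (f0 M)%:E = \int[c2 tt]_M (f0 M)%:E)%E.
    by apply: eq_measure_integral => B mB _; exact: c12.
  rewrite /c1 /c2 /pkcomp /mkcomp /= !integral_kcomp//; try by move=> M; rewrite lee_fin.
  rewrite /kP /kconst /= /kprecomp /= /k1 /k2 /kmix.
  rewrite (_ : (fun w => _) = (fun w => (\1_A (X w) * Exp (k (X w)) f0 +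
     (1 - \1_A (X w)) * f0 (Y w))%:E)); last first.
    apply/funext => w; rewrite indicE (_ : (X w \in A) = (w \in A')); last first.
      by apply/idP/idP => /set_mem h; apply/mem_set.
    case: ifPn => wA; rewrite /= ?mulr1n ?mulr0n.
      rewrite mul1r subrr mul0r addr0 -EFin_Exp//; exact: prob_kernel.
    by rewrite mul0r add0r subr0 mul1r integral_dirac// diracT mul1e.
  rewrite (_ : (\int[P]_x _)%E = (Exp P (fun w => \1_A (X w) * Exp (k (X w)) f0 +
     (1 - \1_A (X w)) * f0 (Y w)))%:E); last first.
    rewrite EFin_Exp//; apply: bounded_measurableD; apply: bounded_measurableM => //.
    by apply: bounded_measurableB => //; exact: bounded_measurable_cst.
  rewrite (_ : (\int[P]_x _)%E = (Exp P (f0 \o Y))%:E); last first.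
    rewrite -EFin_Exp//; apply: eq_integral => w _.
    by rewrite integral_dirac// diracT mul1e.
  have b1 : bounded_measurable (fun w => (1 - \1_A (X w)) * f0 (Y w)).
    apply: bounded_measurableM => //; apply: bounded_measurableB => //.
    exact: bounded_measurable_cst.
  move=> [] ; rewrite ExpD//; last exact: bounded_measurableM.
  move=> /(congr1 (fun x => x - Exp P (fun w => (1 - \1_A (X w)) * f0 (Y w)))).
  rewrite addrK -ExpB// => ->; congr Exp; apply/funext => w /=; ring.
move=> bf; have [mf [K fK]] := bf.
have bA : bounded_measurable (fun w => \1_A (X w) : R).
  exact: (bounded_measurable_comp mX (bounded_measurable_indic _ mA)).
have bK : bounded_measurable (fun w => Exp (k (X w)) f).
  exact: (bounded_measurable_comp mX (bounded_measurable_Exp_kernel k bf)).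
have bc (r : R) := bounded_measurable_cst 'M[R]_(D, T) r.
have bcO (r : R) := bounded_measurable_cst Omega r.
have := main (fun M => f M + K).
have fK0 M : 0 <= f M + K.
  by rewrite -lerBlDr sub0r; have := fK M; rewrite ler_norml => /andP[].
move=> /(_ fK0 (bounded_measurableD bf (bc K))).
rewrite (_ : (fun w => _ * Exp _ _) =
    (fun w => \1_A (X w) * Exp (k (X w)) f + \1_A (X w) * K)); last first.
  apply/funext => w; rewrite ExpD//; last exact: prob_kernel.
  by rewrite Exp_cst ?mulrDr//; exact: prob_kernel.
rewrite (_ : (fun w => _ * (_ + K)) =
    (fun w => \1_A (X w) * f (Y w) + \1_A (X w) * K)); last first.
  by apply/funext => w; rewrite mulrDr.
have bAK : bounded_measurable (fun w => \1_A (X w) * K) by exact: bounded_measurableM.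
have bfY : bounded_measurable (f \o Y) by exact: bounded_measurable_comp.
rewrite !ExpD//; try exact: bounded_measurableM.
exact: addIr.
Qed.

End conditional_expectation.

(** * The expansion of the optimal value *)

Section maxima.
Context (R : realType) (I : eqType).
Implicit Types (F : I -> R) (s : seq I).

Lemma foldl_max_le (x c : R) (l : seq R) :
  (foldl Num.max x l <= c) = (x <= c) && all (<= c) l.
Proof. by elim: l x => [|y l IH] x /=; rewrite ?andbT// IH ge_max andbA. Qed.

Lemma fold1_max_le F s c : (0 < size s)%N ->
  (fold1 Num.max [seq F j | j <- s] <= c) = all (fun j => F j <= c) s.
Proof. by case: s => // j s _; rewrite /fold1 /= foldl_max_le all_map. Qed.

Lemma fold1_max_ge F s i : i \in s -> F i <= fold1 Num.max [seq F j | j <- s].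
Proof.
move=> si; have s0 : (0 < size s)%N by case: s si.
by have := lexx (fold1 Num.max [seq F j | j <- s]); rewrite {1}fold1_max_le// => /allP ->.
Qed.

Lemma fold1_max_mem F s : (0 < size s)%N ->
  exists2 i, i \in s & fold1 Num.max [seq F j | j <- s] = F i.
Proof.
case: s => // j s _; rewrite /fold1 /=.
elim: s j => [|k s IH] j /=; first by exists j; rewrite ?mem_seq1.
have [jk|kj] := leP (F j) (F k).
  by have [i si ->] := IH k; exists i => //; rewrite inE si orbT.
have [i si ->] := IH j; exists i => //.
by move: si; rewrite !inE => /orP[->//|->]; rewrite !orbT.
Qed.

End maxima.

Section value_functions.
Context (R : realType) (T D : nat).
Context (g : forall t : 'I_T.+1, 'M[R]_(D, t) -> R).
Context (kappa : forall t : 'I_T.+1, R.-pker 'M[R]_(D, t) ~> 'M[R]_(D, T)).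
Hypothesis hT : (1 <= T)%N.
Hypothesis mg : forall t : 'I_T.+1, (1 <= t)%N -> measurable_fun setT (@g t).

(** Conditioning is by the given kernel at every argument, also where the past has
probability zero; so the values are functions, and the inequalities between
them hold almost surely. *)
Fixpoint value k (t : 'I_T.+1) (gamma : 'M[R]_(D, t)) : R :=
  if k is k'.+1 then
    value k' gamma - Exp (kappa t gamma) (fun M =>
      fold1 Num.max [seq value k' (prefix (date j) M) | j <- enum 'I_T])
  else Num.max 0 (Num.min (g gamma) 1).

Definition max_value k (M : 'M[R]_(D, T)) : R :=
  fold1 Num.max [seq value k (prefix (date j) M) | j <- enum 'I_T].

Lemma valueS k (t : 'I_T.+1) (gamma : 'M[R]_(D, t)) :
  value k.+1 gamma = value k gamma - Exp (kappa t gamma) (max_value k).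
Proof. by []. Qed.

Lemma size_enum_gt0 : (0 < size (enum 'I_T))%N.
Proof. by rewrite size_enum_ord. Qed.

Lemma value_le_max k j M : value k (prefix (date j) M) <= max_value k M.
Proof. by apply: (fold1_max_ge (fun j => value k (prefix (date j) M))); rewrite mem_enum. Qed.

Lemma max_value_mem k M : exists j, max_value k M = value k (prefix (date j) M).
Proof.
have [j _ e] := fold1_max_mem (fun j => value k (prefix (date j) M)) size_enum_gt0.
by exists j.
Qed.

Lemma bounded_measurable_fold1_max d (X : measurableType d) (I : Type) (s : seq I)
    (F : I -> X -> R) :
  (forall i, bounded_measurable (F i)) ->
  bounded_measurable (fun x => fold1 Num.max [seq F i x | i <- s]).
Proof.
move=> bF; case: s => [|i s]; first exact: bounded_measurable_cst.
rewrite /fold1 /=; have := bF i; move: (F i).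
elim: s => //= j s IH f bf; apply: (IH (fun x => Num.max (f x) (F j x))).
exact: bounded_measurable_max.
Qed.

Lemma bounded_measurable_max_value_of k :
  (forall t : 'I_T.+1, (1 <= t)%N -> bounded_measurable (@value k t)) ->
  bounded_measurable (max_value k).
Proof.
move=> bk; apply: bounded_measurable_fold1_max => j.
exact: (bounded_measurable_comp (@measurable_prefix _ _ _ (date j)) (bk (date j) isT)).
Qed.

Lemma bounded_measurable_value k (t : 'I_T.+1) : (1 <= t)%N ->
  bounded_measurable (@value k t).
Proof.
elim: k t => [|k IH] t t1.
  split.
    by apply: measurable_maxr => //; apply: measurable_minr => //; exact: mg.
  exists 1 => gamma /=; rewrite ger0_norm ?le_max ?lexx//.
  by rewrite ge_max ler01 ge_min lexx orbT.
apply: bounded_measurableB; first exact: IH.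
apply: bounded_measurable_Exp_kernel; exact: bounded_measurable_max_value_of.
Qed.

Lemma bounded_measurable_max_value k : bounded_measurable (max_value k).
Proof. by apply: bounded_measurable_max_value_of; exact: bounded_measurable_value. Qed.

End value_functions.

Section law_of_process.
Context d (Omega : measurableType d) (R : realType) (P : probability Omega R).
Context (T D : nat) (Y : Omega -> 'M[R]_(D, T)) (mY : measurable_fun setT Y).
Context (kappa : forall t : 'I_T.+1, R.-pker 'M[R]_(D, t) ~> 'M[R]_(D, T)).
Hypothesis hkappa : forall t : 'I_T.+1, conditional_law P Y (kappa t).

(** The law of the whole process: there is only one past of length 0. *)
Definition path_law : {measure set 'M[R]_(D, T) -> \bar R} :=
  kappa ord0 0.
Local Notation mu := path_law.
Let P1 : P setT = 1%E := probability_setT P.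
Let mu1 : mu setT = 1%E := prob_kernel _.

Lemma prefix0 M : prefix (@ord0 T) M = 0 :> 'M[R]_(D, @ord0 T).
Proof. by apply/matrixP => i []. Qed.

Lemma measurable_path_event B : measurable B -> measurable [set w | B (Y w)].
Proof. by move=> mB; have := mY measurableT mB; rewrite setTI. Qed.

Lemma path_lawE B : measurable B -> mu B = P [set w | B (Y w)].
Proof.
move=> mB; have := hkappa measurableT mB (t := ord0).
rewrite (_ : [set w | _] = setT); last by apply/seteqP; split.
rewrite setTI => ->.
rewrite (_ : (fun w => _) = cst (mu B)); last first.
  by apply/funext => w; rewrite prefix0.
rewrite integral_cst; last exact: measurableT.
by rewrite -[LHS]mule1; congr (_ * _)%E; exact/esym/P1.
Qed.

Lemma Exp_path_law (f : 'M[R]_(D, T) -> R) : bounded_measurable f ->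
  Exp mu f = Exp P (f \o Y).
Proof.
move=> bf; have := Exp_tower mY (hkappa (t := ord0)) measurableT bf.
rewrite (_ : (fun w => _) = (fun=> Exp mu f)).
  rewrite (Exp_cst P1) => ->; congr Exp; apply/funext => w /=.
  by rewrite indicT mul1r.
by apply/funext => w; rewrite prefix0 indicT mul1r.
Qed.

Lemma ae_path_process (Q : 'M[R]_(D, T) -> Prop) :
  {ae mu, forall M, Q M} -> {ae P, forall w, Q (Y w)}.
Proof.
move=> [N [mN N0 QN]]; exists [set w | N (Y w)]; split.
- exact: measurable_path_event.
- by rewrite -path_lawE.
- by move=> w nQ; exact: QN.
Qed.

(** The event is required to be measurable because a null set of outcomes need not
be the preimage of a null set of paths. *)
Lemma ae_process_path (Q : 'M[R]_(D, T) -> Prop) : measurable [set M | Q M] ->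
  {ae P, forall w, Q (Y w)} -> {ae mu, forall M, Q M}.
Proof.
move=> mQ [N [mN N0 QN]]; exists (~` [set M | Q M]); split => //.
- exact: measurableC.
- rewrite path_lawE; last exact: measurableC.
  apply: (subset_measure0 _ mN _ N0) => //.
  by apply: measurable_path_event; exact: measurableC.
Qed.

(** The mean over the past of the conditional probability of a null set of paths
is its probability, which is zero. *)
Lemma ae_kernel (t : 'I_T.+1) (Q : 'M[R]_(D, T) -> Prop) :
  {ae mu, forall M, Q M} ->
  {ae mu, forall M, {ae kappa t (prefix t M), forall M', Q M'}}.
Proof.
move=> [N [mN N0 QN]].
have mk : measurable_fun setT (fun M => kappa t (prefix t M) N).
  exact: (measurableT_comp (measurable_kernel (kappa t) N mN) (@measurable_prefix _ _ _ t)).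
suff : {ae mu, forall M, kappa t (prefix t M) N = 0%E}.
  by apply: filterS => M kN; exists N.
apply: ae_process_path.
  have := mk measurableT [set 0%E] (emeasurable_set1 _).
  by rewrite setTI.
have mkY : measurable_fun setT (fun w => kappa t (prefix t (Y w)) N).
  exact: (measurableT_comp mk mY).
have : (\int[P]_w `|kappa t (prefix t (Y w)) N| = 0)%E.
  under eq_integral do rewrite gee0_abs//.
  have := hkappa measurableT mN (t := t).
  rewrite (_ : [set w | _] = setT); last by apply/seteqP; split.
  by rewrite setTI -path_lawE// N0 => <-.
by move=> /(ae_eq_integral_abs P measurableT mkY); apply: filterS => w; exact.
Qed.

Lemma measurable_le (f h : 'M[R]_(D, T) -> R) :
  bounded_measurable f -> bounded_measurable h -> measurable [set M | f M <= h M].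
Proof.
move=> [mf _] [mh _]; rewrite (_ : [set _ | _] = (fun M => f M <= h M) @^-1` [set true])//.
by rewrite -[_ @^-1` _]setTI; exact: measurable_fun_ler.
Qed.

(** The conditional expectation can be compared with f on the event of the past
where it is smaller than h, by the tower property; this event is then null. *)
Lemma cond_le (t : 'I_T.+1) (h : 'M[R]_(D, t) -> R) (f : 'M[R]_(D, T) -> R) :
  bounded_measurable h -> bounded_measurable f ->
  {ae mu, forall M, h (prefix t M) <= f M} ->
  {ae mu, forall M, h (prefix t M) <= Exp (kappa t (prefix t M)) f}.
Proof.
move=> bh bf hf.
have bK := bounded_measurable_Exp_kernel (kappa t) bf.
have mX : measurable_fun setT (fun w => prefix t (Y w)).
  exact: (measurable_prefix_process mY).
have bhp := bounded_measurable_comp (@measurable_prefix _ _ _ t) bh.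
have bKp := bounded_measurable_comp (@measurable_prefix _ _ _ t) bK.
apply: ae_process_path; first exact: measurable_le.
(* On the event A the difference is positive, but its mean is at most zero. *)
pose A := [set gamma | Exp (kappa t gamma) f < h gamma].
have mA : measurable A.
  have [mh _] := bh; have [mK _] := bK.
  rewrite (_ : A = (fun gamma => Exp (kappa t gamma) f < h gamma) @^-1` [set true])//.
  by rewrite -[_ @^-1` _]setTI; exact: measurable_fun_ltr.
have bA := bounded_measurable_comp mX (bounded_measurable_indic R mA).
have bhX := bounded_measurable_comp mX bh.
have bKX := bounded_measurable_comp mX bK.
have bfY := bounded_measurable_comp mY bf.
pose F w := \1_A (prefix t (Y w)) * (h (prefix t (Y w)) - Exp (kappa t (prefix t (Y w))) f).
have F0 w : 0 <= F w.
  rewrite /F indicE; case: (boolP (_ \in _)) => [|_]; rewrite ?mul0r// mul1r.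
  by rewrite inE /A /= => /ltW; rewrite subr_ge0.
have bF : bounded_measurable F.
  by apply: bounded_measurableM => //; exact: bounded_measurableB.
have EF : Exp P F <= 0.
  rewrite (_ : F = (fun w => \1_A (prefix t (Y w)) * h (prefix t (Y w)) -
      \1_A (prefix t (Y w)) * Exp (kappa t (prefix t (Y w))) f)); last first.
    by apply/funext => w; rewrite /F mulrBr.
  rewrite ExpB//; try exact: bounded_measurableM.
  rewrite (Exp_tower mY (hkappa (t := t)) mA bf) subr_le0.
  apply: le_ae_Exp => //; try exact: bounded_measurableM.
  by have := ae_path_process hf; apply: filterS => w hw; rewrite ler_wpM2l.
have : (\int[P]_w `|(F w)%:E| = 0)%E.
  under eq_integral do rewrite gee0_abs ?lee_fin//.
  apply/eqP; rewrite eq_le; apply/andP; split; last first.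
    by apply: integral_ge0 => w _; rewrite lee_fin.
  by rewrite EFin_Exp.
have mFE : measurable_fun setT (EFin \o F) by case: bF => mF _; exact/measurable_EFinP.
move=> /(ae_eq_integral_abs P measurableT mFE); apply: filterS => w /(_ I) [].
rewrite /F indicE => Fw; rewrite leNgt; apply/negP => lt.
move: Fw; rewrite mem_set// mul1r => /eqP; rewrite subr_eq0 => /eqP e.
by move: lt; rewrite e ltxx.
Qed.

Lemma cond_ge (t : 'I_T.+1) (h : 'M[R]_(D, t) -> R) (f : 'M[R]_(D, T) -> R) :
  bounded_measurable h -> bounded_measurable f ->
  {ae mu, forall M, f M <= h (prefix t M)} ->
  {ae mu, forall M, Exp (kappa t (prefix t M)) f <= h (prefix t M)}.
Proof.
move=> bh bf hf.
have := @cond_le t (fun M => - h M) (fun M => - f M)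
  (bounded_measurableN bh) (bounded_measurableN bf).
have H : {ae mu, forall M, - h (prefix t M) <= - f M}.
  by apply: filterS hf => M; rewrite lerN2.
move=> /(_ H); apply: filterS => M.
rewrite (_ : (fun M => - f M) = (fun M => -1 * f M)); last first.
  by apply/funext => M'; rewrite mulN1r.
by rewrite ExpZ ?mulN1r ?lerN2//; exact: prob_kernel.
Qed.

End law_of_process.

Section finite_ae.
Context d (X : measurableType d) (R : realType) (mu : {measure set X -> \bar R}).

Lemma ae_forall_fin (I : finType) (Q : I -> X -> Prop) :
  (forall i, {ae mu, forall x, Q i x}) -> {ae mu, forall x, forall i, Q i x}.
Proof. by move=> h; apply: filter_forall. Qed.

End finite_ae.

Section value_bounds.
Context d (Omega : measurableType d) (R : realType) (P : probability Omega R).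
Context (T D : nat) (hT : (1 <= T)%N).
Context (Y : Omega -> 'M[R]_(D, T)) (mY : measurable_fun setT Y).
Context (g : forall t : 'I_T.+1, 'M[R]_(D, t) -> R).
Hypothesis mg : forall t : 'I_T.+1, (1 <= t)%N -> measurable_fun setT (@g t).
Context (kappa : forall t : 'I_T.+1, R.-pker 'M[R]_(D, t) ~> 'M[R]_(D, T)).
Hypothesis hkappa : forall t : 'I_T.+1, conditional_law P Y (kappa t).
Local Notation mu := (path_law kappa).
Local Notation value := (value g kappa).
Local Notation max_value := (max_value g kappa).
Implicit Types (k l : nat) (t : 'I_T.+1).

Let bV k t : (1 <= t)%N -> bounded_measurable (@value k t) :=
  @bounded_measurable_value R T D g kappa mg k t.
Let bM k : bounded_measurable (max_value k) := bounded_measurable_max_value kappa mg k.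

Lemma date_surj t : (1 <= t)%N -> exists j, date j = t.
Proof.
case: (unliftP ord0 t) => [j ->|->] //; by exists j.
Qed.

Lemma value_le_max_date k t M : (1 <= t)%N -> value k (prefix t M) <= max_value k M.
Proof. by move=> /date_surj[j <-]; exact: value_le_max. Qed.

Lemma value0_bounds t (gamma : 'M[R]_(D, t)) : 0 <= value 0 gamma <= 1.
Proof. by rewrite /= le_max lexx/= ge_max ler01 ge_min lexx orbT. Qed.

Lemma max_value0_bounds M : 0 <= max_value 0 M <= 1.
Proof. by have [j ->] := max_value_mem g kappa hT 0 M; exact: value0_bounds. Qed.

(** The reward at any date is at most the maximum, and so at most the conditional
expectation of the maximum. *)
Lemma ae_valueS_le0 k :
  {ae mu, forall M, forall t, (1 <= t)%N -> value k.+1 (prefix t M) <= 0}.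
Proof.
apply: ae_forall_fin => t; have [t1|_] := boolP (1 <= t)%N; last exact: aeW.
have := cond_le mY hkappa (bV k t1) (bM k) (aeW _ (fun M => value_le_max_date k M t1)).
by apply: filterS => M h _; rewrite valueS subr_le0.
Qed.

Lemma ae_max_valueS_le0 k : {ae mu, forall M, max_value k.+1 M <= 0}.
Proof.
apply: filterS (ae_valueS_le0 k) => M h.
by have [j ->] := max_value_mem g kappa hT k.+1 M; exact: h.
Qed.

(** The martingale subtracted has nonpositive values, those of the conditional
expectation of a nonpositive maximum. *)
Lemma ae_valueS_nondecreasing k :
  {ae mu, forall M, forall t, (1 <= t)%N ->
    value k.+1 (prefix t M) <= value k.+2 (prefix t M)}.
Proof.
apply: ae_forall_fin => t; have [t1|_] := boolP (1 <= t)%N; last exact: aeW.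
have := cond_ge mY hkappa (t := t) (bounded_measurable_cst 'M[R]_(D, t) (0 : R))
  (bM k.+1) (ae_max_valueS_le0 k).
by apply: filterS => M h _; rewrite valueS lerBrDl gerDr.
Qed.

Lemma ae_valueS_ge k :
  {ae mu, forall M, forall t, (1 <= t)%N -> -1 <= value k.+1 (prefix t M)}.
Proof.
elim: k => [|k IH].
  apply: aeW => M t t1; rewrite valueS; have /andP[v0 _] := value0_bounds (prefix t M).
  have k1 : kappa t (prefix t M) setT = 1%E by exact: prob_kernel.
  have : Exp (kappa t (prefix t M)) (max_value 0) <= 1.
    rewrite -[leRHS](Exp_cst k1); apply: le_Exp => //.
      exact: bounded_measurable_cst.
    by move=> M'; have /andP[] := max_value0_bounds M'.
  lra.
apply: filterS2 IH (ae_valueS_nondecreasing k) => M h1 h2 t t1.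
exact: le_trans (h1 t t1) (h2 t t1).
Qed.

(** The values of level 0 lie between 0 and 1; those of a higher level are obtained
from them by subtracting at most 1 once, and by increasing steps afterwards. *)
Definition value_floor k : R := if k is 0 then 0 else -1.

Lemma ae_max_value_range k :
  {ae mu, forall M, value_floor k <= max_value k M <= value_floor k + 1}.
Proof.
case: k => [|k]; first by apply: aeW => M; rewrite add0r max_value0_bounds.
apply: filterS2 (ae_valueS_ge k) (ae_max_valueS_le0 k) => M h1 h2.
rewrite /= addNr h2 andbT.
by have [j ->] := max_value_mem g kappa hT k.+1 M; exact: h1.
Qed.

Lemma ae_max_valueS_nondecreasing k :
  {ae mu, forall M, max_value k.+1 M <= max_value k.+2 M}.
Proof.
apply: filterS (ae_valueS_nondecreasing k) => M h.
have [j ->] := max_value_mem g kappa hT k.+1 M.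
exact: le_trans (h (date j) isT) (value_le_max _ _ _ _ _).
Qed.

Lemma prefix_max M : prefix (@ord_max T) M = M :> 'M[R]_(D, T).
Proof. by apply/matrixP => i j; rewrite mxE; congr (M _ _); apply: val_inj. Qed.

(** The last past is the whole path, so there the conditional expectation of the
maximum is the maximum itself. *)
Lemma ae_terminal_value k :
  {ae mu, forall M, value k (prefix ord_max M) =
    value 0 (prefix ord_max M) - \sum_(0 <= l < k) max_value l M}.
Proof.
elim: k => [|k IH]; first by apply: aeW => M; rewrite big_nil subr0.
(* ord_max : 'I_T.+1 is the date T, so that pasts and paths have the same type. *)
pose h : 'M[R]_(D, @ord_max T) -> R := max_value k.
have bh : bounded_measurable h by exact: bM.
have hE M : h (prefix ord_max M) = max_value k M by rewrite /h prefix_max.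
have H1 : {ae mu, forall M, h (prefix ord_max M) <= max_value k M}.
  by apply: aeW => M; rewrite hE.
have H2 : {ae mu, forall M, max_value k M <= h (prefix ord_max M)}.
  by apply: aeW => M; rewrite hE.
have := cond_le mY hkappa bh (bM k) H1; have := cond_ge mY hkappa bh (bM k) H2.
apply: filterS3 IH => M IH h2 h1.
rewrite valueS IH big_nat_recr//= opprD addrA; congr (_ - _).
by apply/eqP; rewrite eq_le -hE h1 h2.
Qed.

(** At the last date the value of level k + 2 is nonpositive, and it is the reward
minus the maxima of the levels up to k + 1; the k + 1 maxima of positive level
thus add up to at least -1, and the last one is the largest. *)
Lemma ae_max_value_ge k :
  {ae mu, forall M, - (k.+1%:R)^-1 <= max_value k.+1 M}.
Proof.
have mono : {ae mu, forall M, forall l, (l <= k)%N -> max_value l.+1 M <= max_value k.+1 M}.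
  elim: k => [|k IH]; first by apply: aeW => M [].
  apply: filterS2 IH (ae_max_valueS_nondecreasing k) => M h1 h2 l.
  rewrite leq_eqVlt => /predU1P[->//|]; rewrite ltnS => /h1.
  by move=> /le_trans; apply.
apply: filterS3 mono (ae_terminal_value k.+2) (ae_valueS_le0 k.+1) => M h1 h2 h3.
have := h3 ord_max hT; rewrite h2 big_nat_recl//=.
have /andP[_ m0] := max_value0_bounds M.
have /andP[v0 _] := value0_bounds (prefix ord_max M).
have : \sum_(0 <= l < k.+1) max_value l.+1 M <= k.+1%:R * max_value k.+1 M.
  rewrite mulr_natl -[k.+1 in leRHS]subn0 -sumr_const_nat.
  by apply: ler_sum_nat => l /andP[_]; rewrite ltnS => /h1.
move=> hs hv; rewrite lerNl -div1r ler_pdivlMr ?ltr0n// mulrC mulrN.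
rewrite /= in v0; lra.
Qed.

End value_bounds.

Section restriction.
Context (R : realType) (T D : nat).

(** A prefix of a prefix, for arbitrary lengths, so that events of an earlier past
can be read as events of a later one. *)
Definition restrict (s t : nat) (gamma : 'M[R]_(D, t)) : 'M[R]_(D, s) :=
  \matrix_(i, l) if insub (val l) is Some l' then gamma i l' else 0.

Lemma restrict_prefix (s t : 'I_T.+1) M : (s <= t)%N ->
  restrict s (prefix t M) = prefix s M :> 'M[R]_(D, s).
Proof.
move=> st; apply/matrixP => i l; rewrite !mxE.
have lt : (l < t)%N by exact: leq_trans (ltn_ord l) st.
by rewrite insubT mxE; congr (M _ _); apply: val_inj.
Qed.

Lemma measurable_restrict_mx s t : measurable_fun setT (@restrict s t).
Proof.
apply: measurable_fun_into_mx => i l.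
case E : (insub (val l) : option 'I_t) => [l'|].
  rewrite (_ : (fun _ => _) = fun gamma : 'M[R]_(D, t) => gamma i l').
    exact: measurable_fun_mx_entry.
  by apply/funext => gamma; rewrite mxE E.
rewrite (_ : (fun _ => _) = fun=> 0 : R); first exact: measurable_cst.
by apply/funext => gamma; rewrite mxE E.
Qed.

End restriction.

Section stopping.
Context d (Omega : measurableType d) (R : realType) (P : probability Omega R).
Context (T D : nat) (hT : (1 <= T)%N).
Context (Y : Omega -> 'M[R]_(D, T)) (mY : measurable_fun setT Y).
Local Notation past t w := (prefix t (Y w)).
Let P1 : P setT = 1%E := probability_setT P.
Let mX (t : 'I_T.+1) : measurable_fun setT (fun w => past t w).
Proof. exact: (measurable_prefix_process mY). Qed.

(** The event of stopping at t is the event of having stopped by t and not by t - 1,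
so it is an event of the past at t. *)
Lemma stopping_time_events (tau : Omega -> 'I_T.+1) : stopping_time Y tau ->
  exists A : forall t : 'I_T.+1, set 'M[R]_(D, t),
    (forall t, measurable (A t)) /\ (forall t w, tau w = t <-> A t (past t w)).
Proof.
move=> [tau0 tauF].
suff : forall t : 'I_T.+1, exists At : set 'M[R]_(D, t),
    measurable At /\ forall w, tau w = t <-> At (past t w).
  move=> h; pose A t := projT1 (cid (h t)).
  by exists A; split => t; have [] := projT2 (cid (h t)).
move=> t; have [B mB Bt] := tauF t.
have Bw w : (tau w <= t)%N <-> B (past t w).
  rewrite (_ : is_true (tau w <= t)%N = [set w | (tau w <= t)%N] w)// -Bt.
  by split => [[]|].
have [t0|t0] := posnP t.
  exists set0; split => // w; split => // tw.
  by exfalso; move: (tau0 w); rewrite tw t0.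
pose s : 'I_T.+1 := inord t.-1.
have sE : nat_of_ord s = t.-1.
  by rewrite inordK// (leq_ltn_trans (leq_pred _) (ltn_ord t)).
have st : (s <= t)%N by rewrite sE leq_pred.
have [B' mB' Bs] := tauF s.
have Bw' w : (tau w <= s)%N <-> B' (past s w).
  rewrite (_ : is_true (tau w <= s)%N = [set w | (tau w <= s)%N] w)// -Bs.
  by split => [[]|].
exists (B `\` (@restrict R D s t) @^-1` B'); split.
  apply: measurableD => //.
  by have := @measurable_restrict_mx R D s t measurableT _ mB'; rewrite setTI.
move=> w; split => [tw|[/Bw h1]] /=.
  split; first by apply/Bw; rewrite tw.
  rewrite restrict_prefix// => /Bw'; rewrite tw sE.
  by rewrite leqNgt ltn_predL t0.
rewrite restrict_prefix// => h2; apply: val_inj; apply/eqP; rewrite eqn_leq h1/=.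
rewrite leqNgt; apply/negP => tt; apply: h2; apply/Bw'.
by rewrite sE -ltnS prednK.
Qed.

Definition payoff (tau : Omega -> 'I_T.+1) (f : forall t : 'I_T.+1, 'M[R]_(D, t) -> R)
  (w : Omega) : R := f (tau w) (past (tau w) w).

(** The sum over dates makes a stopped reward a sum of products to which the tower
property applies. *)
Lemma payoffE (tau : Omega -> 'I_T.+1) (A : forall t : 'I_T.+1, set 'M[R]_(D, t))
    (f : forall t : 'I_T.+1, 'M[R]_(D, t) -> R) :
  (forall w, (0 < tau w)%N) -> (forall t w, tau w = t <-> A t (past t w)) ->
  payoff tau f = (fun w => \sum_(j < T) \1_(A (date j)) (past (date j) w) * f (date j) (past (date j) w)).
Proof.
move=> tau0 tauA; apply/funext => w; rewrite /payoff.
have [j jw] := date_surj (tau0 w).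
rewrite (bigD1 j)//= big1 ?addr0.
  by rewrite indicE mem_set ?mul1r ?jw//; apply/tauA.
move=> i ij; rewrite indicE memNset ?mul0r// => /tauA; rewrite -jw => /lift_inj ji.
by rewrite ji eqxx in ij.
Qed.

Lemma Exp_sum n (F : 'I_n -> Omega -> R) : (forall i, bounded_measurable (F i)) ->
  Exp P (fun w => \sum_(i < n) F i w) = \sum_(i < n) Exp P (F i) /\
  bounded_measurable (fun w => \sum_(i < n) F i w).
Proof.
elim: n F => [|n IH] F bF.
  split; last first.
    rewrite (_ : (fun w => _) = fun=> 0); first exact: bounded_measurable_cst.
    by apply/funext => w; rewrite big_ord0.
  rewrite big_ord0 -[RHS](Exp_cst P1 0); congr Exp.
  by apply/funext => w; rewrite big_ord0.
rewrite (_ : (fun w => _) = fun w => \sum_(i < n) F (widen_ord (leqnSn n) i) w + F ord_max w).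
  have [E B] := IH (fun i => F (widen_ord (leqnSn n) i)) (fun i => bF _).
  by rewrite big_ord_recr /= ExpD// E; split => //; exact: bounded_measurableD.
by apply/funext => w; rewrite big_ord_recr.
Qed.

Lemma bounded_measurable_payoff tau (f : forall t : 'I_T.+1, 'M[R]_(D, t) -> R) :
  stopping_time Y tau ->
  (forall t : 'I_T.+1, (1 <= t)%N -> bounded_measurable (f t)) ->
  bounded_measurable (payoff tau f).
Proof.
move=> st bf; have [A [mA tauA]] := stopping_time_events st; have [tau0 _] := st.
rewrite (payoffE f tau0 tauA); apply: (Exp_sum _).2 => j.
apply: bounded_measurableM.
  exact: (bounded_measurable_comp (@mX (date j)) (bounded_measurable_indic R (mA _))).
exact: (bounded_measurable_comp (@mX (date j)) (bf (date j) isT)).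
Qed.

(** Optional stopping: a stopped martingale of conditional expectations of h has
the mean of h. *)
Lemma Exp_payoff_sub (kappa : forall t : 'I_T.+1, R.-pker 'M[R]_(D, t) ~> 'M[R]_(D, T))
    (hkappa : forall t : 'I_T.+1, conditional_law P Y (kappa t))
    tau (f : forall t : 'I_T.+1, 'M[R]_(D, t) -> R) (h : 'M[R]_(D, T) -> R) :
  stopping_time Y tau ->
  (forall t : 'I_T.+1, (1 <= t)%N -> bounded_measurable (f t)) ->
  bounded_measurable h ->
  Exp P (payoff tau (fun t gamma => f t gamma - Exp (kappa t gamma) h)) =
  Exp P (payoff tau f) - Exp P (h \o Y).
Proof.
move=> st bf bh; have [A [mA tauA]] := stopping_time_events st; have [tau0 _] := st.
pose K t gamma := Exp (kappa t gamma) h.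
have bK t : bounded_measurable (K t) by exact: bounded_measurable_Exp_kernel.
have bfp := bounded_measurable_payoff st bf.
have bKp : bounded_measurable (payoff tau K).
  by apply: bounded_measurable_payoff => // t _.
have bA j : bounded_measurable (fun w => \1_(A (date j)) (past (date j) w) : R).
  exact: (bounded_measurable_comp (@mX _) (bounded_measurable_indic R (mA _))).
have bhY : bounded_measurable (h \o Y) by exact: bounded_measurable_comp.
rewrite (_ : payoff tau _ = fun w => payoff tau f w - payoff tau K w)// ExpB//.
congr (_ - _); rewrite (payoffE K tau0 tauA).
have [-> _] := @Exp_sum T (fun j w => \1_(A (date j)) (past (date j) w) * K (date j) (past (date j) w))
  (fun j => bounded_measurableM (bA j) (bounded_measurable_comp (@mX (date j)) (bK (date j)))).
have [E _] := @Exp_sum T (fun j w => \1_(A (date j)) (past (date j) w) * h (Y w))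
  (fun j => bounded_measurableM (bA j) bhY).
rewrite (_ : h \o Y = fun w => \sum_(j < T) \1_(A (date j)) (past (date j) w) * h (Y w)).
  rewrite E; apply: eq_bigr => j _; exact: (Exp_tower mY (hkappa (date j)) (mA _) bh).
apply/funext => w /=.
by have /(congr1 (fun F => F w)) := payoffE (fun _ _ => h (Y w)) tau0 tauA.
Qed.

(** If no past lies in c, the last date is taken. *)
Lemma first_entry_time (c : forall t : 'I_T.+1, 'M[R]_(D, t) -> bool) :
  (forall t : 'I_T.+1, (1 <= t)%N -> measurable [set gamma | c t gamma]) ->
  exists tau, stopping_time Y tau /\
    forall w, (exists t : 'I_T.+1, (1 <= t)%N /\ c t (past t w)) -> c (tau w) (past (tau w) w).
Proof.
move=> mc.
(* The last date satisfies Q on every path, so that the minimum exists. *)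
pose Q w (j : 'I_T) := c (date j) (past (date j) w) || (j.+1 == T).
have lastT : (T.-1 < T)%N by rewrite prednK.
have Qlast w : Q w (Ordinal lastT) by rewrite /Q /= prednK// eqxx orbT.
have : forall w, exists t : 'I_T.+1, exists j, [/\ t = date j, Q w j & forall i, Q w i -> (j <= i)%N].
  move=> w; have [j Qj jmin] := arg_minnP (fun j : 'I_T => val j) (Qlast w).
  by exists (date j), j; split.
move=> /choice[tau tauP]; exists tau; split.
  split; first by move=> w; have [j [->]] := tauP w.
  move=> t.
  exists (\bigcup_(j in [set j : 'I_T | (date j <= t)%N])
     ([set gamma | c (date j) (restrict (date j) gamma)] `|` [set gamma | j.+1 == T])).
    apply: fin_bigcup_measurable => // j _; apply: measurableU.
      have := @measurable_restrict_mx R D (date j) t measurableT _ (mc (date j) isT).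
      by rewrite setTI.
    case: (j.+1 == T).
      by rewrite (_ : [set _ | _] = setT) //; apply/seteqP; split.
    by rewrite (_ : [set _ | _] = set0) //; apply/seteqP; split.
  rewrite setTI; apply/seteqP; split => w.
    move=> [j jt cj]; have [i [ti _ imin]] := tauP w; rewrite /= ti.
    apply: (leq_trans _ (jt : (date j <= t)%N)).
    rewrite /date /= /bump !add1n ltnS; apply: imin.
    rewrite /Q; move: cj => [cj|->]; last by rewrite orbT.
    by move: cj; rewrite /mkset restrict_prefix// => ->.
  have [j [tj Qj _]] := tauP w; rewrite /mkset tj => jt; exists j => //.
  by case/orP: Qj => cj; [left|right] => //; rewrite /mkset restrict_prefix.
move=> w [t [t1 ct]]; have [i it] := date_surj t1; rewrite -{}it in ct.
have [j [-> Qj jmin]] := tauP w.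
have Qi : Q w i by rewrite /Q ct.
case/orP: Qj => // /eqP jT.
suff <- : i = j by [].
by apply: val_inj; apply/eqP; rewrite eqn_leq (jmin _ Qi) andbT -ltnS jT ltn_ord.
Qed.

End stopping.

Section optimal_value.
Context d (Omega : measurableType d) (R : realType) (P : probability Omega R).
Context (T D : nat) (hT : (1 <= T)%N).
Context (Y : Omega -> 'M[R]_(D, T)) (mY : measurable_fun setT Y).
Context (g : forall t : 'I_T.+1, 'M[R]_(D, t) -> R).
Hypothesis mg : forall t : 'I_T.+1, (1 <= t)%N -> measurable_fun setT (@g t).
Context (kappa : forall t : 'I_T.+1, R.-pker 'M[R]_(D, t) ~> 'M[R]_(D, T)).
Hypothesis hkappa : forall t : 'I_T.+1, conditional_law P Y (kappa t).
Hypothesis hZ : forall t : 'I_T.+1, (1 <= t)%N ->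
  {ae P, forall w, 0 <= stop_reward Y g t w <= 1}.
Local Notation mu := (path_law kappa).
Local Notation value := (value g kappa).
Local Notation max_value := (max_value g kappa).
Let P1 : P setT = 1%E := probability_setT P.

Let bV k : forall t : 'I_T.+1, (1 <= t)%N -> bounded_measurable (@value k t) :=
  @bounded_measurable_value R T D g kappa mg k.

Lemma ae_reward_value0 :
  {ae P, forall w, forall t : 'I_T.+1, (1 <= t)%N -> g (prefix t (Y w)) = value 0 (prefix t (Y w))}.
Proof.
apply: ae_forall_fin => t; have [t1|_] := boolP (1 <= t)%N; last exact: aeW.
apply: filterS (hZ t1) => w; rewrite /stop_reward => /andP[g0 g1] _ /=.
by rewrite min_l// max_r.
Qed.

Lemma expected_reward tau : stopping_time Y tau ->
  ('E_P[fun w => stop_reward Y g (tau w) w] = (Exp P (payoff Y tau (value 0)))%:E)%E.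
Proof.
move=> st; rewrite unlock.
have bp := bounded_measurable_payoff P mY st (bV 0).
rewrite -EFin_Exp//; apply: ae_eq_integral => //.
- apply/measurable_EFinP.
  have [A [mA tauA]] := stopping_time_events st; have [tau0 _] := st.
  rewrite (_ : (fun w => _) = payoff Y tau g)// (payoffE g tau0 tauA).
  apply: measurable_sum => j.
  have mXj : measurable_fun setT (fun w => prefix (date j) (Y w)).
    exact: (measurable_prefix_process mY).
  apply: measurable_funM; last exact: (measurableT_comp (mg (t := date j) isT) mXj).
  exact: (measurableT_comp (measurable_indic (mA (date j))) mXj).
- by case: bp => mp _; exact/measurable_EFinP.
- apply: filterS ae_reward_value0 => w h _; congr EFin.
  by apply: h; have [tau0 _] := st.
Qed.

Lemma Exp_payoff_value tau k : stopping_time Y tau ->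
  Exp P (payoff Y tau (value 0)) =
  Exp P (payoff Y tau (value k)) + \sum_(0 <= l < k) Exp mu (max_value l).
Proof.
move=> st; elim: k => [|k ->]; first by rewrite big_nil addr0.
have bm := bounded_measurable_max_value kappa mg k.
rewrite big_nat_recr//= (Exp_path_law mY hkappa bm).
rewrite (Exp_payoff_sub mY hkappa st (bV k) bm); ring.
Qed.

(** Stopping time by stopping time, the mean reward is the sum of the first k + 1
terms plus the mean of the stopped [value k.+1]. The latter is nonpositive, and
at least -1/(k+1) for the first entry time into the pasts where [value k.+1]
is at least -1/(k+1). *)
Lemma OPT_expansion k : exists2 V : R, OPT P Y g = V%:E &
  `|\sum_(0 <= l < k.+1) Exp mu (max_value l) - V| <= k.+1%:R^-1.
Proof.
set S := \sum_(_ <= _ < _) _.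
have up tau : stopping_time Y tau -> Exp P (payoff Y tau (value k.+1)) <= 0.
  move=> st; rewrite -[leRHS](Exp_cst P1); apply: le_ae_Exp => //.
  - exact: bounded_measurable_payoff (bV k.+1).
  - exact: bounded_measurable_cst.
  have H := ae_path_process mY hkappa (ae_valueS_le0 mY mg hkappa k).
  apply: filterS H => w h.
  by apply: h; have [tau0 _] := st.
(* A past in this event occurs on almost every path. *)
pose c (t : 'I_T.+1) (gamma : 'M[R]_(D, t)) := - k.+1%:R^-1 <= value k.+1 gamma.
have mc (t : 'I_T.+1) : (1 <= t)%N -> measurable [set gamma | c t gamma].
  move=> t1; have [mv _] := @bV k.+1 t t1.
  rewrite (_ : [set _ | _] = (fun gamma => c t gamma) @^-1` [set true])//.
  by rewrite -[_ @^-1` _]setTI; apply: measurable_fun_ler.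
have [tau [st tauc]] := first_entry_time hT Y mc.
have low : - k.+1%:R^-1 <= Exp P (payoff Y tau (value k.+1)).
  rewrite -[leLHS](Exp_cst P1); apply: le_ae_Exp => //.
  - exact: bounded_measurable_cst.
  - exact: bounded_measurable_payoff (bV k.+1).
  have H := ae_path_process mY hkappa (ae_max_value_ge hT mY mg hkappa k).
  apply: filterS H => w h.
  apply: tauc; have [j e] := max_value_mem g kappa hT k.+1 (Y w).
  by exists (date j); split => //; rewrite /c -e.
have hup : (OPT P Y g <= S%:E)%E.
  apply: ge_ereal_sup => _ [tau' st' <-].
  by rewrite expected_reward// (Exp_payoff_value k.+1 st') lee_fin gerDr up.
have hlow : ((S - k.+1%:R^-1)%:E <= OPT P Y g)%E.
  apply: (@le_trans _ _ ('E_P[fun w => stop_reward Y g (tau w) w])%E).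
    by rewrite expected_reward// (Exp_payoff_value k.+1 st) lee_fin -/S addrC lerD2r.
  by apply: ereal_sup_ubound; exists tau.
have fin : OPT P Y g \is a fin_num.
  by rewrite fin_numE; move: hup hlow; case: (OPT P Y g).
exists (fine (OPT P Y g)); first by rewrite fineK.
move: hup hlow; rewrite -(fineK fin) !lee_fin /= => h1 h2.
by rewrite ger0_norm ?subr_ge0// lerBlDr addrC -lerBlDr.
Qed.

End optimal_value.

(** * Accuracy of the algorithms *)

(** The maximum is 1-Lipschitz for the supremum norm. *)
Lemma fold1_max_dist (R : realType) (I : Type) (F : I -> R) (e : R) (s : seq I) (l : seq R) :
  0 <= e -> all2 (fun i a => `|a - F i| <= e) s l ->
  `|fold1 Num.max l - fold1 Num.max [seq F i | i <- s]| <= e.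
Proof.
move=> e0; case: s l => [|i s] [|a l] //=; first by rewrite /fold1/= subrr normr0.
case/andP => ai; rewrite /fold1 /=; elim: s l a (F i) ai => [|j s IH] [|b l] //= a x ax.
case/andP => bj sl; apply: (IH _ (Num.max a b) (Num.max x (F j))) => //.
move: ax bj; rewrite !ler_distl => /andP[a1 a2] /andP[b1 b2].
apply/andP; split.
  by rewrite lerBlDr ge_max -!lerBlDr !le_max a1 b1 orbT.
by rewrite ge_max -!lerBlDr !le_max !lerBlDr a2 b2 orbT.
Qed.

Section correctness.
Context d (Omega : measurableType d) (R : realType) (P : probability Omega R).
Context (T D : nat) (hT : (1 <= T)%N).
Context (Y : Omega -> 'M[R]_(D, T)) (mY : measurable_fun setT Y).
Context (g : forall t : 'I_T.+1, 'M[R]_(D, t) -> R).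
Hypothesis mg : forall t : 'I_T.+1, (1 <= t)%N -> measurable_fun setT (@g t).
Context (kappa : forall t : 'I_T.+1, R.-pker 'M[R]_(D, t) ~> 'M[R]_(D, T)).
Hypothesis hkappa : forall t : 'I_T.+1, conditional_law P Y (kappa t).
Hypothesis hZ : forall t : 'I_T.+1, (1 <= t)%N ->
  {ae P, forall w, 0 <= stop_reward Y g t w <= 1}.
Local Notation mu := (path_law kappa).
Local Notation value := (value g kappa).
Local Notation max_value := (max_value g kappa).
Local Notation prog := (prog R T D).
Local Notation expect := (expect g kappa).
Local Notation has_law := (has_law g kappa).
Local Notation pr := (pr g kappa).
Implicit Types (k l N : nat) (t : 'I_T.+1) (M : 'M[R]_(D, T)) (e eps eta delta : R).

(** Stated along a path, since the recursive calls are made at the prefixes of one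
simulated path. *)
Definition accurate k M : Prop := forall t, (1 <= t)%N ->
  forall eps delta, 0 < eps -> 0 < delta < 1 ->
  (pr (algB k (prefix t M) eps delta)
     [set x | (eps < `|x - value k (prefix t M)|)%R] <= delta%:E)%E.

Let good_law k (t : 'I_T.+1) e delta (t1 : (1 <= t)%N) (gamma : 'M[R]_(D, t)) :
  has_law (algB k gamma e delta).
Proof. exact: (sampled_has_law gamma (sampled_algB mg kappa k e delta t1)). Qed.

Lemma pr_max_deviation k M e eta : accurate k M -> 0 < e -> 0 < eta < 1 ->
  (pr (bind (for_each (enum 'I_T) (fun j => algB k (prefix (date j) M) e eta))
        (fun A2 => Ret R T D (fold1 Num.max A2)))
     [set x | (e < `|x - max_value k M|)%R] <= (T%:R * eta)%:E)%E.
Proof.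
move=> accM e0 eta01; rewrite /pr expect_bind.
rewrite -[X in (X%:R * eta)%:E](size_enum_ord T).
apply: (@expect_for_each_union _ _ _ _ _ _ R _ _ _
  (fun j => [set x | (e < `|x - value k (prefix (date j) M)|)%R])).
- by case/andP: eta01 => /ltW.
- by move=> j _; exact: good_law.
- by move=> j _; exact: measurable_dist_gt.
- by move=> j _; exact: accM.
- by move=> l; rewrite lee_fin.
- by move=> l; rewrite lee_fin indicE; case: (_ \in _).
move=> l hl; rewrite /= indicE memNset// /mkset; apply/negP; rewrite -leNgt.
apply: (@fold1_max_dist _ _ (fun j => value k (prefix (date j) M)) _ (enum 'I_T)).
  exact: ltW.
elim: (enum 'I_T) l hl => [|j s IH] [|a l] //= /andP[aj sl].
by rewrite IH// andbT leNgt; move: aj; rewrite notin_setE /mkset => /negP.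
Qed.

Lemma pr_mean_estimate k (t : 'I_T.+1) (gamma : 'M[R]_(D, t)) e eta N :
  {ae kappa t gamma, forall M, accurate k M} ->
  {ae kappa t gamma, forall M, value_floor R k <= max_value k M <= value_floor R k + 1} ->
  (0 < N)%N -> 0 < e -> 0 < eta < 1 ->
  (pr (mean_estimate k gamma e eta N)
     [set x | (2 * e < `|x - Exp (kappa t gamma) (max_value k)|)%R] <=
   (N%:R * (T%:R * eta) + 2 * expR (- (2 * N%:R * e ^+ 2)))%:E)%E.
Proof.
move=> acc rng N0 e0 eta01.
apply: (@pr_mean_deviation _ _ _ g kappa t gamma
  (fun A1 => bind (for_each (enum 'I_T) (fun j => algB k (prefix (date j) A1) e eta))
     (fun A2 => Ret R T D (fold1 Num.max A2))) (max_value k) (value_floor R k)) => //.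
- by rewrite mulr_ge0//; case/andP: eta01 => /ltW.
- exact: bounded_measurable_max_value.
- move=> M.
  have : sampled g kappa (fun _ : unit =>
     bind (for_each (enum 'I_T) (fun j => algB k (prefix (date j) M) e eta))
       (fun A2 => Ret R T D (fold1 Num.max A2))).
    apply: (@sampled_bind _ _ _ g kappa _ unit _ _ (seq R) R
      (fun _ => for_each (enum 'I_T) (fun j => algB k (prefix (date j) M) e eta))
      (fun z => Ret R T D (fold1 Num.max z.2))).
      apply: (@sampled_for_each _ _ _ g kappa _ unit _ _ R (enum 'I_T)
        (fun j _ => algB k (prefix (date j) M) e eta)) => j.
      have mh : measurable_fun setT (fun _ : unit => prefix (date j) M).
        exact: measurable_cst.
      exact: (sampled_comp mh (sampled_algB mg kappa k e eta (t := date j) isT)).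
    apply: sampled_ret.
    exact: (measurableT_comp (@measurable_fold1_max R) measurable_snd).
  by move=> /(sampled_has_law tt).
by apply: filterS acc => M accM; exact: pr_max_deviation.
Qed.

Lemma failure_prob_value_bounds (c : R) N : 1 < c -> (0 < N)%N ->
  0 < failure_prob_value T c N < 1.
Proof.
move=> c1 N0; have NT : 1 <= (N * T)%:R :> R by rewrite ler1n muln_gt0 N0.
have h : 1 < c * (N * T)%:R by rewrite (lt_le_trans c1)// ler_peMr// ltW// (lt_trans ltr01).
rewrite /failure_prob_value div1r -mulrA -natrM invr_gt0 (lt_trans ltr01 h)/=.
by rewrite invf_lt1// (lt_trans ltr01 h).
Qed.

Lemma failure_prob_value_total (c : R) N : 0 < c -> (0 < N)%N ->
  N%:R * (T%:R * failure_prob_value T c N) = c^-1.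
Proof.
move=> c0 N0; rewrite /failure_prob_value; field.
by rewrite !pnatr_eq0 -!lt0n N0 hT gt_eqF.
Qed.

Lemma ae_accurate0 : {ae mu, forall M, accurate 0 M}.
Proof.
suff : {ae mu, forall M, forall t, (1 <= t)%N -> g (prefix t M) = value 0 (prefix t M)}.
  apply: filterS => M h t t1 eps delta eps0 /andP[d0 _].
  rewrite /pr [expect _ _]/= indicE memNset ?lee_fin ?ltW//.
  rewrite /mkset -[Num.max _ _]/(value 0 (prefix t M)) -h// subrr normr0.
  by apply/negP; rewrite -leNgt ltW.
apply: ae_forall_fin => t; have [t1|_] := boolP (1 <= t)%N; last exact: aeW.
have h := ae_reward_value0 kappa hZ.
suff : {ae mu, forall M, g (prefix t M) = value 0 (prefix t M)} by apply: filterS.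
apply: (ae_process_path mY hkappa); last by apply: filterS h => w; exact.
have m1 : measurable_fun setT (fun M => g (prefix t M)).
  exact: (measurableT_comp (mg t1) (@measurable_prefix _ _ _ t)).
have [m2 _] := bounded_measurable_comp (@measurable_prefix _ _ _ t)
  (bounded_measurable_value kappa mg 0 t1).
rewrite (_ : [set _ | _] = (fun M => g (prefix t M) - value 0 (prefix t M)) @^-1` [set 0]).
  by rewrite -[_ @^-1` _]setTI; apply: measurable_funB.
apply/seteqP; split => M hM; apply/eqP; first by rewrite subr_eq0; apply/eqP.
by rewrite -subr_eq0; apply/eqP.
Qed.

(** Three errors of eps/2, eps/4 and eps/4 add up to eps: that of the recursive
call at the current past, those of the recursive calls along the simulated
paths, and that of the empirical mean. They fail with probability at most 1/8,
1/16 and 1/16. *)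
Lemma pr_difference_estimate k (t : 'I_T.+1) (gamma : 'M[R]_(D, t)) eps :
  (1 <= t)%N -> 0 < eps ->
  (pr (algB k gamma (eps / 2) (1 / 8))
     [set x | (eps / 2 < `|x - value k gamma|)%R] <= (1 / 8)%:E)%E ->
  {ae kappa t gamma, forall M, accurate k M} ->
  {ae kappa t gamma, forall M, value_floor R k <= max_value k M <= value_floor R k + 1} ->
  (pr (difference_estimate k gamma eps)
     [set x | (eps < `|x - value k.+1 gamma|)%R] <= (1 / 4)%:E)%E.
Proof.
move=> t1 eps0 acc3 acc rng; rewrite /pr /difference_estimate expect_bind.
set N := sample_size_value _ _.
have e0 : 0 < eps / 4 by rewrite divr_gt0.
have eta02 : 0 < (1 / 16 : R) < 2 by lra.
have N0 : (0 < N)%N by exact: sample_size_value_gt0.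
have eta01 : 0 < (failure_prob_value T 16 N : R) < 1 by apply: failure_prob_value_bounds => //; lra.
have hm : (pr (mean_estimate k gamma (eps / 4) (failure_prob_value T 16 N) N)
    [set x | (2 * (eps / 4) < `|x - Exp (kappa t gamma) (max_value k)|)%R] <= (1 / 8)%:E)%E.
  apply: (le_trans (pr_mean_estimate acc rng N0 e0 eta01)).
  rewrite failure_prob_value_total// lee_fin.
  by have := sample_size_valueP e0 eta02; rewrite -/N; lra.
have -> : (1 / 4 : R) = 1 / 8 + 1 * (1 / 8) by field.
apply: (expect_affine_le _ _ _ _ acc3) => //.
- exact: good_law.
- exact: measurable_dist_gt.
- by move=> x; apply: expect_ge0 => y; rewrite lee_fin.
move=> x; rewrite expect_bind.
have [xB|xB] := boolP (x \in [set x | eps / 2 < `|x - value k gamma|]).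
  rewrite indicE xB mulr1; apply: (@le_trans _ _ 1%E); last by rewrite lee_fin lerDr.
  by apply: expect_le_cst => y; rewrite lee_fin// indicE; case: (_ \in _).
rewrite indicE (negbTE xB) mulr0 addr0.
apply: (le_trans _ hm).
apply: le_expect => y; rewrite lee_fin// !indicE.
case: (boolP (_ \in [set x | eps < _])) => //; rewrite inE /= => hy.
rewrite mem_set//=; move: xB; rewrite notin_setE /mkset => /negP; rewrite -leNgt.
move=> hx; rewrite (_ : 2 * (eps / 4) = eps / 2); last by field.
rewrite ltNge; apply/negP => hy2; move: hy; apply/negP; rewrite -leNgt.
rewrite (_ : _ - _ = (x - value k gamma) - (y - Exp (kappa t gamma) (max_value k))).
  by rewrite (le_trans (ler_normB _ _))// [leRHS]splitr lerD.
by rewrite -/(max_value k); ring.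
Qed.

(** The estimate at a past M_[t] uses recursive calls at M_[t] and along paths drawn
from the conditional law given M_[t]. For almost every M both kinds of calls
are accurate, the second one by [ae_kernel]. *)
Lemma ae_accurate k : {ae mu, forall M, accurate k M}.
Proof.
elim: k => [|k IH]; first exact: ae_accurate0.
have h : {ae mu, forall M, forall t : 'I_T.+1,
    {ae kappa t (prefix t M), forall M', accurate k M'} /\
    {ae kappa t (prefix t M), forall M',
       value_floor R k <= max_value k M' <= value_floor R k + 1}}.
  apply: ae_forall_fin => t.
  have := ae_kernel mY hkappa t (ae_max_value_range hT mY mg hkappa k).
  by apply: filterS2 (ae_kernel mY hkappa t IH) => M.
apply: filterS2 IH h => M accM h t t1 eps delta eps0 d01; have [h1 h2] := h t.
have /andP[d0 d1] := d01; rewrite /pr expect_algBS.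
have acc3 : (pr (algB k (prefix t M) (eps / 2) (1 / 8))
     [set x | (eps / 2 < `|x - value k (prefix t M)|)%R] <= (1 / 8)%:E)%E.
  by apply: accM => //; [rewrite divr_gt0|lra].
apply: (le_trans (pr_median_deviation _ _ (pr_difference_estimate t1 eps0 acc3 h1 h2))).
  apply: (sampled_has_law (prefix t M) (@sampled_difference_estimate R T D g kappa k t eps _ t1)).
  by move=> t' e' delta' t1'; exact: sampled_algB.
rewrite lee_fin (le_trans (repetitions_valueP _))//; lra.
Qed.

End correctness.

Section kernel_law.
Context d d' (X : measurableType d) (A : measurableType d') (R : realType).
Variables (k : R.-pker X ~> A) (x : X).

(** Kernels bundle their values as measures only, whereas [output_law] is about
probabilities. *)
Definition kernel_law : set A -> \bar R := k x.

HB.instance Definition _ := Measure.copy kernel_law (k x).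

Let kernel_law_setT : kernel_law setT = 1%E.
Proof. exact: prob_kernel. Qed.

HB.instance Definition _ := Measure_isProbability.Build _ _ _ kernel_law kernel_law_setT.

End kernel_law.

Lemma sum_dist (R : realType) (I : Type) (F : I -> R) (e : R) (s : seq I) (l : seq R) :
  all2 (fun i a => `|a - F i| <= e) s l ->
  `|\sum_(x <- l) x - \sum_(i <- s) F i| <= (size s)%:R * e.
Proof.
elim: s l => [|i s IH] [|a l] //=; first by rewrite !big_nil subrr normr0 mul0r.
case/andP => ai sl; rewrite !big_cons opprD addrACA -natr1 mulrDl mul1r addrC.
by rewrite (le_trans (ler_normD _ _))// lerD// IH.
Qed.

Section algorithm_law.
Context (R : realType) (T D : nat).
Context (g : forall t : 'I_T.+1, 'M[R]_(D, t) -> R).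
Hypothesis mg : forall t : 'I_T.+1, (1 <= t)%N -> measurable_fun setT (@g t).
Context (kappa : forall t : 'I_T.+1, R.-pker 'M[R]_(D, t) ~> 'M[R]_(D, T)).

Lemma sampled_algA eps delta :
  sampled g kappa (fun _ : unit => algA T D eps delta).
Proof.
set k := nat_ceil (2 / eps); pose v : R := 1 / k%:R.
set N := sample_size_value (eps / 2 * v / 2) (1 / 8).
pose p l (_ : unit) := median_of (repetitions_value (delta * v))
  (mean_estimate (T := T) (D := D) l.-1 (0 : 'M[R]_(D, @ord0 T)) (eps / 2 * v / 2)
     (failure_prob_value T 8 N) N).
apply: (eq_sampled (q := fun x => bind (for_each (iota 1 k) (fun l => p l x))
   (fun L => Ret R T D (\sum_(x <- (x, L).2) x)))).
  by move=> u f; rewrite expect_algA expect_bind.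
apply: (@sampled_bind R T D g kappa _ unit _ _ (seq R) R
  (fun x => for_each (iota 1 k) (fun l => p l x))
  (fun z : unit * seq R => Ret R T D (\sum_(x <- z.2) x))).
  apply: (@sampled_for_each R T D g kappa _ unit _ _ R (iota 1 k) p) => l.
  apply: sampled_median_of.
  have m0 : measurable_fun setT (fun _ : unit => 0 : 'M[R]_(D, @ord0 T)).
    exact: measurable_cst.
  apply: (sampled_comp m0 (@sampled_mean_estimate R T D g kappa l.-1 ord0 _ _ _ _)).
  by move=> t e' delta' t1; exact: sampled_algB.
apply: sampled_ret.
exact: (measurableT_comp (@measurable_sum_seq R) measurable_snd).
Qed.

Lemma algA_output_law eps delta (E : set R) (q : R) : measurable E ->
  (pr g kappa (algA T D eps delta) (~` E) <= q%:E)%E ->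
  exists X : probability R R,
    output_law g kappa (algA T D eps delta) X /\ ((1 - q)%:E <= X E)%E.
Proof.
move=> mE hE; have [k hk] := sampled_algA eps delta.
have X_pr (B : set R) : measurable B -> kernel_law k tt B = pr g kappa (algA T D eps delta) B.
  move=> mB; rewrite /pr (hk tt)//; first by rewrite integral_indic// setIT.
  by apply/measurable_EFinP; exact: measurable_indic.
exists (kernel_law k tt : probability R R); split.
  by move=> B mB; rewrite output_prob_expect; exact: X_pr.
rewrite -[E]setCK probability_setC; last exact: measurableC.
rewrite EFinB leeB//; apply: le_trans hE.
by have /X_pr <- := measurableC mE.
Qed.

End algorithm_law.

Section algorithm_correct.
Context d (Omega : measurableType d) (R : realType) (P : probability Omega R).
Context (T D : nat) (hT : (1 <= T)%N).
Context (Y : Omega -> 'M[R]_(D, T)) (mY : measurable_fun setT Y).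
Context (g : forall t : 'I_T.+1, 'M[R]_(D, t) -> R).
Hypothesis mg : forall t : 'I_T.+1, (1 <= t)%N -> measurable_fun setT (@g t).
Context (kappa : forall t : 'I_T.+1, R.-pker 'M[R]_(D, t) ~> 'M[R]_(D, T)).
Hypothesis hkappa : forall t : 'I_T.+1, conditional_law P Y (kappa t).
Hypothesis hZ : forall t : 'I_T.+1, (1 <= t)%N ->
  {ae P, forall w, 0 <= stop_reward Y g t w <= 1}.
Local Notation mu := (path_law kappa).
Local Notation max_value := (max_value g kappa).

Lemma pr_expansion_term l (alpha beta : R) : 0 < alpha -> 0 < beta < 1 ->
  (pr g kappa (median_of (repetitions_value beta)
      (mean_estimate l (0 : 'M[R]_(D, @ord0 T)) (alpha / 2)
         (failure_prob_value T 8 (sample_size_value (alpha / 2) (1 / 8)))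
         (sample_size_value (alpha / 2) (1 / 8))))
    [set x | (alpha < `|x - Exp mu (max_value l)|)%R] <= beta%:E)%E.
Proof.
move=> a0 /andP[b0 b1]; set N := sample_size_value _ _.
have e0 : 0 < alpha / 2 by rewrite divr_gt0.
have eta02 : 0 < (1 / 8 : R) < 2 by lra.
have N0 : (0 < N)%N by exact: sample_size_value_gt0.
have eta01 : 0 < (failure_prob_value T 8 N : R) < 1.
  by apply: failure_prob_value_bounds => //; lra.
have hm := pr_mean_estimate mg (ae_accurate hT mY mg hkappa hZ l : {ae kappa ord0 0, _})
  (ae_max_value_range hT mY mg hkappa l : {ae kappa ord0 0, _}) N0 e0 eta01.
rewrite failure_prob_value_total// (_ : 2 * (alpha / 2) = alpha) in hm; last by field.
apply: (le_trans (pr_median_deviation (c := Exp mu (max_value l)) (e := alpha) _ _ _)).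
- have good := @sampled_mean_estimate R T D g kappa l ord0 (alpha / 2)
    (failure_prob_value T 8 N) N (fun t e delta => @sampled_algB R T D g mg kappa l t e delta).
  exact: (sampled_has_law (0 : 'M[R]_(D, @ord0 T)) good).
- apply: (le_trans hm); rewrite lee_fin.
  by have := sample_size_valueP e0 eta02; rewrite -/N; lra.
rewrite lee_fin (le_trans (repetitions_valueP _))//; lra.
Qed.

(** Each of the k terms is within eps/(2k) with failure probability at most delta/k,
and truncating the expansion after k >= 2/eps terms costs at most eps/2. *)
Lemma pr_algA (eps delta V : R) : 0 < eps < 1 -> 0 < delta < 1 -> OPT P Y g = V%:E ->
  (pr g kappa (algA T D eps delta) [set x | (eps < `|x - V|)%R] <= delta%:E)%E.
Proof.
move=> /andP[eps0 eps1] /andP[d0 d1] OPTV; rewrite /pr expect_algA.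
set k := nat_ceil (2 / eps); set v := _ / k%:R; set alpha := eps / 2 * v.
have hk : 2 / eps <= k%:R by apply: nat_ceil_ge; rewrite divr_ge0// ltW.
have k0 : 0 < k%:R :> R by rewrite (lt_le_trans _ hk)// divr_gt0.
have v0 : 0 < v by rewrite divr_gt0.
have kv : k%:R * v = 1 by rewrite /v div1r mulfV// gt_eqF.
have v1 : v <= 1.
  rewrite -kv -[leLHS]mul1r ler_wpM2r ?ler1n -?(ltr0n R)//; exact: ltW.
have a0 : 0 < alpha by rewrite mulr_gt0// divr_gt0.
have b01 : 0 < delta * v < 1.
  rewrite mulr_gt0//= (le_lt_trans _ d1)// -[leRHS]mulr1 ler_wpM2l//; exact: ltW.
have dE : delta = (size (iota 1 k))%:R * (delta * v) by rewrite size_iota mulrCA kv mulr1.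
rewrite [leRHS](_ : _ = ((size (iota 1 k))%:R * (delta * v))%:E); last by rewrite -dE.
apply: (@expect_for_each_union _ _ _ _ _ _ R _ (iota 1 k) _
  (fun l => [set x | alpha < `|x - Exp mu (max_value l.-1)|])).
- by case/andP: b01 => /ltW.
- move=> l _; set p := mean_estimate _ _ _ _ _.
  have m0 : measurable_fun setT (fun _ : unit => 0 : 'M[R]_(D, @ord0 T)).
    exact: measurable_cst.
  apply: (@sampled_has_law _ _ _ g kappa _ _ unit _ (fun _ => median_of _ p) tt).
  apply: sampled_median_of.
  apply: (sampled_comp m0 (@sampled_mean_estimate R T D g kappa l.-1 ord0 _ _ _ _)).
  by move=> t e' delta' t1; exact: sampled_algB.
- by move=> l _; exact: measurable_dist_gt.
- by move=> l _; exact: pr_expansion_term.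
- by move=> l; rewrite lee_fin.
- by move=> l; rewrite lee_fin indicE; case: (_ \in _).
move=> l hl; rewrite indicE memNset// /mkset; apply/negP; rewrite -leNgt.
have {}hl : `|\sum_(x <- l) x - \sum_(i <- iota 1 k) Exp mu (max_value i.-1)| <= eps / 2.
  rewrite (_ : eps / 2 = (size (iota 1 k))%:R * alpha); last first.
    by rewrite size_iota /alpha mulrCA kv mulr1.
  apply: sum_dist; elim: (iota 1 k) l hl => [|j s IH] [|a l] //= /andP[aj sl].
  by rewrite IH// andbT leNgt; move: aj; rewrite notin_setE /mkset => /negP.
have [V' OPTV'] := OPT_expansion hT mY mg hkappa hZ k.-1.
have -> : V' = V by move: OPTV'; rewrite OPTV => -[].
have kk : (k.-1.+1 = k)%N by rewrite prednK// -(ltr0n R).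
rewrite kk => hV.
have E : \sum_(i <- iota 1 k) Exp mu (max_value i.-1) = \sum_(0 <= i < k) Exp mu (max_value i).
  by rewrite (iotaDl 1 0 k : iota 1 k = _) big_map /index_iota subn0.
rewrite E in hl.
set S := \sum_(0 <= i < k) _ in hV hl.
rewrite (_ : _ - V = (\sum_(x <- l) x - S) + (S - V)); last by ring.
rewrite (le_trans (ler_normD _ _))// [leRHS]splitr lerD// (le_trans hV)//.
rewrite -[leRHS]invrK lef_pV2 ?posrE// ?invr_gt0 ?divr_gt0//.
by rewrite invf_div.
Qed.

End algorithm_correct.

(** * Running time *)

Section running_time.
Context (R : realType) (T D : nat) (C G : R).
Context (g : forall t : 'I_T.+1, 'M[R]_(D, t) -> R).
Local Notation prog := (prog R T D).
Implicit Types (k N : nat) (t : 'I_T.+1) (eps e eta delta a b : R).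

(** [runs_within] with a postcondition on outputs: the cost of the instructions that
follow a loop depends on the length of the list it returns. *)
Fixpoint runs_to A (p : prog A) b (Q : A -> Prop) : Prop :=
  match p with
  | Ret a => 0 <= b /\ Q a
  | Operation o k => runs_to (k (operation_value o)) (b - 1) Q
  | Ceiling x k => runs_to (k (nat_ceil x)) (b - 1) Q
  | Median s k => runs_to (k (median s)) (b - (size s)%:R) Q
  | EvalReward t gamma k => runs_to (k (g gamma)) (b - G) Q
  | CallOracle t gamma k => forall M, runs_to (k M) (b - C) Q
  end.

Lemma runs_to_within A (p : prog A) b Q : runs_to p b Q -> runs_within C G g p b.
Proof.
elim: p b => //= [a b []//|o k IH|x k IH|s k IH|t gamma k IH|t gamma k IH] b;
  by [exact: IH|move=> h M; exact: IH].
Qed.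

Lemma runs_to_le A (p : prog A) a b Q : a <= b -> runs_to p a Q -> runs_to p b Q.
Proof.
move=> ab; elim: p a b ab => /= [x|o k IH|x k IH|s k IH|t gamma k IH|t gamma k IH] a b ab.
- by move=> [a0 Qx]; split => //; exact: le_trans ab.
- by apply: IH; rewrite lerD2r.
- by apply: IH; rewrite lerD2r.
- by apply: IH; rewrite lerD2r.
- by apply: IH; rewrite lerD2r.
- by move=> h M; apply: (IH M (a - C)) => //; rewrite lerD2r.
Qed.

Lemma runs_to_bind A B (p : prog A) (q : A -> prog B) a b Q Q' :
  runs_to p a Q -> (forall x, Q x -> runs_to (q x) b Q') ->
  runs_to (bind p q) (a + b) Q'.
Proof.
move=> hp hq; elim: p a hp => /= [x|o k IH|x k IH|s k IH|t gamma k IH|t gamma k IH] a.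
- move=> [a0 Qx]; apply: runs_to_le (hq x Qx); by rewrite lerDr.
- by rewrite addrAC; exact: IH.
- by rewrite addrAC; exact: IH.
- by rewrite addrAC; exact: IH.
- by rewrite addrAC; exact: IH.
- by move=> h M; rewrite addrAC; exact: IH.
Qed.

Lemma runs_to_op_bind A o (q : R -> prog A) b Q :
  runs_to (q (operation_value o)) b Q -> runs_to (bind (op T D o) q) (1 + b) Q.
Proof. by move=> h /=; rewrite addrC addKr. Qed.

Lemma runs_to_for_each (I : eqType) A (s : seq I) (p : I -> prog A) b :
  (forall i, i \in s -> runs_to (p i) b (fun=> True)) ->
  runs_to (for_each s p) ((size s)%:R * b) (fun l => size l = size s).
Proof.
elim: s => [|i s IH] hp; first by rewrite mul0r.
rewrite /= -natr1 mulrDl mul1r addrC.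
apply: runs_to_bind; first by apply: hp; rewrite inE eqxx.
move=> x _; rewrite -[_ * b]addr0.
apply: runs_to_bind; first by apply: IH => j js; apply: hp; rewrite inE js orbT.
by move=> l ls /=; rewrite ls.
Qed.

Lemma runs_to_repeat A n (p : nat -> prog A) b :
  (forall i, (1 <= i <= n)%N -> runs_to (p i) b (fun=> True)) ->
  runs_to (for_each (iota 1 n) p) (n%:R * b) (fun l => size l = n).
Proof.
move=> hp; have := @runs_to_for_each _ A (iota 1 n) p b.
by rewrite size_iota; apply => i; rewrite mem_iota add1n ltnS; exact: hp.
Qed.

Lemma runs_to_fold_op o (s : seq R) :
  runs_to (fold_op T D o s) (size s)%:R (fun=> True).
Proof.
case: s => [|x s] //=; elim: s x => [|y s IH] x //=.
by rewrite -natr1 addrK; exact: IH.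
Qed.

Lemma runs_to_average N (s : seq R) : size s = N ->
  runs_to (average T D N s) (N%:R + 2) (fun=> True).
Proof.
move=> sN; rewrite (_ : N%:R + 2 = 1 + (N%:R + 1)); last by ring.
apply: runs_to_op_bind; apply: runs_to_bind.
  by rewrite -sN; exact: runs_to_fold_op.
by move=> S _; rewrite -[1]addr0; apply: (runs_to_op_bind (q := @ret R T D R)).
Qed.

Lemma runs_to_med (s : seq R) : runs_to (med T D s) (size s)%:R (fun=> True).
Proof. by rewrite /= subrr. Qed.

Lemma runs_to_sample_size e eta :
  runs_to (sample_size T D e eta) 7 (fun N => N = sample_size_value e eta).
Proof. by rewrite /=; split => //; lra. Qed.

Lemma runs_to_repetitions delta :
  runs_to (repetitions T D delta) 5 (fun n => n = repetitions_value delta).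
Proof. by rewrite /=; split => //; lra. Qed.

Lemma runs_to_failure_prob (c : R) N :
  runs_to (failure_prob T D c N) 3 (fun eta => eta = failure_prob_value T c N).
Proof. by rewrite /=; split => //; lra. Qed.

(** Cost of simulating N maxima when the recursive calls cost b each: per path, one
oracle call, T calls preceded by four operations, and one fold. *)
Definition loop_cost N (b : R) : R := N%:R * (C + (T%:R * (4 + b) + T%:R)).

Lemma runs_to_loop k t (gamma : 'M[R]_(D, t)) (c : R) N (o : operation R) b :
  (forall t (gamma : 'M[R]_(D, t)),
     runs_to (algB k gamma (operation_value o) (failure_prob_value T c N)) b (fun=> True)) ->
  runs_to
    (for_each (iota 1 N) (fun=>
      bind (call_oracle gamma) (fun A1 =>
      bind (for_each (enum 'I_T) (fun j =>
        bind (op T D o) (fun e4 =>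
        bind (failure_prob T D c N) (fun eta =>
        algB k (prefix (date j) A1) e4 eta))))
      (@maximum R T D))))
    (loop_cost N b) (fun l => size l = N).
Proof.
move=> hb; apply: runs_to_repeat => _ _.
apply: (@runs_to_bind _ _ _ _ _ _ (fun=> True)) => [M|A1 _]; first by rewrite /= subrr.
apply: (@runs_to_bind _ _ _ _ _ _ (fun l : seq R => size l = T)) => [|l lT]; last first.
  by rewrite -{2}lT; exact: runs_to_fold_op.
have := @runs_to_for_each _ R (enum 'I_T) (fun j =>
        bind (op T D o) (fun e4 =>
        bind (failure_prob T D c N) (fun eta =>
        algB k (prefix (date j) A1) e4 eta))) (4 + b).
rewrite size_enum_ord; apply => j _.
rewrite (_ : 4 + b = 1 + (3 + b)); last by ring.
apply: runs_to_op_bind; apply: runs_to_bind; first exact: runs_to_failure_prob.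
by move=> _ ->; exact: hb.
Qed.

Fixpoint costB k eps delta : R :=
  if k is k'.+1 then
    let N := sample_size_value (eps / 4) (1 / 16) in
    let n := repetitions_value delta in
    13 + (n%:R * (costB k' (eps / 2) (1 / 8) +
      (loop_cost N (costB k' (eps / 4) (failure_prob_value T 16 N)) + (N%:R + 4))) + n%:R)
  else G.

Lemma runs_to_algB k t (gamma : 'M[R]_(D, t)) eps delta :
  runs_to (algB k gamma eps delta) (costB k eps delta) (fun=> True).
Proof.
elim: k t gamma eps delta => [|k IH] t gamma eps delta; first by rewrite /= subrr.
cbn [algB costB].
set N := sample_size_value _ _; set n := repetitions_value delta; set cA := costB k _ _.
set cm := loop_cost _ _.
rewrite (_ : 13 + _ = 1 + (7 + (5 + (n%:R * (cA + (cm + (N%:R + 4))) + n%:R)))); last by ring.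
apply: runs_to_op_bind; apply: runs_to_bind; first exact: runs_to_sample_size.
move=> _ ->; apply: runs_to_bind; first exact: runs_to_repetitions.
move=> _ ->; apply: (@runs_to_bind _ _ _ _ _ _ (fun l : seq R => size l = n)); last first.
  by move=> l <-; exact: runs_to_med.
apply: runs_to_repeat => i _.
rewrite (_ : cA + _ = 1 + (cA + (cm + ((N%:R + 2) + 1)))); last by ring.
apply: runs_to_op_bind; apply: runs_to_bind; first exact: IH.
move=> A3 _; apply: runs_to_bind; first by apply: runs_to_loop => t' gamma'; exact: IH.
move=> l lN; apply: runs_to_bind; first exact: runs_to_average.
by move=> m _ /=; rewrite subrr.
Qed.

End running_time.

Section logarithm_bounds.
Context (R : realType).
Implicit Types (x e eta delta : R) (N T : nat).

Lemma ln_le_sub1 x : 0 < x -> ln x <= x - 1.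
Proof. by move=> x0; rewrite -[X in ln X](subrKC 1); apply: le_ln1Dx; lra. Qed.

(** A bound sharper than 2 <= exp 1, needed for the constant 8 in
[repetitions_value_le]. *)
Lemma expR34_ge2 : 2 <= expR (3 / 4) :> R.
Proof.
rewrite (_ : 3 / 4 = 8%:R * (3 / 32)); last by field.
rewrite expRM_natl; apply: (@le_trans _ _ ((1 + 3 / 32) ^+ 8)); first by lra.
by rewrite lerXn2r ?nnegrE ?expR_ge0 ?expR_ge1Dx//; lra.
Qed.

Lemma ln2_le : ln 2 <= 3 / 4 :> R.
Proof. by rewrite -[leRHS]expRK ler_ln ?posrE ?expR_gt0// expR34_ge2. Qed.

Lemma ln_pow2_le n : ln (2 ^+ n) <= n%:R * (3 / 4) :> R.
Proof. by rewrite lnXn// -[leLHS]mulr_natl ler_wpM2l// ln2_le. Qed.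

Lemma ln_inv_ge0 delta : 0 < delta <= 1 -> 0 <= ln delta^-1.
Proof. by move=> /andP[d0 d1]; rewrite ln_ge0// invf_ge1. Qed.

Lemma repetitions_value_le delta : 0 < delta <= 1 ->
  (repetitions_value delta)%:R <= 8 * (1 + ln delta^-1).
Proof.
move=> d01; have := ln_inv_ge0 d01; have /andP[d0 d1] := d01 => l0.
have h0 : 0 <= 8 * ln (2 * (1 / delta)).
  by rewrite mulr_ge0// ln_ge0// div1r ler_pdivlMr// mul1r (le_trans d1)// ler1n.
have := nat_ceil_lt h0; rewrite -/(repetitions_value delta) div1r.
rewrite lnM ?posrE ?invr_gt0//; have := ln2_le; lra.
Qed.

Lemma sample_size_value_le e eta (c : R) : 0 < e -> 0 < eta < 2 -> ln (2 / eta) <= c ->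
  (sample_size_value e eta)%:R <= (e^-1) ^+ 2 * c / 2 + 1.
Proof.
move=> e0 /andP[eta0 eta2] hc; have e2 : 0 < e ^+ 2 by rewrite exprn_gt0.
have h : 1 / (2 * e ^+ 2) * ln (2 / eta) <= (e^-1) ^+ 2 * c / 2.
  rewrite (_ : (e^-1) ^+ 2 * c / 2 = 1 / (2 * e ^+ 2) * c); last first.
    by field; rewrite gt_eqF.
  by rewrite ler_wpM2l// divr_ge0// mulr_ge0// ltW.
have h0 : 0 <= 1 / (2 * e `^ 2) * ln (2 / eta).
  rewrite powR2; last exact: ltW.
  rewrite mulr_ge0//; first by rewrite divr_ge0// mulr_ge0// ltW.
  by rewrite ln_ge0// ler_pdivlMr// mul1r ltW.
have := nat_ceil_lt h0; rewrite -/(sample_size_value e eta).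
rewrite powR2; last exact: ltW.
by move=> /ltW /le_trans; apply; rewrite lerD2r.
Qed.

(** The inner failure probability is 1 over a monomial in 2, x and T. *)
Lemma ln_failure_prob (i j p T N : nat) x : (0 < N)%N -> (0 < T)%N -> 1 <= x ->
  N%:R <= 2 ^+ j * x ^+ p ->
  ln (failure_prob_value T (2 ^+ i) N)^-1 <= (i + j)%:R * (3 / 4) + p%:R * (x - 1) + (T%:R - 1).
Proof.
move=> N0 T0 x1 hN; have x0 : 0 < x by rewrite (lt_le_trans _ x1).
have T0' : 0 < T%:R :> R by rewrite ltr0n.
have N0' : 0 < N%:R :> R by rewrite ltr0n.
rewrite /failure_prob_value div1r invrK.
apply: (@le_trans _ _ (ln (2 ^+ (i + j) * x ^+ p * T%:R))).
  rewrite ler_ln ?posrE ?mulr_gt0 ?exprn_gt0//.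
  rewrite exprD; apply: ler_wpM2r => //; rewrite -mulrA; apply: ler_wpM2l => //.
rewrite lnM ?posrE ?mulr_gt0 ?exprn_gt0// lnM ?posrE ?exprn_gt0//.
apply: lerD; last exact: ln_le_sub1.
apply: lerD; first exact: ln_pow2_le.
rewrite lnXn// -[leLHS]mulr_natl; apply: ler_wpM2l => //; exact: ln_le_sub1.
Qed.

End logarithm_bounds.

Section cost_bounds.
Context (R : realType) (T : nat) (C G : R).
Hypotheses (hT : (1 <= T)%N) (hC : 0 <= C) (hG : 0 <= G).
Implicit Types (x eps delta : R) (k N : nat).

Let Tr : R := T%:R.
Let U : R := C + G + 1.
Let T1 : 1 <= Tr. Proof. by rewrite ler1n. Qed.

Let U0 : 0 <= U. Proof. by rewrite /U !addr_ge0. Qed.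

(** Unfolding the recursion c_(k+1)(x) = B T^2 x^3 c_k(4x) gives the factors
4^(3 (0 + 1 + ... + (k - 1))), which are below 8^(k^2). *)
Definition costB_bound k x : R :=
  U * (2 ^+ 12 * Tr ^+ 2 * x ^+ 3) ^+ k * 8 ^+ (k * k).

Let base_ge1 x : 1 <= x -> 1 <= 2 ^+ 12 * Tr ^+ 2 * x ^+ 3.
Proof.
move=> x1; have := exprn_ege1 2 T1; have := exprn_ege1 3 x1 => h3 h2.
by have := ler_pM ler01 ler01 h2 h3; rewrite mulr1; lra.
Qed.

Lemma costB_bound_ge k x : 1 <= x -> U <= costB_bound k x.
Proof.
move=> x1.
rewrite /costB_bound -mulrA; apply: ler_peMr => //.
apply: mulr_ege1; first exact: exprn_ege1 (base_ge1 x1).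
by apply: exprn_ege1; lra.
Qed.

Lemma costB_bound_le k x y : 1 <= x -> x <= y -> costB_bound k x <= costB_bound k y.
Proof.
move=> x1 xy.
have b1 := base_ge1 x1.
rewrite /costB_bound; apply: ler_wpM2r; first exact: exprn_ge0.
apply: ler_wpM2l => //; rewrite lerXn2r ?nnegrE ?(le_trans ler01)// ?(le_trans b1)//.
  apply: ler_wpM2l; first by rewrite mulr_ge0// exprn_ge0// (le_trans ler01).
  by rewrite lerXn2r ?nnegrE// (le_trans ler01)// (le_trans x1).
apply: ler_wpM2l; first by rewrite mulr_ge0// exprn_ge0// (le_trans ler01).
by rewrite lerXn2r ?nnegrE// (le_trans ler01)// (le_trans x1).
Qed.

Lemma costB_bound_nondecreasing k l x : (k <= l)%N -> 1 <= x ->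
  costB_bound k x <= costB_bound l x.
Proof.
move=> kl x1.
rewrite /costB_bound; apply: ler_pM.
- by rewrite mulr_ge0// exprn_ge0// (le_trans ler01 (base_ge1 x1)).
- exact: exprn_ge0.
- by apply: ler_wpM2l => //; apply: ler_weXn2l => //; exact: base_ge1.
- by apply: ler_weXn2l; [lra|exact: leq_mul].
Qed.

(** The summand N is the cost of the additions of the empirical mean that follows
the loop. *)
Lemma loop_cost_le N x X (c q b : R) : 1 <= x -> U <= X ->
  N%:R <= q -> 0 <= c -> b <= c * Tr * x * X ->
  loop_cost T C N b + N%:R <= q * ((c + 6) * (Tr ^+ 2 * x * X)).
Proof.
move=> x1 UX Nq c0 hb; set w := Tr ^+ 2 * x * X.
have CX : C + 1 <= X by apply: le_trans UX; rewrite /U; move: hG; lra.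
have X1 : 1 <= X by move: hC CX; lra.
have X0 : 0 <= X by rewrite (le_trans ler01).
have Xw : X <= w by rewrite /w ler_peMl// mulr_ege1// exprn_ege1.
have Tw : Tr <= w.
  rewrite /w expr2 -2!mulrA ler_peMr ?(le_trans ler01)// mulrA mulr_ege1// mulr_ege1//.
have Tb : Tr * b <= c * w.
  rewrite (_ : c * w = Tr * (c * Tr * x * X)); last by rewrite /w; ring.
  by apply: ler_wpM2l => //; exact: le_trans T1.
rewrite /loop_cost -[Y in _ + Y]mulr1 -mulrDr.
apply: (@le_trans _ _ (N%:R * ((c + 6) * w))).
  by apply: ler_wpM2l => //; rewrite -/Tr [Tr * (_ + _)]mulrDr [(c + 6) * w]mulrDl; lra.
apply: ler_wpM2r => //; apply: mulr_ge0; first by lra.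
exact: le_trans Xw.
Qed.

(** Replacing x by 4x multiplies each of the k factors x^3 by 8^2. *)
Lemma costBS_bound_ge k x : 1 <= x ->
  2 ^+ 12 * Tr ^+ 2 * x ^+ 3 * costB_bound k (4 * x) <= costB_bound k.+1 x.
Proof.
move=> x1; rewrite /costB_bound [(4 * x) ^+ 3]exprMn.
rewrite (_ : 2 ^+ 12 * _ * (4 ^+ 3 * _) = 8 ^+ 2 * (2 ^+ 12 * Tr ^+ 2 * x ^+ 3)); last by ring.
set b := 2 ^+ 12 * _ * _; rewrite exprMn -exprM.
rewrite (_ : b * _ = U * b ^+ k.+1 * 8 ^+ (2 * k + k * k)); last by rewrite exprD exprS; ring.
have b0 : 0 <= b by rewrite (le_trans ler01 (base_ge1 x1)).
apply: ler_wpM2l; first by rewrite mulr_ge0// exprn_ge0.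
by apply: ler_weXn2l; [lra|lia].
Qed.

Let ge1_inv eps : 0 < eps <= 1 -> 1 <= eps^-1.
Proof. by move=> /andP[e0 e1]; rewrite invf_ge1. Qed.

Lemma inner_sample_size_le eps : 0 < eps <= 1 ->
  (sample_size_value (eps / 4) (1 / 16))%:R <= 2 ^+ 5 * eps^-1 ^+ 2.
Proof.
move=> e01; have x1 := ge1_inv e01; have /andP[e0 _] := e01.
have h := exprn_ege1 2 x1.
have e4 : 0 < eps / 4 by rewrite divr_gt0.
have eta : 0 < (1 / 16 : R) < 2 by lra.
have hl : ln (2 / (1 / 16)) <= 15 / 4 :> R.
  have := @ln_pow2_le R 5; rewrite (_ : 2 ^+ 5 = 2 / (1 / 16)); last by field.
  lra.
apply: (le_trans (sample_size_value_le e4 eta hl)).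
by rewrite invf_div exprMn; lra.
Qed.

(** The recursive calls at precision eps/4 and failure probability 1/(16NT)
dominate: there are NT of them per repetition, with N of order x^2, each with a
factor 1 + ln(16NT) of order T x. *)
Lemma costB_le k eps delta : 0 < eps <= 1 -> 0 < delta <= 1 ->
  costB T C G k eps delta <= costB_bound k eps^-1 * (1 + ln delta^-1).
Proof.
elim: k eps delta => [|k IH] eps delta e01 d01.
  rewrite /= /costB_bound !expr0 !mulr1; have := ln_inv_ge0 d01 => l0.
  apply: (@le_trans _ _ U); first by rewrite /U; move: hC; lra.
  by rewrite ler_peMr//; lra.
have x1 := ge1_inv e01; have /andP[e0 e1] := e01; cbn [costB].
set x := eps^-1 in x1 *; set X := costB_bound k (4 * x).
set L := 1 + _; have L1 : 1 <= L by rewrite /L; have := ln_inv_ge0 d01; lra.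
set N := sample_size_value _ _; set n := repetitions_value delta.
have nL : n%:R <= 8 * L by exact: repetitions_value_le.
have NE : N%:R <= 2 ^+ 5 * x ^+ 2 by exact: inner_sample_size_le.
have N0 : (0 < N)%N by apply: sample_size_value_gt0; [rewrite divr_gt0|lra].
have x4 : 1 <= 4 * x by lra.
have UX : U <= X by exact: costB_bound_ge.
have X0 : 0 <= X by exact: le_trans UX.
have hA : costB T C G k (eps / 2) (1 / 8) <= 4 * X.
  apply: (le_trans (IH _ _ _ _)); [by rewrite divr_gt0//=; lra|lra|].
  have : costB_bound k (eps / 2)^-1 <= X.
    by apply: costB_bound_le; rewrite invf_div -/x; lra.
  have : ln (1 / 8 : R)^-1 <= 9 / 4.
    have := @ln_pow2_le R 3; rewrite (_ : 2 ^+ 3 = (1 / 8)^-1); last by field.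
    lra.
  have : 0 <= ln (1 / 8 : R)^-1 by apply: ln_inv_ge0; lra.
  move=> l0 l1 hX; rewrite [leLHS]mulrC; apply: ler_pM => //; try lra.
  by apply: le_trans (costB_bound_ge _ _); rewrite // invf_div -/x; lra.
have hB : costB T C G k (eps / 4) (failure_prob_value T 16 N) <= 8 * Tr * x * X.
  have /andP[f0 f1] : 0 < (failure_prob_value T 16 N : R) < 1.
    by apply: failure_prob_value_bounds => //; lra.
  apply: (le_trans (IH _ _ _ _)); [by rewrite divr_gt0//=; lra|by rewrite f0 ltW|].
  rewrite invf_div -/x -/X mulrC; apply: ler_wpM2r => //.
  have := @ln_failure_prob R 4 5 2 T N x N0 hT x1 NE.
  rewrite (_ : 2 ^+ 4 = 16); last by ring.
  have : Tr <= Tr * x by rewrite ler_peMr// (le_trans ler01).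
  have : x <= Tr * x by rewrite ler_peMl// (le_trans ler01).
  rewrite -/Tr; have := T1; lra.
set W := Tr ^+ 2 * x ^+ 3 * X.
set lc := loop_cost _ _ _ _; have hloop : lc + N%:R <= 448 * W.
  rewrite (_ : 448 * W = 2 ^+ 5 * x ^+ 2 * ((8 + 6) * (Tr ^+ 2 * x * X))); last by rewrite /W; ring.
  by apply: loop_cost_le.
have XW : X <= W by rewrite /W ler_peMl// mulr_ege1// exprn_ege1.
have W1 : 1 <= W by apply: le_trans XW; apply: le_trans UX; rewrite /U; move: hC hG; lra.
apply: (@le_trans _ _ (2 ^+ 12 * W * L)); last first.
  rewrite ler_wpM2r ?(le_trans ler01)// (le_trans _ (costBS_bound_ge k x1))//.
  by rewrite /W !mulrA.
have LW : 1 <= L * W by rewrite mulr_ege1.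
apply: (@le_trans _ _ (13 + n%:R * (457 * W))).
  rewrite lerD2l -[Y in _ + Y <= _]mulr1 -mulrDr; apply: ler_wpM2l => //.
  have U1 : 1 <= X by apply: le_trans UX; rewrite /U; move: hC hG; lra.
  by move: hA hloop XW W1; lra.
have : n%:R * (457 * W) <= 8 * L * (457 * W).
  by apply: ler_wpM2r nL; lra.
have : 3669 * (L * W) <= 2 ^+ 12 * (L * W).
  by apply: ler_wpM2r; lra.
by rewrite -[2 ^+ 12 * W * L]mulrA [W * L]mulrC; move: LW; lra.
Qed.

End cost_bounds.

Section outer_cost.
Context (R : realType) (T D : nat) (C G : R).
Hypotheses (hT : (1 <= T)%N) (hC : 0 <= C) (hG : 0 <= G).
Context (g : forall t : 'I_T.+1, 'M[R]_(D, t) -> R).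
Implicit Types (x eps delta : R) (k l m N : nat).

Let Tr : R := T%:R.
Let U : R := C + G + 1.
Let T1 : 1 <= Tr. Proof. by rewrite ler1n. Qed.

Lemma runs_to_algA eps delta b :
  let k := nat_ceil (2 / eps) in
  let alpha := eps / 2 * (1 / k%:R) in
  let N := sample_size_value (alpha / 2) (1 / 8) in
  let n := repetitions_value (delta * (1 / k%:R)) in
  (forall l, (l < k)%N -> costB T C G l (alpha / 2) (failure_prob_value T 8 N) <= b) ->
  runs_to C G g (algA T D eps delta)
    (14 + (k%:R * (5 + (n%:R * (loop_cost T C N b + (N%:R + 2)) + n%:R)) + k%:R))
    (fun=> True).
Proof.
move=> k alpha N n hb; rewrite /algA.
set c := k%:R * _ + _.
rewrite (_ : 14 + c = 1 + (1 + (1 + (1 + (1 + (1 + (1 + (7 + c)))))))); last by ring.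
apply: runs_to_op_bind; apply: (@runs_to_bind _ _ _ _ _ _ _ _ _ _ _ _ (fun k' => k' = k)).
  by rewrite /= subrr.
move=> _ ->; do 5 apply: runs_to_op_bind.
apply: runs_to_bind; first exact: runs_to_sample_size.
move=> _ ->; rewrite /c.
apply: (@runs_to_bind _ _ _ _ _ _ _ _ _ _ _ _ (fun l : seq R => size l = k)) => [|l <-]; last first.
  exact: runs_to_fold_op.
apply: runs_to_repeat => l /andP[l1 lk].
apply: runs_to_bind; first exact: runs_to_repetitions.
move=> _ ->; apply: (@runs_to_bind _ _ _ _ _ _ _ _ _ _ _ _ (fun l : seq R => size l = n)) => [|L <-]; last first.
  exact: runs_to_med.
apply: runs_to_repeat => i _.
apply: runs_to_bind; last by move=> L; exact: runs_to_average.
apply: runs_to_loop => t gamma; apply: runs_to_le (runs_to_algB _ _ _ _ _ _ _).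
by apply: hb; lia.
Qed.

Lemma outer_sample_size_le alpha x : 0 < alpha -> 1 <= x -> (alpha / 2)^-1 <= 12 * x ^+ 2 ->
  (sample_size_value (alpha / 2) (1 / 8))%:R <= 2 ^+ 8 * x ^+ 4.
Proof.
move=> a0 x1 hy; have h := exprn_ege1 4 x1.
have e0 : 0 < alpha / 2 by rewrite divr_gt0.
have eta : 0 < (1 / 8 : R) < 2 by lra.
have hl : ln (2 / (1 / 8)) <= 3 :> R.
  have := @ln_pow2_le R 4; rewrite (_ : 2 ^+ 4 = 2 / (1 / 8)); last by field.
  lra.
apply: (le_trans (sample_size_value_le e0 eta hl)).
have : (alpha / 2)^-1 ^+ 2 <= 144 * x ^+ 4.
  rewrite (_ : 144 * x ^+ 4 = (12 * x ^+ 2) ^+ 2); last by ring.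
  by rewrite lerXn2r ?nnegrE ?invr_ge0 ?(ltW e0)// (le_trans _ hy)// invr_ge0 ltW.
lra.
Qed.

(** The arithmetic of the outer loop, with constants rounded up to powers of 2 and
L(delta/k) bounded by k L(delta). *)
Lemma outer_total_le (x L Lb W lc k n N : R) :
  1 <= x -> 1 <= L -> 1 <= W -> 1 <= Lb -> 1 <= k -> k <= 3 * x -> Lb <= k * L ->
  0 <= n -> n <= 8 * Lb -> lc + N <= 2 ^+ 12 * W ->
  14 + (k * (5 + (n * (lc + (N + 2)) + n)) + k) <= 2 ^+ 22 * (x ^+ 2 * (L * W)).
Proof.
move=> x1 L1 W1 Lb1 k1 kx LbL n0 nL.
set c : R := 2 ^+ 12; have c8 : 8 <= c.
  by rewrite /c (_ : 12 = 3 + 9)%N // exprD; have := @exprn_ege1 R 9 2; lra.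
have -> : 2 ^+ 22 * (x ^+ 2 * (L * W)) = 64 * c * (16 * (x ^+ 2 * (L * W))).
  by rewrite /c (_ : 22 = 10 + 12)%N // exprD; ring.
clearbody c => hloop.
have h1 : lc + (N + 2) + 1 <= 2 * (c * W).
  have : 8 * W <= c * W by apply: ler_wpM2r; lra.
  lra.
have LW : 1 <= Lb * W by rewrite mulr_ege1.
have cLW : 8 <= c * (Lb * W) by rewrite (le_trans c8)// ler_peMr//; lra.
have h2 : n * (lc + (N + 2)) + n <= 16 * (c * (Lb * W)).
  rewrite -[Y in _ + Y]mulr1 -mulrDr.
  rewrite (_ : 16 * _ = 8 * Lb * (2 * (c * W))); last by ring.
  apply: (@le_trans _ _ (n * (2 * (c * W)))); first exact: ler_wpM2l.
  have cW0 : 0 <= c * W by apply: mulr_ge0; lra.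
  by apply: ler_wpM2r nL; lra.
have h3 : k * (5 + (n * (lc + (N + 2)) + n)) + k <= k * (32 * (c * (Lb * W))).
  by rewrite -[Y in _ + Y]mulr1 -mulrDr; apply: ler_wpM2l; lra.
have h4 : k * (32 * (c * (Lb * W))) + 14 <= 64 * c * (k * (Lb * W)).
  have : 8 <= k * (c * (Lb * W)) by rewrite (le_trans cLW)// ler_peMl//; lra.
  lra.
have h5 : k * (Lb * W) <= 16 * (x ^+ 2 * (L * W)).
  rewrite mulrA (_ : 16 * _ = 16 * x ^+ 2 * L * W); last by ring.
  apply: ler_wpM2r; first lra.
  apply: (@le_trans _ _ (3 * x * (3 * x * L))).
    apply: ler_pM => //; try lra.
    by apply: (le_trans LbL); apply: ler_wpM2r; lra.
  rewrite (_ : 3 * x * _ = 9 * (x ^+ 2 * L)); last by ring.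
  have : 0 <= x ^+ 2 * L by rewrite mulr_ge0 ?exprn_ge0//; lra.
  lra.
have : 64 * c * (k * (Lb * W)) <= 64 * c * (16 * (x ^+ 2 * (L * W))).
  by apply: ler_wpM2l h5; lra.
by move: h3 h4; set a1 := _ * (5 + _); set a2 := k * (32 * _); lra.
Qed.

Lemma costB_bound_outer m x : 1 <= x ->
  costB_bound T C G m (12 * x ^+ 2) <=
  U * ((2 ^+ 23 * Tr ^+ 2 * x ^+ 6) ^+ m * 8 ^+ (m * m)).
Proof.
move=> x1; rewrite /costB_bound -/Tr -/U -mulrA.
apply: ler_wpM2l; first by rewrite /U !addr_ge0.
apply: ler_wpM2r; first exact: exprn_ge0.
pose z : R := 2 ^+ 18 * Tr ^+ 2 * x ^+ 6.
have z0 : 0 <= z.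
  have x0 : 0 <= x := le_trans ler01 x1.
  have Tr0 : 0 <= Tr := le_trans ler01 T1.
  exact: (mulr_ge0 (mulr_ge0 (exprn_ge0 18 (ler0n R 2)) (exprn_ge0 2 Tr0)) (exprn_ge0 6 x0)).
have -> : 2 ^+ 12 * Tr ^+ 2 * (12 * x ^+ 2) ^+ 3 = 27 * z by rewrite /z; ring.
have -> : 2 ^+ 23 * Tr ^+ 2 * x ^+ 6 = 32 * z by rewrite /z; ring.
by clearbody z; apply: lerXn2r; rewrite ?nnegrE; lra.
Qed.

(** Here m is the highest level of the recursive calls, and x the inverse of the
precision. *)
Definition costA_bound m x : R :=
  U * (2 ^+ 22 * x ^+ 7 * Tr ^+ 2 * (2 ^+ 23 * Tr ^+ 2 * x ^+ 6) ^+ m * 8 ^+ (m * m)).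

(** The precision of the calls is eps/(4k) with k at most 3x, so its inverse is
at most 12 x^2; this is the source of the sixth power of x in the bound. *)
Lemma runs_to_algA_bound eps delta : 0 < eps < 1 -> 0 < delta < 1 ->
  runs_to C G g (algA T D eps delta)
    (costA_bound (nat_ceil (2 / eps)).-1 eps^-1 * (1 + ln delta^-1)) (fun=> True).
Proof.
move=> /andP[e0 e1] /andP[d0 d1]; set x := eps^-1.
have x1 : 1 <= x by rewrite invf_ge1// ltW.
set k := nat_ceil _; set m := k.-1.
have hk : 2 * x <= k%:R by apply: nat_ceil_ge; rewrite mulr_ge0// (le_trans ler01).
have hk3 : k%:R <= 3 * x.
  have := @nat_ceil_lt R (2 * x); rewrite -/k => /(_ _)/ltW h.
  by apply: (le_trans (h _)); [rewrite mulr_ge0// (le_trans ler01)|lra].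
have k0 : 0 < k%:R :> R by lra.
have k1 : 1 <= k%:R :> R by rewrite ler1n -(ltr0n R).
set alpha := eps / 2 * (1 / k%:R); set beta := delta * (1 / k%:R).
have a0 : 0 < alpha by rewrite mulr_gt0// divr_gt0.
have yE : (alpha / 2)^-1 = 4 * k%:R * x.
  by rewrite /alpha /x; field; rewrite !gt_eqF.
have y12 : (alpha / 2)^-1 <= 12 * x ^+ 2.
  rewrite yE expr2 (_ : 12 * _ = 4 * (3 * x) * x); last by ring.
  by apply: ler_wpM2r; [lra|apply: ler_wpM2l].
have y1 : 1 <= (alpha / 2)^-1.
  rewrite yE -mulrA; have : 1 <= k%:R * x by rewrite mulr_ege1.
  lra.
have al1 : 0 < alpha / 2 <= 1.
  by rewrite divr_gt0//= -[alpha / 2]invrK invf_le1// (lt_le_trans ltr01).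
set N := sample_size_value (alpha / 2) (1 / 8).
have NE : N%:R <= 2 ^+ 8 * x ^+ 4 by exact: outer_sample_size_le.
have N0 : (0 < N)%N by apply: sample_size_value_gt0; lra.
set X := costB_bound T C G m (12 * x ^+ 2).
have x2 : 1 <= x ^+ 2 by exact: exprn_ege1.
have UX : U <= X by apply: costB_bound_ge => //; lra.
have X1 : 1 <= X by apply: le_trans UX; rewrite /U; move: hC hG; lra.
have X0 : 0 <= X by lra.
set n := repetitions_value beta.
set Lb := 1 + ln beta^-1; set L := 1 + ln delta^-1.
have d01 : 0 < delta <= 1 by rewrite d0 ltW.
have L1 : 1 <= L by have := ln_inv_ge0 d01; rewrite /L; lra.
have b01 : 0 < beta <= 1.
  have v1 : 1 / k%:R <= 1 :> R by rewrite div1r invf_le1.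
  have v0 : 0 < 1 / k%:R :> R by rewrite divr_gt0.
  by rewrite /beta mulr_gt0//= mulr_ile1// ltW.
have Lb1 : 1 <= Lb by have := ln_inv_ge0 b01; rewrite /Lb; lra.
have nL : n%:R <= 8 * Lb by exact: repetitions_value_le.
have LbL : Lb <= k%:R * L.
  rewrite /Lb /beta div1r invfM invrK lnM ?posrE ?invr_gt0//.
  have := ln_le_sub1 k0.
  have : 0 <= (k%:R - 1) * (L - 1) by apply: mulr_ge0; lra.
  rewrite /L; lra.
have hB l : (l < k)%N ->
    costB T C G l (alpha / 2) (failure_prob_value T 8 N) <= 10 * Tr * x * X.
  move=> lk; have /andP[f0 f1] : 0 < (failure_prob_value T 8 N : R) < 1.
    by apply: failure_prob_value_bounds => //; lra.
  apply: (le_trans (costB_le hT hC hG _ _ _)); [exact: al1|by rewrite f0 ltW|].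
  have h1 : costB_bound T C G l (alpha / 2)^-1 <= X.
    apply: (@le_trans _ _ (costB_bound T C G m (alpha / 2)^-1)).
      have lm : (l <= m)%N by rewrite -ltnS (ltn_predK lk).
      exact: (costB_bound_nondecreasing hT hC hG lm y1).
    exact: (costB_bound_le hT hC hG m y1 y12).
  have h2 : 1 + ln (failure_prob_value T 8 N)^-1 <= 10 * Tr * x.
    have := @ln_failure_prob R 3 8 4 T N x N0 hT x1 NE.
    rewrite (_ : 2 ^+ 3 = 8); last by ring.
    have : Tr <= Tr * x by rewrite ler_peMr// (le_trans ler01).
    have : x <= Tr * x by rewrite ler_peMl// (le_trans ler01).
    rewrite -/Tr; have := T1; lra.
  rewrite [leLHS]mulrC; apply: (@le_trans _ _ (10 * Tr * x * costB_bound T C G l (alpha / 2)^-1)).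
    apply: ler_wpM2r => //.
    by apply: le_trans (costB_bound_ge _ _ _ _ _) => //; rewrite !addr_ge0.
  by apply: ler_wpM2l => //; rewrite !mulr_ge0//; lra.
have := @runs_to_algA eps delta (10 * Tr * x * X) hB.
rewrite -/x -/k -/alpha -/beta -/N -/n; apply: runs_to_le.
set W := Tr ^+ 2 * x ^+ 5 * X.
set lc := loop_cost _ _ _ _; have hloop : lc + N%:R <= 2 ^+ 12 * W.
  rewrite (_ : 2 ^+ 12 * W = 2 ^+ 8 * x ^+ 4 * ((10 + 6) * (Tr ^+ 2 * x * X))); last by rewrite /W; ring.
  exact: (loop_cost_le hT hC hG x1 UX NE (ler0n _ _) (lexx _)).
have W1 : 1 <= W by rewrite /W mulr_ege1// mulr_ege1// exprn_ege1.
apply: (le_trans (outer_total_le x1 L1 W1 Lb1 k1 hk3 LbL (ler0n _ _) nL hloop)).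
have hX := costB_bound_outer m x1; rewrite -/X in hX.
rewrite /costA_bound -/Tr; set B := _ ^+ m * _ in hX *.
rewrite /W (_ : 2 ^+ 22 * (_ * _) = (2 ^+ 22 * x ^+ 7 * Tr ^+ 2 * L) * X); last by ring.
rewrite (_ : U * _ * L = (2 ^+ 22 * x ^+ 7 * Tr ^+ 2 * L) * (U * B)); last by rewrite /B; ring.
have x0 : 0 <= x := le_trans ler01 x1.
have L0 : 0 <= L := le_trans ler01 L1.
apply: ler_wpM2l hX; apply: mulr_ge0 L0.
have Tr0 : 0 <= Tr := le_trans ler01 T1.
exact: (mulr_ge0 (mulr_ge0 (exprn_ge0 22 (ler0n R 2)) (exprn_ge0 7 x0)) (exprn_ge0 2 Tr0)).
Qed.

(** Powers of x and of 2 are compared with exponentials by x <= exp(x - 1) and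
2 <= exp(3/4); all the exponents are at most quadratic in x once m <= 2x. *)
Lemma costA_bound_le m x : 1 <= x -> m%:R <= 2 * x ->
  costA_bound m x <= U * (expR (100 * x ^+ 2) * Tr `^ (8 * x)).
Proof.
move=> x1 mx; have U0 : 0 <= U by rewrite /U !addr_ge0.
have x0 : 0 <= x by lra.
rewrite /costA_bound; apply: ler_wpM2l => //.
rewrite (_ : _ * 8 ^+ _ = 2 ^+ (22 + 23 * m + 3 * (m * m)) * x ^+ (7 + 6 * m) * Tr ^+ (2 + 2 * m)); last first.
  have -> : 8 ^+ (m * m) = 2 ^+ (3 * (m * m)) :> R.
    by rewrite [in RHS]exprM; congr (_ ^+ _); ring.
  rewrite [(_ * _ * _) ^+ m]exprMn [(_ * _) ^+ m]exprMn.
  rewrite -[(2 ^+ 23) ^+ m]exprM -[(Tr ^+ 2) ^+ m]exprM -[(x ^+ 6) ^+ m]exprM.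
  rewrite [2 ^+ (22 + _ + _)]exprD [2 ^+ (22 + _)]exprD.
  rewrite [x ^+ (_ + _)]exprD [Tr ^+ (_ + _)]exprD.
  move: (2 ^+ 22) (2 ^+ (23 * m)) (2 ^+ (3 * (m * m))) => c1 c2 c3.
  by move: (x ^+ (6 * m)) (x ^+ 7) (Tr ^+ 2) (Tr ^+ (2 * m)) => c4 c5 c6 c7; ring.
have pow2 n : 2 ^+ n <= expR (n%:R * (3 / 4)) :> R.
  rewrite expRM_natl lerXn2r ?nnegrE ?expR_ge0//; exact: expR34_ge2.
have powx n : x ^+ n <= expR (n%:R * (x - 1)).
  rewrite expRM_natl lerXn2r ?nnegrE ?expR_ge0//.
  by have := expR_ge1Dx (x - 1); rewrite addrC subrK.
have Tr0 : 0 <= Tr := le_trans ler01 T1.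
apply: ler_pM; [by apply: mulr_ge0; exact: exprn_ge0|exact: exprn_ge0| |].
  apply: (@le_trans _ _ (expR ((22 + 23 * m + 3 * (m * m))%:R * (3 / 4)) *
      expR ((7 + 6 * m)%:R * (x - 1)))).
    by apply: ler_pM; [exact: exprn_ge0|exact: exprn_ge0|exact: pow2|exact: powx].
  rewrite -expRD ler_expR !natrD !natrM.
  set M : R := m%:R in mx *; have M0 : 0 <= M by exact: ler0n.
  have MM : M * M <= 2 * x * (2 * x) by apply: ler_pM.
  have Mx : M * (x - 1) <= 2 * x * (x - 1) by apply: ler_wpM2r; lra.
  have xx : x <= x * x by rewrite ler_peMr.
  by rewrite [x ^+ 2]expr2; lra.
rewrite -(powR_mulrn _ Tr0); apply: ler_powR => //.
by rewrite natrD natrM; lra.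
Qed.

End outer_cost.

(** * The approximation theorem *)

Theorem theorem3 (R : realType) (d : measure_display) (Omega : measurableType d)
  (P : probability Omega R) (T D : nat) (hT : (1 <= T)%N) (hD : (1 <= D)%N)
  (Y : Omega -> 'M[R]_(D, T)) (mY : measurable_fun setT Y)
  (g : forall t : 'I_T.+1, 'M[R]_(D, t) -> R)
  (mg : forall t : 'I_T.+1, (1 <= t)%N -> measurable_fun setT (g t))
  (kappa : forall t : 'I_T.+1, R.-pker 'M[R]_(D, t) ~> 'M[R]_(D, T))
  (hkappa : forall t : 'I_T.+1, conditional_law P Y (kappa t))
  (C G : R) (hC : 0 <= C) (hG : 0 <= G)
  (hOPT : (0 < OPT P Y g)%E)
  (hZ : forall t : 'I_T.+1, (1 <= t)%N ->
     {ae P, forall w, 0 <= stop_reward Y g t w <= 1})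
  (eps delta : R) (heps : 0 < eps < 1) (hdelta : 0 < delta < 1) :
  runs_within C G g (algA T D eps delta)
    ((C + G + 1) * (1 + ln delta^-1) * expR (100 * eps ^- 2)
       * T%:R `^ (8 * eps^-1)) /\
  exists X : probability R R,
    output_law g kappa (algA T D eps delta) X /\
    ((1 - delta)%:E <= X [set x : R | (`|x%:E - OPT P Y g| <= eps%:E)%E])%E.
Proof.
have /andP[e0 e1] := heps; have /andP[d0 d1] := hdelta; split.
  have x1 : 1 <= eps^-1 by rewrite invf_ge1// ltW.
  apply: (@runs_to_within _ _ _ _ _ _ _ _ _ (fun=> True)).
  apply: runs_to_le (runs_to_algA_bound hT hC hG g heps hdelta).
  rewrite [leRHS](_ : _ = (C + G + 1) *
    (expR (100 * eps ^- 2) * T%:R `^ (8 * eps^-1)) * (1 + ln delta^-1)); last by ring.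
  apply: ler_wpM2r.
    by have := @ln_inv_ge0 _ delta; rewrite d0 ltW// => /(_ isT); lra.
  rewrite -exprVn; apply: costA_bound_le => //.
  have h0 : 0 <= 2 / eps by rewrite divr_ge0// ltW.
  by have := nat_ceil_lt h0; case: (nat_ceil _) => [//|n] /=; rewrite -natr1; lra.
have [V OPTV _] := OPT_expansion hT mY mg hkappa hZ 0.
have E : [set x : R | (`|x%:E - OPT P Y g| <= eps%:E)%E] = ~` [set x | eps < `|x - V|].
  apply/seteqP; split => x; rewrite OPTV /mkset /= lee_fin.
    by move=> h /lt_geF; rewrite h.
  by move=> /negP; rewrite -leNgt.
rewrite E; apply: (algA_output_law mg); first by apply: measurableC; exact: measurable_dist_gt.
by rewrite setCK; exact: (pr_algA hT mY mg hkappa hZ heps hdelta OPTV).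
Qed.
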